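(* There exists $\varepsilon_0>0$ such that the following holds for every $0<\varepsilon\le\varepsilon_0$ and every $C>0$. Let $(u,u_t,n,v)\in C\left(\mathbb{R}^+,H^1(\mathbb{R})\times L^2(\mathbb{R})\times L^2(\mathbb{R})\times L^2(\mathbb{R})\right)$ be a solution of the Klein-Gordon-Zakharov system $$u_{tt}-u_{xx}+u=-nu,\qquad n_t+v_x=0,\qquad v_t+\left(n+|u|^2\right)_x=0,$$ with finite energy $E_{KG}<\infty$, such that $u(t,\cdot)$ is odd for all $t\ge0$ and $$\sup_{t\ge0}\|u(t)\|_{H^1(\mathbb{R})}\le\varepsilon\quad\text{and}\quad\sup_{t\ge0}\|u_t(t)\|_{L^2(\mathbb{R})}\le C .$$ Then, for every compact interval $I\subset\mathbb{R}$, $$\lim_{t\to\infty}\left(\|u(t)\|_{H^1(I)}+\|u_t(t)\|_{L^2(I)}+\|n(t)\|_{L^2(I)}+\|v(t)\|_{L^2(I)}\right)=0 .$$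
   Context: Here $(t,x)\in\mathbb{R}^+\times\mathbb{R}$ with $\mathbb{R}^+=[0,\infty)$, and $u,n,v$ are real-valued. The system is the first-order (in the wave component) form of $u_{tt}-u_{xx}+u=-nu$, $n_{tt}-n_{xx}=(|u|^2)_{xx}$. Its flow preserves the energy $$E_{KG}=\int_{\mathbb{R}}|u|^2+|u_x|^2+|u_t|^2+\tfrac12\left(|n|^2+|v|^2\right)+n|u|^2\,dx$$ and the momentum $P_{KG}=\int_{\mathbb{R}}u_tu_x\,dx-\tfrac12\int_{\mathbb{R}}vn\,dx$. *)

(* Defs.v *)
From HB Require Import structures.
From mathcomp Require Export all_boot all_order all_algebra.
From mathcomp Require Export all_classical all_reals all_analysis.
Set Implicit Arguments.
Unset Strict Implicit.
Unset Printing Implicit Defensive.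
Export Order.TTheory GRing.Theory Num.Theory.
Export numFieldNormedType.Exports.

#[global] Open Scope classical_set_scope.
#[global] Open Scope ring_scope.

(** * Sobolev spaces on the line

    Elements of [L^2(R)] and [H^1(R)] are represented by (Borel) functions
    [R -> R]; nothing below depends on the representative of a class. *)

(** Smooth compactly supported functions. *)
Definition test_function (R : realType) (phi : R -> R) : Prop :=
  (forall k x, derivable (derive1n k phi) x 1) /\
  compact (closure [set x | phi x != 0]).

Definition pairing (R : realType) (f phi : R -> R) : R :=
  \int[@lebesgue_measure R]_x (f x * phi x).

Definition L2 (R : realType) : set (R -> R) :=
  [set f | f \in Lfun (@lebesgue_measure R) 2%:E].

Definition weak_derivative (R : realType) (f g : R -> R) : Prop :=
  forall phi, test_function phi -> pairing f (derive1 phi) = - pairing g phi.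

Definition H1 (R : realType) : set (R -> R) :=
  [set f | L2 f /\ exists2 g, L2 g & weak_derivative f g].

(** Only meaningful on [H1], where it is unique up to a null set. *)
Definition wderiv (R : realType) (f : R -> R) : R -> R :=
  xget (cst 0) [set g | L2 g /\ weak_derivative f g].

(** Norms of the restriction to a measurable set [D]; [H1norm D f] is to be used
    for [f] in [H1] only, with [D] an interval. *)
Definition L2norm (R : realType) (D : set R) (f : R -> R) : \bar R :=
  'N[@lebesgue_measure R]_2%:E [EFin \o (f \_ D)].

Definition H1norm (R : realType) (D : set R) (f : R -> R) : \bar R :=
  ((L2norm D f ^+ 2 + L2norm D (wderiv f) ^+ 2) `^ 2^-1)%E.

(** * The Klein-Gordon-Zakharov system

    [w t] is the state of the field [w] at time [t]; values at negative times
    are never used. *)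

(** Continuity of [w : [0, +oo[ -> X], where [X] is the space with norm [N]. *)
Definition time_continuous (R : realType) (N : (R -> R) -> \bar R)
    (w : R -> R -> R) : Prop :=
  forall t : R, 0 <= t ->
    N (w s \- w t) @[s --> within [set s | 0 <= s] (nbhs t)] --> 0%E.

Definition KGZ_energy (R : realType) (u ut n v : R -> R) : \bar R :=
  (\int[@lebesgue_measure R]_x
    (u x ^+ 2 + wderiv u x ^+ 2 + ut x ^+ 2 +
     2^-1 * (n x ^+ 2 + v x ^+ 2) + n x * u x ^+ 2)%:E)%E.

(** Solutions in [C(R^+, H^1 x L^2 x L^2 x L^2)]. The equations
    [u_t = ut], [ut_t = u_xx - u - n u], [n_t = - v_x],
    [v_t = - (n + u^2)_x] hold in the space of distributions on the line, at
    every positive time: [x]-derivatives are moved to the test function. *)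
Record KGZ_solution (R : realType) (u ut n v : R -> R -> R) : Prop := {
  KGZ_mem : forall t : R, 0 <= t ->
    [/\ H1 (u t), L2 (ut t), L2 (n t) & L2 (v t)] ;
  KGZ_cont : [/\ time_continuous (H1norm setT) u,
                 time_continuous (L2norm setT) ut,
                 time_continuous (L2norm setT) n &
                 time_continuous (L2norm setT) v] ;
  KGZ_eq : forall phi, test_function phi -> forall t : R, 0 < t ->
    [/\ is_derive t (1 : R) (fun s => pairing (u s) phi)
          (pairing (ut t) phi),
        is_derive t (1 : R) (fun s => pairing (ut s) phi)
          (pairing (u t) (derive1n 2 phi) - pairing (u t) phi
           - pairing (n t \* u t) phi),
        is_derive t (1 : R) (fun s => pairing (n s) phi)
          (pairing (v t) (derive1 phi)) &
        is_derive t (1 : R) (fun s => pairing (v s) phi)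
          (pairing (fun x => n t x + u t x ^+ 2) (derive1 phi))]
}.

(* Main.v *)
(** Put [p = u_x] and [q = u_t]. The fields [q ± p], [n ± v], [u] and [u^2] all solve scalar
    transport equations [f_t = sg f_x + s] with a source [s] in L^2. For fixed [t] the map
    [h |-> f (t + h, x - sg h)] is differentiable in L^2: this is read off the weak equation by
    duality, testing against the dense class of translated test functions. Hence
    [d/dt int psi f g = - sg int psi' f g + int psi (s g + f z)] for two solutions with the same
    [sg] and a bounded weight [psi], with no mollification; the case of functions independent of
    [t] is the product rule for weak derivatives. This yields the evolution of every weighted
    quadratic quantity below and the conservation of the energy.

    Up to sign the virial functional is
    [int tanh (q p - n v / 2) + 1/2 int sech^2 u q]. Its derivative is the quadratic form
    [int sech^2 (p^2 - tanh u p + (n^2 + v^2) / 4)] plus the cubic term [1/2 int sech^2 n u^2].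
    As [u] is odd, [sgn(x) u] is again in H^1, so that integrals of [(psi u (sgn u))_x] and
    [(psi u^2)_x] vanish; adding suitable ones makes the integrand of the quadratic form pointwise
    coercive. The cubic term is absorbed by [n^2] and [u^4], and [u^4] by another exact derivative
    and the smallness of [u]. A small multiple of [int sech^4 u q] adds [q^2]. The functional is
    bounded by the conserved energy, so a local energy [F] is integrable in time, while [|F'|] is
    bounded by the derivative of the functional; therefore [F] tends to 0. *)

(* Why oddness is needed: with zeta = sech(x) u, integration by parts turns int sech^2 (p^2 - tanh u
   p) into int (zeta'^2 - sech^2 zeta^2 / 2), and the operator - d^2/dx^2 - sech^2 / 2 has a
   negative eigenvalue with an even ground state. On a half-line with zeta(0) = 0 this direction is
   gone, and positivity becomes pointwise after adding the derivative of y zeta^2, where y solves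
   the Riccati inequality y' >= y^2 + sech^2 / 2. A bounded such y on [0, +oo[ increases to a limit
   <= 0, so y(0) < 0 and its odd extension jumps at 0. This is why sgn(x) u has to be handled as an
   H^1 function. The tanh-weighted part of the functional is the localized momentum P_KG; the
   correction sech^2 u q trades its -q^2 for -p^2. Every cubic term is a field times u^2, so Young's
   inequality and sup u^2 <= 1/200 suffice. Smallness of u in H^1 alone thus fixes the threshold,
   whatever the size of u_t, n and v. *)
Require Import Defs.
From mathcomp Require Import measurable_realfun ring lra.
Set Implicit Arguments.
Unset Strict Implicit.
Unset Printing Implicit Defensive.

(** * Square-integrable functions *)

Section L2basics.
Context {R : realType}.
Local Notation mu := (@lebesgue_measure R).
Implicit Types f g h a : R -> R.

Lemma ae_imply (P Q : R -> Prop) : (forall x, P x -> Q x) ->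
  {ae mu, forall x, P x} -> {ae mu, forall x, Q x}.
Proof. by move=> PQ; apply: filterS => //; exact: (ae_filter_ringOfSetsType mu). Qed.

Definition intg f := mu.-integrable setT (EFin \o f).
Definition Int f : R := \int[mu]_x f x.
Definition nrm f : R := Num.sqrt (Int (fun x => f x ^+ 2)).

Lemma L2_measurable f : L2 f -> measurable_fun setT f.
Proof. by rewrite /L2/= inE => /andP[]; rewrite inE. Qed.

Lemma L2_sqr f : L2 f -> intg (fun x => f x ^+ 2).
Proof. exact: Lfun2_integrable_sqr. Qed.

Lemma L2normE f : L2norm setT f = ((\int[mu]_x (f x ^+ 2)%:E) `^ 2^-1)%E.
Proof.
rewrite /L2norm unlock; congr (_ `^ _)%E.
apply: eq_integral => x _ /=.
by rewrite patch_setT powR_mulrn// real_normK// num_real.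
Qed.

Lemma intg_measurable f : intg f -> measurable_fun setT f.
Proof. by move=> /integrableP[/measurable_EFinP]. Qed.

Lemma L2P f : measurable_fun setT f -> intg (fun x => f x ^+ 2) -> L2 f.
Proof.
move=> mf /integrableP[_ i2]; rewrite /L2/= inE; apply/andP; split; rewrite inE//=.
rewrite /finite_norm.
have := L2normE f; rewrite /L2norm patch_setT => ->.
rewrite poweR_lty//; apply: le_lt_trans i2.
rewrite le_eqVlt; apply/orP; left; apply/eqP.
by apply: eq_integral => x _ /=; rewrite ger0_norm// sqr_ge0.
Qed.

Lemma intg_ae_le f g : measurable_fun setT f -> intg g ->
  {ae mu, forall x, `|f x| <= g x} -> intg f.
Proof.
(* The bound holds only almost everywhere; [k] is [f] cut to 0 where it fails, hence is dominated
   everywhere and equal to [f] almost everywhere. *)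
move=> mf ig fg; pose k x := if `|f x| <= g x then f x else 0.
have mg := intg_measurable ig.
have mS : measurable [set x | `|f x| <= g x].
  rewrite -[X in measurable X]setTI; apply: measurable_fun_le => //.
  exact: measurableT_comp.
have fk : {ae mu, forall x, f x = k x}.
  by apply: ae_imply fg => x; rewrite /k => ->.
have mk : measurable_fun setT k.
  have -> : k = f \_ [set x | `|f x| <= g x].
    apply/funext => x; rewrite /k patchE; case: ifPn => h.
      by rewrite mem_set.
    by rewrite memNset//=; apply/negP.
  by apply/(measurable_restrictT _ _).1 => //; exact: measurable_funTS.
have ik : intg k.
  apply: le_integrable ig => //; first exact/measurable_EFinP.
  move=> x _ /=; rewrite lee_fin /k; case: ifPn => [h|_].
    by rewrite (le_trans h)// ler_norm.
  by rewrite normr0.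
move/integrableP : ik => [_ ik]; apply/integrableP; split; first exact/measurable_EFinP.
apply: le_lt_trans ik; rewrite le_eqVlt; apply/orP; left; apply/eqP.
apply: ae_eq_integral => //.
- by apply: measurableT_comp => //; exact/measurable_EFinP.
- by apply: measurableT_comp => //; exact/measurable_EFinP.
- by apply: ae_imply fk => x /= ->.
Qed.

Lemma intg_le f g : measurable_fun setT f -> intg g ->
  (forall x, `|f x| <= g x) -> intg f.
Proof. by move=> mf ig fg; apply: (intg_ae_le mf ig); exact: aeW. Qed.

Lemma intgD f g : intg f -> intg g -> intg (fun x => f x + g x).
Proof. by move=> fi gi; have := integrableD measurableT fi gi. Qed.

Lemma intgB f g : intg f -> intg g -> intg (fun x => f x - g x).
Proof. by move=> fi gi; have := integrableB measurableT fi gi. Qed.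

Lemma intgZ c f : intg f -> intg (fun x => c * f x).
Proof. by move=> fi; have := integrableZl measurableT c fi. Qed.

Lemma intgN f : intg f -> intg (fun x => - f x).
Proof. by move=> fi; have := integrableN fi. Qed.

Lemma intg_norm f : intg f -> intg (fun x => `|f x|).
Proof. by move=> fi; have := integrable_norm fi. Qed.

Lemma intg0 : intg (fun=> 0).
Proof. exact: integrable0. Qed.

Lemma intg_eq f g : f =1 g -> intg f -> intg g.
Proof. by move=> /funext ->. Qed.

Lemma IntD f g : intg f -> intg g -> Int (fun x => f x + g x) = Int f + Int g.
Proof. by move=> fi gi; rewrite /Int RintegralD. Qed.

Lemma IntB f g : intg f -> intg g -> Int (fun x => f x - g x) = Int f - Int g.
Proof. by move=> fi gi; rewrite /Int RintegralB. Qed.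

Lemma IntZ c f : intg f -> Int (fun x => c * f x) = c * Int f.
Proof. by move=> fi; rewrite /Int RintegralZl. Qed.

Lemma Int0 : Int (fun=> 0) = 0.
Proof. by rewrite /Int /Rintegral integral0. Qed.

Lemma IntN f : intg f -> Int (fun x => - f x) = - Int f.
Proof.
by move=> fi; rewrite -[RHS]mulN1r -IntZ//; congr Int; apply/funext => x; rewrite mulN1r.
Qed.

Lemma eq_Int f g : f =1 g -> Int f = Int g.
Proof. by move=> /funext ->. Qed.

Lemma eq_Int_ae f g : measurable_fun setT f -> measurable_fun setT g ->
  {ae mu, forall x, f x = g x} -> Int f = Int g.
Proof.
move=> mf mg fg; rewrite /Int /Rintegral; congr fine.
apply: ae_eq_integral => //; [exact/measurable_EFinP|exact/measurable_EFinP|].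
by apply: ae_imply fg => x /= ->.
Qed.

Lemma Int_ge0 f : (forall x, 0 <= f x) -> 0 <= Int f.
Proof. by move=> f0; apply: Rintegral_ge0. Qed.

Lemma le_Int_ae f g : intg f -> intg g -> {ae mu, forall x, f x <= g x} ->
  Int f <= Int g.
Proof.
move=> fi gi fg; rewrite -subr_ge0 -IntB//.
rewrite (@eq_Int_ae _ (fun x => `|g x - f x|)).
- by apply: Int_ge0 => x.
- exact: intg_measurable (intgB gi fi).
- exact: intg_measurable (intg_norm (intgB gi fi)).
- by apply: ae_imply fg => x h; rewrite ger0_norm// subr_ge0.
Qed.

Lemma le_Int f g : intg f -> intg g -> (forall x, f x <= g x) -> Int f <= Int g.
Proof. by move=> fi gi fg; apply: le_Int_ae => //; exact: aeW. Qed.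

Lemma Int_fin f : intg f -> (Int f)%:E = (\int[mu]_x (f x)%:E)%E.
Proof. by move=> fi; rewrite /Int /Rintegral fineK//; apply: integrable_fin_num. Qed.

Lemma Int_eq0_ae f : intg f -> (forall x, 0 <= f x) -> Int f = 0 ->
  {ae mu, forall x, f x = 0}.
Proof.
move=> fi f0 If; have := Int_fin fi; rewrite If => /esym I0.
have mf := intg_measurable fi.
have : (\int[mu]_x `|(f x)%:E| = 0)%E.
  by apply: etrans I0; apply: eq_integral => x _ /=; rewrite ger0_norm.
have mE : measurable_fun setT (fun x => (f x)%:E) by exact/measurable_EFinP.
move/(ae_eq_integral_abs mu measurableT mE); apply: ae_imply => x /(_ I) /=.
by case.
Qed.

Lemma Int_dct (f_ : nat -> R -> R) f g :
  (forall n, measurable_fun setT (f_ n)) -> measurable_fun setT f -> intg g ->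
  {ae mu, forall x, f_ n x @[n --> \oo] --> f x} ->
  (forall n x, `|f_ n x| <= g x) ->
  Int (f_ n) @[n --> \oo] --> Int f.
Proof.
move=> mf_ mf ig cf le.
have h1 n : measurable_fun setT (EFin \o f_ n) by apply/measurable_EFinP.
have h2 : measurable_fun setT (EFin \o f) by apply/measurable_EFinP.
have h3 : {ae mu, forall x, setT x -> (EFin \o f_ n) x @[n --> \oo] --> (EFin \o f) x}.
  by apply: ae_imply cf => x fx _; apply/cvg_EFin; [exact: nearW|exact: fx].
have h4 : {ae mu, forall x n, setT x -> (`|(EFin \o f_ n) x| <= (EFin \o g) x)%E}.
  by apply: aeW => x n _ /=; rewrite lee_fin.
have [fi _] := @dominated_convergence _ _ R mu setT measurableT (fun n => EFin \o f_ n)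
  (EFin \o f) (EFin \o g) h1 h2 h3 ig h4.
rewrite /Int /Rintegral => h.
by have /fine_cvgP[_] : (\int[mu]_x (f_ n x)%:E @[n --> \oo] -->
    (fine (\int[mu]_x (f x)%:E))%:E)%E by rewrite fineK//; exact: integrable_fin_num.
Qed.

Lemma L2D f g : L2 f -> L2 g -> L2 (fun x => f x + g x).
Proof.
move=> lf lg; have [mf mg] := (L2_measurable lf, L2_measurable lg).
apply: L2P; first exact: measurable_funD.
apply: (@intg_le _ (fun x => 2 * (f x ^+ 2) + 2 * (g x ^+ 2))).
- by apply: measurable_funX; exact: measurable_funD.
- by apply: intgD; apply: intgZ; apply: L2_sqr.
- move=> x; rewrite ger0_norm ?sqr_ge0//; have := sqr_ge0 (f x - g x); nra.
Qed.

Lemma L2Z c f : L2 f -> L2 (fun x => c * f x).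
Proof.
move=> lf; have mf := L2_measurable lf.
apply: L2P; first exact: measurable_funM.
by apply: intg_eq (intgZ (c ^+ 2) (L2_sqr lf)) => x; rewrite exprMn.
Qed.

Lemma L2N f : L2 f -> L2 (fun x => - f x).
Proof.
by move=> lf; have := L2Z (-1) lf; congr L2; apply/funext => x; rewrite mulN1r.
Qed.

Lemma L2B f g : L2 f -> L2 g -> L2 (fun x => f x - g x).
Proof. by move=> lf lg; exact: (L2D lf (L2N lg)). Qed.

Lemma L2M_ae K a f : measurable_fun setT a -> {ae mu, forall x, `|a x| <= K} ->
  L2 f -> L2 (fun x => a x * f x).
Proof.
move=> ma aK lf; have mf := L2_measurable lf.
apply: L2P; first exact: measurable_funM.
apply: (@intg_ae_le _ (fun x => K ^+ 2 * (f x ^+ 2))).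
- by apply: measurable_funX; exact: measurable_funM.
- exact: intgZ (L2_sqr lf).
- apply: ae_imply aK => x aK; rewrite ger0_norm ?sqr_ge0// exprMn.
  rewrite ler_wpM2r ?sqr_ge0// -(real_normK (num_real (a x))).
  by rewrite ler_sqr ?nnegrE//; exact: le_trans aK.
Qed.

Lemma L2M K a f : measurable_fun setT a -> (forall x, `|a x| <= K) ->
  L2 f -> L2 (fun x => a x * f x).
Proof. by move=> ma aK; apply: (L2M_ae (K := K)) => //; exact: aeW. Qed.

Lemma intgM f g : L2 f -> L2 g -> intg (fun x => f x * g x).
Proof. by move=> lf lg; apply/Lfun1_integrable; exact: Lfun2_mul_Lfun1. Qed.

Lemma intgM3 K a f g : measurable_fun setT a -> (forall x, `|a x| <= K) ->
  L2 f -> L2 g -> intg (fun x => a x * f x * g x).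
Proof. by move=> ma aK lf lg; apply: intgM => //; exact: (L2M (K := K)). Qed.

Lemma nrm_ge0 f : 0 <= nrm f. Proof. exact: sqrtr_ge0. Qed.

Lemma nrm_sqr f : nrm f ^+ 2 = Int (fun x => f x ^+ 2).
Proof. by rewrite sqr_sqrtr// Int_ge0// => x; rewrite sqr_ge0. Qed.

Lemma L2norm_nrm f : L2 f -> L2norm setT f = (nrm f)%:E.
Proof.
move=> lf; rewrite L2normE -Int_fin ?poweR_EFin; last exact: L2_sqr.
by rewrite powR12_sqrt// Int_ge0// => x; rewrite sqr_ge0.
Qed.

(* The discriminant of [t |-> Int ((f + t g) ^+ 2)] is nonpositive. *)
Lemma cauchy_schwarz f g : L2 f -> L2 g ->
  `|Int (fun x => f x * g x)| <= nrm f * nrm g.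
Proof.
move=> lf lg; set b := Int _.
have e (s t : R) : 0 <= s ^+ 2 * nrm f ^+ 2 + 2 * s * t * b + t ^+ 2 * nrm g ^+ 2.
  rewrite !nrm_sqr /b -!IntZ -?IntD; try (do ?[apply: intgD|apply: intgZ];
    solve [exact: L2_sqr|exact: intgM]).
  by apply: Int_ge0 => x; have := sqr_ge0 (s * f x + t * g x); nra.
rewrite -(@ler_sqr R) ?nnegrE ?mulr_ge0 ?nrm_ge0//.
rewrite real_normK ?num_real// exprMn.
(* If [nrm g = 0], the values [s = - b] and [t = (nrm f ^+ 2 + 1) / 2] reduce the quadratic form to
   [- b ^+ 2], so [b = 0]. Otherwise [s = nrm g ^+ 2] and [t = - b] give the claim multiplied by
   [nrm g ^+ 2]. *)
have [g0|g0] := eqVneq (nrm g) 0.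
  rewrite g0 expr0n mulr0; have := e (- b) (nrm f ^+ 2 / 2 + 1 / 2); rewrite g0.
  have := sqr_ge0 b; have := nrm_ge0 f; nra.
have g2 : 0 < nrm g ^+ 2 by rewrite exprn_gt0// lt_def g0 nrm_ge0.
have := e (nrm g ^+ 2) (- b); rewrite -(@ler_pM2r _ (nrm g ^+ 2))//; nra.
Qed.

Lemma nrmZ c f : L2 f -> nrm (fun x => c * f x) = `|c| * nrm f.
Proof.
move=> lf; rewrite /nrm (eq_Int (g := fun x => c ^+ 2 * (f x ^+ 2))).
  by rewrite IntZ; [rewrite sqrtrM ?sqr_ge0// sqrtr_sqr|exact: L2_sqr].
by move=> x; rewrite exprMn.
Qed.

Lemma nrmN f : nrm (fun x => - f x) = nrm f.
Proof. by congr (Num.sqrt (Int _)); apply/funext => x; rewrite sqrrN. Qed.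

Lemma nrmBC f g : nrm (fun x => f x - g x) = nrm (fun x => g x - f x).
Proof. by rewrite -nrmN; congr nrm; apply/funext => x; rewrite opprB. Qed.

Lemma nrm0 : nrm (fun=> 0) = 0.
Proof.
by rewrite /nrm (eq_Int (g := fun=> 0)) ?Int0 ?sqrtr0// => x; rewrite expr0n.
Qed.

Lemma nrmD f g : L2 f -> L2 g -> nrm (fun x => f x + g x) <= nrm f + nrm g.
Proof.
move=> lf lg; rewrite -(@ler_sqr R) ?nnegrE ?addr_ge0 ?nrm_ge0//.
rewrite nrm_sqr (eq_Int (g := fun x => f x ^+ 2 + (2 * (f x * g x) + g x ^+ 2))).
  rewrite IntD ?IntD ?IntZ ?sqrrD -?nrm_sqr;
    try (do ?[apply: intgD|apply: intgZ]; solve [exact: L2_sqr|exact: intgM]).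
  have := le_trans (ler_norm _) (cauchy_schwarz lf lg); lra.
by move=> x; ring.
Qed.

Lemma nrm_le f g : L2 f -> L2 g -> {ae mu, forall x, `|f x| <= `|g x|} -> nrm f <= nrm g.
Proof.
move=> lf lg fg; rewrite ler_sqrt; last by apply: Int_ge0 => x; rewrite sqr_ge0.
apply: le_Int_ae; [exact: L2_sqr|exact: L2_sqr|].
apply: ae_imply fg => x; rewrite -(@ler_sqr R) ?nnegrE//.
by rewrite !real_normK// num_real.
Qed.

Lemma nrm_ae f g : measurable_fun setT f -> measurable_fun setT g ->
  {ae mu, forall x, f x = g x} -> nrm f = nrm g.
Proof.
move=> mf mg fg; congr Num.sqrt; apply: eq_Int_ae; try exact: measurable_funX.
by apply: ae_imply fg => x ->.
Qed.

Lemma L2_ae f g : measurable_fun setT g ->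
  {ae mu, forall x, f x = g x} -> L2 f -> L2 g.
Proof.
move=> mg fg lf; apply: L2P => //.
apply: (@intg_ae_le _ (fun x => f x ^+ 2)); [exact: measurable_funX|exact: L2_sqr|].
by apply: ae_imply fg => x ->; rewrite ger0_norm// sqr_ge0.
Qed.

Lemma nrmM_ae K a f : measurable_fun setT a -> {ae mu, forall x, `|a x| <= K} ->
  L2 f -> nrm (fun x => a x * f x) <= K * nrm f.
Proof.
move=> ma aK lf.
(* For [K < 0] the hypothesis forces an absurdity at almost every point, so both norms are 0; no
   sign condition on [K] has to be carried along. *)
have [K0|K0] := lerP 0 K; last first.
  have f0 : {ae mu, forall x, False}.
    by apply: ae_imply aK => x h; have := le_lt_trans (le_trans (normr_ge0 _) h) K0; rewrite ltxx.
  have -> : nrm f = 0.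
    rewrite -nrm0; apply: nrm_ae; [exact: L2_measurable|exact: measurable_cst|].
    by apply: ae_imply f0.
  rewrite mulr0 -nrm0 (@nrm_ae _ (fun=> 0))//.
    by apply: measurable_funM => //; exact: L2_measurable.
  by apply: ae_imply f0.
have -> : K * nrm f = nrm (fun x => K * f x) by rewrite nrmZ// ger0_norm.
apply: nrm_le.
- exact: (L2M_ae ma aK).
- exact: L2Z.
- apply: ae_imply aK => x aK; rewrite !normrM ler_wpM2r//.
  by rewrite (le_trans aK)// ler_norm.
Qed.

Lemma nrmM K a f : measurable_fun setT a -> (forall x, `|a x| <= K) ->
  L2 f -> nrm (fun x => a x * f x) <= K * nrm f.
Proof. by move=> ma aK; apply: nrmM_ae => //; exact: aeW. Qed.

Lemma nrm_eq0_ae f : L2 f -> nrm f = 0 -> {ae mu, forall x, f x = 0}.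
Proof.
move=> lf f0; have : {ae mu, forall x, f x ^+ 2 = 0}.
  apply: Int_eq0_ae; [exact: L2_sqr|by move=> x; rewrite sqr_ge0|].
  by rewrite -nrm_sqr f0 expr0n.
by apply: ae_imply => x /eqP; rewrite sqrf_eq0 => /eqP.
Qed.

End L2basics.

(** * Translations and reflections *)

Section Invariance.
Context {R : realType}.
Local Notation mu := (@lebesgue_measure R).
Implicit Types f g h a : R -> R.

Section measure_preserving.
Variable phi : R -> R.
Hypothesis mphi : measurable_fun [set: measurableTypeR R]
  (phi : measurableTypeR R -> measurableTypeR R).
Hypothesis muphi : forall A : set R, measurable A ->
  pushforward mu (phi : R -> measurableTypeR R) A = mu A.

Let m1 := measure_function_pushforward__canonical__measure_function_Measure mu mphi.

Let integral_muphi (f : R -> \bar R) : (\int[m1]_x f x = \int[mu]_x f x)%E.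
Proof. by apply: eq_measure_integral => A mA _; exact: muphi. Qed.

Lemma measure_preserving_ge0 (f : R -> \bar R) : measurable_fun setT f ->
  (forall x, 0 <= f x)%E -> (\int[mu]_x f (phi x) = \int[mu]_x f x)%E.
Proof.
move=> mf f0; rewrite -[RHS]integral_muphi.
exact/esym/(@ge0_integral_pushforward _ _ (measurableTypeR R) (measurableTypeR R)
  R phi mphi mu setT f measurableT mf (fun x _ => f0 x)).
Qed.

Lemma intg_comp f : intg f -> intg (fun x => f (phi x)).
Proof.
move=> fi; have mf := intg_measurable fi.
move/integrableP : fi => [mfE fi]; apply/integrableP; split.
  by apply/measurable_EFinP; exact: (measurableT_comp mf mphi).
have := measure_preserving_ge0 (f := fun x => `|(f x)%:E|%E).
move=> ->//; exact: measurableT_comp.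
Qed.

Lemma Int_comp f : intg f -> Int (fun x => f (phi x)) = Int f.
Proof.
move=> fi; have mf : measurable_fun setT (EFin \o f).
  by apply/measurable_EFinP; exact: intg_measurable.
rewrite /Int /Rintegral; congr fine.
rewrite -[RHS]integral_muphi.
exact/esym/(@integral_pushforward _ _ (measurableTypeR R) (measurableTypeR R) R phi mphi mu setT (EFin \o f) mf (intg_comp fi)).
Qed.

Lemma L2_comp f : L2 f -> L2 (fun x => f (phi x)).
Proof.
move=> lf; apply: L2P; first exact: (measurableT_comp (L2_measurable lf) mphi).
exact: (intg_comp (L2_sqr lf)).
Qed.

Lemma nrm_comp f : L2 f -> nrm (fun x => f (phi x)) = nrm f.
Proof. by move=> lf; congr Num.sqrt; exact: (Int_comp (L2_sqr lf)). Qed.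

End measure_preserving.

Lemma measurable_shift c : measurable_fun setT ((fun x => x + c) : R -> measurableTypeR R).
Proof. by apply: measurable_funD. Qed.

(** Lebesgue measure is determined by its values on half-open intervals, whose lengths a shift
    preserves. *)
Lemma lebesgue_measure_shift c (A : set R) : measurable A ->
  pushforward mu ((fun x => x + c) : R -> measurableTypeR R) A = mu A.
Proof.
move=> mA; apply/esym/lebesgue_measure_unique => //=.
  exact: measurable_shift.
move=> mc _ [[a b]] _ <-; rewrite /pushforward.
have -> : (fun x => x + c) @^-1` `]a, b]%classic = `](a - c), (b - c)]%classic.
  by apply/seteqP; split => x /=; rewrite !in_itv/= ltrBlDr lerBrDr.
rewrite !lebesgue_measure_itv/= !lte_fin ltrD2r; case: ifPn => // _.
by rewrite -!EFinD; congr EFin; ring.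
Qed.

Lemma Int_shift c f : intg f -> Int (fun x => f (x + c)) = Int f.
Proof. exact: (Int_comp (measurable_shift c) (@lebesgue_measure_shift c)). Qed.

Lemma L2_shift c f : L2 f -> L2 (fun x => f (x + c)).
Proof. exact: (L2_comp (measurable_shift c) (@lebesgue_measure_shift c)). Qed.

Lemma nrm_shift c f : L2 f -> nrm (fun x => f (x + c)) = nrm f.
Proof. exact: (nrm_comp (measurable_shift c) (@lebesgue_measure_shift c)). Qed.

Lemma Int_opp f : intg f -> Int (fun x => f (- x)) = Int f.
Proof. exact: (Int_comp (@oppr_measurable R setT) (@lebesgue_measureN R)). Qed.

Lemma intg_opp f : intg f -> intg (fun x => f (- x)).
Proof. exact: (intg_comp (@oppr_measurable R setT) (@lebesgue_measureN R)). Qed.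

End Invariance.

(** * Derivatives of real functions *)

Section Calculus.
Context {R : realType}.
Implicit Types (f g : R -> R) (x l : R).

Definition der f x l := is_derive x (1 : R) f l.

(** A division-free form that includes [h = 0]: error estimates on increments are proved and reused
    in this shape. *)
Lemma derP f x l : der f x l <-> forall e, 0 < e ->
  exists2 d, 0 < d & forall h, `|h| < d -> `|f (x + h) - f x - h * l| <= e * `|h|.
Proof.
have E : der f x l <-> (h^-1 *: ((f \o shift x) (h *: (1 : R)) - f x) @[h --> 0^'] --> l).
  split=> [[dx <-]|fl]; first exact: dx.
  by split; [apply/cvg_ex; exists l|apply/cvg_lim].
have Q h : h != 0 -> `|l - h^-1 *: ((f \o shift x) (h *: (1 : R)) - f x)| * `|h| =
    `|f (x + h) - f x - h * l|.
  move=> h0; rewrite -normrM /= -[h *: (1 : R)]/(h * 1) mulr1 (addrC h) -[_ *: _]/(_ * _).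
  by rewrite -normrN; congr `|_|; field.
apply: (iff_trans E); split=> [/cvgrPdist_le fl e e0|fl].
  have := fl _ e0; rewrite /dnbhs near_withinE => /nbhs_ballP[d /= d0 H].
  exists d => // h hd; have [->|h0] := eqVneq h 0.
    by rewrite addr0 subrr mul0r subr0 normr0 mulr0.
  rewrite -Q// ler_pM2r ?normr_gt0//; apply: H => //.
  by rewrite /ball/= sub0r normrN.
apply/cvgrPdist_le => e e0; have [d d0 H] := fl _ e0.
rewrite /dnbhs near_withinE; apply/nbhs_ballP; exists d => //= h.
rewrite /ball/= sub0r normrN => hd h0.
by rewrite -(@ler_pM2r _ `|h|) ?normr_gt0// Q// H.
Qed.

Lemma der_near f g x l d : 0 < d -> (forall y, `|y - x| < d -> f y = g y) ->
  der f x l -> der g x l.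
Proof.
move=> d0 fg; apply: near_eq_is_derive; apply/nbhs_ballP; exists d => //= y.
by rewrite /ball/= distrC => /fg.
Qed.

Lemma derD f g x a b l : der f x a -> der g x b -> l = a + b ->
  der (fun y => f y + g y) x l.
Proof. by move=> fa gb ->; exact: (is_deriveD fa gb). Qed.

Lemma derN f x a l : der f x a -> l = - a -> der (fun y => - f y) x l.
Proof. by move=> fa ->; exact: (is_deriveN fa). Qed.

Lemma derB f g x a b l : der f x a -> der g x b -> l = a - b ->
  der (fun y => f y - g y) x l.
Proof. by move=> fa gb ->; exact: (is_deriveB fa gb). Qed.

Lemma derM f g x a b l : der f x a -> der g x b -> l = a * g x + f x * b ->
  der (fun y => f y * g y) x l.
Proof.
move=> fa gb ->; have := is_deriveM fa gb.
by rewrite addrC (mulrC a).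
Qed.

Lemma derZ k f x a l : der f x a -> l = k * a -> der (fun y => k * f y) x l.
Proof. by move=> fa ->; exact: (is_deriveZ k fa). Qed.

Lemma der_cst k x : der (fun=> k) x 0.
Proof. exact: is_derive_cst. Qed.

Lemma der_id x : der (fun y => y) x 1.
Proof. exact: is_derive_id. Qed.

Lemma der_comp f g x a b l : der f (g x) a -> der g x b -> l = a * b ->
  der (fun y => f (g y)) x l.
Proof. by move=> fa gb ->; exact: (is_derive1_comp fa gb). Qed.

Lemma derV f x a l : f x != 0 -> der f x a -> l = - a / f x ^+ 2 ->
  der (fun y => (f y)^-1) x l.
Proof.
move=> f0 fa ->; have := is_deriveV f0 fa.
by rewrite -[_ *: a]/(_ * a) mulrC mulrN mulNr.
Qed.

Lemma der_expR f x a l : der f x a -> l = a * expR (f x) -> der (fun y => expR (f y)) x l.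
Proof. by move=> fa ->; apply: (der_comp (is_derive_expR _) fa); rewrite mulrC. Qed.

Lemma der_affine k b x : der (fun y => k * y + b) x k.
Proof.
by apply: (derD (derZ (der_id x) (erefl (k * 1))) (der_cst b x)); rewrite mulr1 addr0.
Qed.

Lemma der_uniq f x a b : der f x a -> der f x b -> a = b.
Proof. by move=> [_ <-] [_ <-]. Qed.

Lemma der_derive1 f x a : der f x a -> derive1 f x = a.
Proof. by move=> [_ <-]; rewrite derive1E. Qed.

Lemma der_continuous f x a : der f x a -> {for x, continuous f}.
Proof.
by move=> [dx _]; apply: differentiable_continuous; apply/derivable1_diffP.
Qed.

Lemma mvt f (df : R -> R) (a b : R) : a <= b -> (forall x, a <= x <= b -> der f x (df x)) ->
  exists2 c, a <= c <= b & f b - f a = df c * (b - a).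
Proof.
move=> ab fd; have [||c cab e] := @MVT_segment R f df a b ab.
- by move=> x; rewrite in_itv/= => /andP[/ltW ax /ltW xb]; apply: fd; rewrite ax.
- apply: derivable_within_continuous => x; rewrite in_itv/= => /fd; by case.
- by exists c => //; rewrite in_itv in cab.
Qed.

Lemma mvt_bound f (df : R -> R) K x h :
  (forall y, `|y - x| <= `|h| -> der f y (df y)) ->
  (forall y, `|y - x| <= `|h| -> `|df y| <= K) -> `|f (x + h) - f x| <= K * `|h|.
Proof.
move=> fd fK; have [h0|h0] := lerP 0 h.
  have [||c cab ->] := @mvt f df x (x + h); first by rewrite lerDl.
    by move=> y /andP[a b]; apply: fd; rewrite !ger0_norm//; lra.
  rewrite (addrC x) addrK normrM ler_wpM2r// fK//.
  by case/andP: cab => a b; rewrite !ger0_norm//; lra.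
have [||c cab e] := @mvt f df (x + h) x; first by lra.
  by move=> y /andP[a b]; apply: fd; rewrite (ltr0_norm h0) ler0_norm; lra.
rewrite -normrN opprB e normrM opprD addrA subrr sub0r normrN ler_wpM2r// fK//.
by case/andP: cab => a b; rewrite (ltr0_norm h0) ler0_norm; lra.
Qed.

Lemma taylor2 f (f1 f2 : R -> R) K x h :
  (forall y, der f y (f1 y)) -> (forall y, der f1 y (f2 y)) ->
  (forall y, `|f2 y| <= K) -> `|f (x + h) - f x - h * f1 x| <= K * h ^+ 2.
Proof.
move=> d1 d2 fK.
(* Removing the slope at [x] leaves a derivative of size at most K |h| on the segment, so the mean
   value theorem is used twice and Taylor's factor 1/2 is given up. *)
pose g y := f y - y * f1 x.
have dg y : der g y (f1 y - f1 x).
  apply: (derB (d1 y) (derM (der_id y) (der_cst (f1 x) y) (erefl _))).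
  by rewrite mul1r mulr0 addr0.
have -> : f (x + h) - f x - h * f1 x = g (x + h) - g x by rewrite /g; ring.
have -> : K * h ^+ 2 = K * `|h| * `|h| by rewrite -mulrA -expr2 real_normK// num_real.
apply: (mvt_bound (df := fun y => f1 y - f1 x)) => // y yh.
have -> : f1 y = f1 (x + (y - x)) by congr f1; ring.
apply: le_trans (mvt_bound (fun z _ => d2 z) (fun z _ => fK z)) _.
by rewrite ler_wpM2l// (le_trans _ (fK 0)).
Qed.

End Calculus.

(** * Test functions *)

Section TestFunctions.
Context {R : realType}.
Local Notation mu := (@lebesgue_measure R).
Implicit Types (f g phi : R -> R) (x l c : R).

(** A tower of explicit derivatives and a support radius replace iterated [derive1n] and the compact
    closure; closure properties then amount to exhibiting a tower. *)
Lemma test_functionP phi : test_function phi <->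
  exists F : nat -> R -> R, exists N : R, [/\ 0 < N, F 0%N = phi,
    forall k x, der (F k) x (F k.+1 x) & forall x, N < `|x| -> phi x = 0].
Proof.
split=> [[sm cp]|[F [N [N0 F0 dF sF]]]].
  have [M [_ MN]] := compact_bounded cp.
  exists (fun k => derive1n k phi), (`|M| + 1); split=> //.
  - by move=> k x; rewrite derive1nS derive1E; split => //; exact: sm.
  - move=> x Mx; apply/eqP/negPn/negP => px.
    have lt : M < `|M| + 1 by rewrite ltr_pwDr// ler_norm.
    have /= h := MN _ lt x (@subset_closure _ [set x | phi x != 0] x px).
    by move: h; rewrite leNgt Mx.
have Fk k : derive1n k phi = F k.
  elim: k => [|k IH]; first by rewrite derive1n0.
  by rewrite derive1nS IH; apply/funext => x; exact: der_derive1.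
split=> [k x|]; first by rewrite Fk; have [] := dF k x.
apply: (subclosed_compact (B := `[(- N), N]%classic)).
- exact: closed_closure.
- exact: segment_compact.
- have cN : closed `[(- N), N]%classic by exact: interval_closed.
  rewrite [X in _ `<=` X]((closure_id _).1 cN); apply: closureS => x /= px.
  rewrite in_itv/= -ler_norml leNgt; apply/negP => /sF px0.
  by rewrite px0 eqxx in px.
Qed.

Lemma testD phi psi : test_function phi -> test_function psi ->
  test_function (fun x => phi x + psi x).
Proof.
move=> /test_functionP[F [N [N0 F0 dF sF]]] /test_functionP[G [M [M0 G0 dG sG]]].
apply/test_functionP; exists (fun k x => F k x + G k x), (N + M); split=> //.
- by rewrite addr_gt0.
- by rewrite F0 G0.
- by move=> k x; exact: (derD (dF k x) (dG k x)).
- by move=> x h; rewrite sF ?sG ?addr0//; lra.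
Qed.

Lemma testZ c phi : test_function phi -> test_function (fun x => c * phi x).
Proof.
move=> /test_functionP[F [N [N0 F0 dF sF]]].
apply/test_functionP; exists (fun k x => c * F k x), N; split=> //.
- by rewrite F0.
- by move=> k x; exact: (derZ (dF k x)).
- by move=> x h; rewrite sF ?mulr0.
Qed.

Lemma test0 : test_function (fun=> 0 : R).
Proof.
apply/test_functionP; exists (fun _ _ => 0), 1; split => //.
by move=> k x; exact: der_cst.
Qed.

Lemma test_shift c phi : test_function phi -> test_function (fun x => phi (x + c)).
Proof.
move=> /test_functionP[F [N [N0 F0 dF sF]]].
apply/test_functionP; exists (fun k x => F k (x + c)), (N + `|c|); split=> //.
- by rewrite ltr_wpDr.
- by rewrite F0.
- move=> k x; have h := derD (der_id x) (der_cst c x) (erefl (1 + 0)).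
  by apply: (der_comp (g := fun y => y + c) (dF k (x + c)) h); rewrite addr0 mulr1.
- by move=> x h; rewrite sF//; have := lerB_normD x c; lra.
Qed.

Lemma test_derive1 phi : test_function phi -> test_function (derive1 phi).
Proof.
move=> /test_functionP[F [N [N0 F0 dF sF]]].
have -> : derive1 phi = F 1%N.
  by apply/funext => x; rewrite -F0; exact: der_derive1.
apply/test_functionP; exists (fun k x => F k.+1 x), N; split=> //.
move=> x Nx; apply: (der_uniq (dF 0%N x)); rewrite F0.
apply: (@der_near _ (fun=> 0) _ _ _ (`|x| - N)); first by rewrite subr_gt0.
  move=> y xy; rewrite sF//; have := ler_normD y (x - y).
  by rewrite (addrC y) subrK (distrC x); lra.
exact: der_cst.
Qed.

Lemma test_der phi x : test_function phi -> der phi x (derive1 phi x).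
Proof. by move=> [sm _]; rewrite derive1E; split => //; exact: (sm 0%N). Qed.

Lemma test_continuous phi : test_function phi -> continuous phi.
Proof. by move=> tphi x; exact: der_continuous (test_der x tphi). Qed.

Lemma test_measurable phi : test_function phi -> measurable_fun setT phi.
Proof. by move=> /test_continuous; exact: continuous_measurable_fun. Qed.

Lemma test_support phi : test_function phi ->
  exists2 N, 0 < N & forall x, N < `|x| -> phi x = 0.
Proof. by move=> /test_functionP[F [N [N0 F0 dF sF]]]; exists N. Qed.

Lemma test_bounded phi : test_function phi -> exists2 M, 0 < M & forall x, `|phi x| <= M.
Proof.
move=> tphi; have [N N0 sN] := test_support tphi.
have cphi : continuous (fun x => `|phi x|).
  by move=> x; apply: cvg_norm; exact: test_continuous.
have [||c _ cM] := @EVT_max R (fun x => `|phi x|) (- N) N; first by lra.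
  exact: continuous_subspaceT.
exists (`|phi c| + 1); first by rewrite ltr_wpDl.
move=> x; have [xN|/sN->] := lerP `|x| N; last by rewrite normr0 addr_ge0.
by apply: (@le_trans _ _ `|phi c|); [apply: cM; rewrite in_itv/= -ler_norml|rewrite lerDl].
Qed.

Lemma intg_itv_indic (a b : R) : intg (\1_(`]a, b[%classic) : R -> R).
Proof. exact: integrable_indic_itv. Qed.

Lemma intg_bounded_support f N M : measurable_fun setT f ->
  (forall x, `|f x| <= M) -> (forall x, N < `|x| -> f x = 0) -> intg f.
Proof.
move=> mf fM fN.
apply: (@intg_le _ _ (fun x => M * \1_(`](- (`|N| + 1)), (`|N| + 1)[%classic) x)) => //.
  exact: intgZ (intg_itv_indic _ _).
move=> x; rewrite indicE; case: (boolP (_ \in _)); rewrite ?mulr1// mulr0.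
rewrite notin_setE/= in_itv/= -ltr_norml => /negP; rewrite -leNgt => h.
by rewrite fN ?normr0//; have := ler_norm N; lra.
Qed.

Lemma L2_bounded_support f N M : measurable_fun setT f ->
  (forall x, `|f x| <= M) -> (forall x, N < `|x| -> f x = 0) -> L2 f.
Proof.
move=> mf fM fN; apply: L2P => //.
apply: (@intg_bounded_support _ N (M ^+ 2)); first exact: measurable_funX.
  move=> x; rewrite normrX ler_sqr ?nnegrE//; exact: le_trans (fM x).
by move=> x /fN ->; rewrite expr0n.
Qed.

Lemma test_L2 phi : test_function phi -> L2 phi.
Proof.
move=> tphi; have [N N0 sN] := test_support tphi; have [M M0 bM] := test_bounded tphi.
exact: (L2_bounded_support (test_measurable tphi) bM sN).
Qed.

Lemma test_taylor phi : test_function phi ->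
  exists2 K, 0 < K & forall x h, `|phi (x + h) - phi x - h * derive1 phi x| <= K * h ^+ 2.
Proof.
move=> tphi; have t1 := test_derive1 tphi; have t2 := test_derive1 t1.
have [M M0 bM] := test_bounded t2; exists M => // x h.
by apply: taylor2 bM => y; exact: test_der.
Qed.

(* [|phi (x + h) - phi x - h phi' x| <= K h^2] is supported in a fixed interval for [|h| <= 1]. *)
Lemma test_taylor_nrm phi : test_function phi ->
  exists2 K, 0 < K & forall h, `|h| <= 1 ->
    nrm (fun x => phi (x + h) - phi x - h * derive1 phi x) <= K * h ^+ 2.
Proof.
move=> tphi; have [K K0 tK] := test_taylor tphi; have [N N0 sN] := test_support tphi.
have [N' N'0 sN'] := test_support (test_derive1 tphi).
pose I : R -> R := \1_(`](- (N + N' + 2)), (N + N' + 2)[%classic).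
have mI : measurable_fun setT I by exact: measurable_indic.
have lI : L2 I.
  apply: (@L2_bounded_support _ (N + N' + 2) 1) => // x; rewrite /I indicE.
    by case: (_ \in _); rewrite ?normr1 ?normr0.
  by move=> xN; rewrite memNset//= in_itv/= -ltr_norml; apply/negP; rewrite -leNgt ltW.
exists (K * (nrm I + 1)); first by rewrite mulr_gt0// ltr_wpDl ?nrm_ge0.
move=> h h1.
have lF : L2 (fun x => phi (x + h) - phi x - h * derive1 phi x).
  have lphi := test_L2 tphi.
  exact: (L2B (L2B (L2_shift h lphi) lphi) (L2Z h (test_L2 (test_derive1 tphi)))).
apply: (@le_trans _ _ (nrm (fun x => (K * h ^+ 2) * I x))).
  apply: nrm_le => //; first exact: L2Z.
  apply: aeW => x; rewrite /I indicE; case: (boolP (_ \in _)) => [_|].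
    by rewrite mulr1 (le_trans (tK _ _))// ler_norm.
  rewrite notin_setE/= in_itv/= -ltr_norml => /negP; rewrite -leNgt => xN.
  rewrite sN ?sN ?sN' ?mulr0 ?subr0 ?normr0//; try lra.
  by have := lerB_normD x h; lra.
rewrite nrmZ// ger0_norm; last by rewrite mulr_ge0 ?sqr_ge0 ?ltW.
by rewrite mulrAC ler_wpM2r ?sqr_ge0// ler_pM2l// lerDl.
Qed.

End TestFunctions.

(** * Smooth bumps *)

Section Bump.
Context {R : realType}.
Implicit Types (f g phi : R -> R) (x l c : R).

(** Differentiation maps the family x^(-j) exp(-c/x) into its own span, so smoothness across 0
    follows from first-order differentiability of every member. The rate [c] is a parameter because
    bumps approach indicators as it tends to 0. *)
Definition flat c (j : nat) x : R := if 0 < x then x^-1 ^+ j * expR (- c * x^-1) else 0.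

Lemma flat_ge0 c j x : 0 <= flat c j x.
Proof.
rewrite /flat; case: ifPn => // x0.
by rewrite mulr_ge0 ?expR_ge0// exprn_ge0// invr_ge0 ltW.
Qed.

Lemma flat_le c j x : 0 < c -> flat c j x <= (j.+2)`!%:R / c ^+ j.+2 * x ^+ 2.
Proof.
move=> c0; rewrite /flat; case: ifPn => x0; last first.
  by rewrite mulr_ge0 ?sqr_ge0// divr_ge0// exprn_ge0// ltW.
have y0 : 0 <= c * x^-1 by rewrite mulr_ge0 ?invr_ge0 ?ltW.
(* The exponential series is kept up to its term of order j + 2: two powers more than x^(-j) leave
   the factor x^2 that makes the derivative at 0 vanish. *)
have := expR_ge1Dxn j.+1 y0; set E := expR _ => h.
have E0 : 0 < E by exact: expR_gt0.
have {}h : (c * x^-1) ^+ j.+2 <= (j.+2)`!%:R * E.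
  have f0 : 0 < (j.+2)`!%:R :> R by rewrite ltr0n fact_gt0.
  rewrite (mulrC _ E) -ler_pdivrMr//; lra.
rewrite mulNr expRN -/E ler_pdivrMr//.
have -> : x^-1 ^+ j = (c * x^-1) ^+ j.+2 / c ^+ j.+2 * x ^+ 2.
  by rewrite exprMn !exprS; field; rewrite !gt_eqF ?exprn_gt0.
rewrite [leRHS](_ : _ = (j.+2)`!%:R * E * (c ^- j.+2 * x ^+ 2)); last by ring.
rewrite -[leLHS]mulrA.
by rewrite ler_wpM2r// mulr_ge0 ?sqr_ge0// invr_ge0 exprn_ge0// ltW.
Qed.

Lemma der_flat c j x : 0 < c ->
  der (flat c j) x (c * flat c j.+2 x - j%:R * flat c j.+1 x).
Proof.
move=> c0; have [x0|x0|->] := ltrgt0P x.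
- apply: (@der_near _ (fun y => y^-1 ^+ j * expR (- c * y^-1)) _ _ _ x) => //.
    move=> y yx; rewrite /flat; case: ifPn => //; move: yx.
    by rewrite ltr_norml; lra.
  have dV : der (fun y => y^-1) x (- 1 / x ^+ 2).
    by apply: (derV _ (der_id x)) => //; rewrite gt_eqF.
  have dX : der (fun y => y^-1 ^+ j) x (j%:R * x^-1 ^+ j.-1 * (- 1 / x ^+ 2)).
    have dp : der (fun y => y ^+ j) x^-1 (j%:R * x^-1 ^+ j.-1).
      have -> : (fun y : R => y ^+ j) = (fun y => y) ^+ j by apply/funext => y; rewrite exprfctE.
      by have := is_deriveX j (der_id x^-1); rewrite -[_ *: 1]/(_ * 1) mulr1.
    exact: (der_comp dp dV).
  have dE : der (fun y => expR (- c * y^-1)) x ((- c * (- 1 / x ^+ 2)) * expR (- c * x^-1)).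
    by apply: (der_expR (derZ dV (erefl _))).
  apply: (derM dX dE); rewrite /flat x0.
  case: j {dX} => [|j] /=; rewrite ?exprS; field; rewrite gt_eqF//.
- rewrite /flat ltNge (ltW x0)/= !mulr0 subr0.
  apply: (@der_near _ (fun=> 0) _ _ _ (- x)); [lra| |exact: der_cst].
  by move=> y; rewrite ltr_norml => yx; case: ifPn => //; lra.
rewrite /flat ltxx !mulr0 subr0; apply/derP => e e0.
pose K : R := (j.+2)`!%:R / c ^+ j.+2.
have K0 : 0 < K by rewrite divr_gt0 ?exprn_gt0// ltr0n fact_gt0.
exists (e / K); first by rewrite divr_gt0.
move=> h hd; rewrite ltxx subr0 mulr0 subr0 add0r -/(flat c j h) ger0_norm ?flat_ge0//.
apply: le_trans (flat_le j h c0) _; rewrite -/K.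
have -> : h ^+ 2 = `|h| * `|h| by rewrite -expr2 real_normK// num_real.
rewrite mulrA ler_wpM2r// -ler_pdivlMl// mulrC ltW//.
Qed.

Section class.
Variables a b c : R.

(** The span of products of two flat functions, one for each endpoint. Being stable under one
    differentiation, it contains all derivatives of [bump]. *)
Inductive bumpcls : (R -> R) -> Prop :=
| bump_flat j k : bumpcls (fun x => flat c j (x - a) * flat c k (b - x))
| bump_add f g : bumpcls f -> bumpcls g -> bumpcls (fun x => f x + g x)
| bump_scale k f : bumpcls f -> bumpcls (fun x => k * f x).

Lemma bumpcls_der f : 0 < c -> bumpcls f ->
  exists2 g, bumpcls g & forall x, der f x (g x).
Proof.
move=> c0; elim=> {f} [j k|f g _ [f' cf df] _ [g' cg dg]|k f _ [f' cf df]].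
- exists (fun x => (c * (flat c j.+2 (x - a) * flat c k (b - x)) +
                   (- j%:R) * (flat c j.+1 (x - a) * flat c k (b - x))) +
                  (- c * (flat c j (x - a) * flat c k.+2 (b - x)) +
                   k%:R * (flat c j (x - a) * flat c k.+1 (b - x)))).
    by do ?[apply: bump_add|apply: bump_scale|apply: bump_flat].
  move=> x.
  have d1 : der (fun y => y - a) x 1.
    by apply: (derB (der_id x) (der_cst a x)); rewrite subr0.
  have d2 : der (fun y => b - y) x (- 1).
    by apply: (derB (der_cst b x) (der_id x)); rewrite sub0r.
  have D1 := der_comp (g := fun y => y - a) (der_flat j (x - a) c0) d1 (erefl _).
  have D2 := der_comp (g := fun y => b - y) (der_flat k (b - x) c0) d2 (erefl _).
  by apply: (derM D1 D2); ring.
- by exists (fun x => f' x + g' x); [exact: bump_add|move=> x; exact: derD].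
- by exists (fun x => k * f' x); [exact: bump_scale|move=> x; exact: derZ].
Qed.

Lemma bumpcls_iter f k : 0 < c -> bumpcls f -> bumpcls (derive1n k f).
Proof.
move=> c0 cf; elim: k => [|k IH]; first by rewrite derive1n0.
rewrite derive1nS; have [g cg dg] := bumpcls_der c0 IH.
by have -> : derive1 (derive1n k f) = g by apply/funext => x; exact: der_derive1.
Qed.

Definition bump x := flat c 0 (x - a) * flat c 0 (b - x).

Lemma bump_support x : ~~ (a < x < b) -> bump x = 0.
Proof.
rewrite /bump /flat !subr_gt0; case: (a < x); last by rewrite mul0r.
by move=> /= /negbTE ->; rewrite mulr0.
Qed.

Lemma bump_test : 0 < c -> test_function bump.
Proof.
move=> c0; apply/test_functionP; exists (fun k => derive1n k bump), (`|a| + `|b| + 1); split=> //.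
- move=> k x; rewrite derive1nS.
  have [g cg dg] := bumpcls_der c0 (bumpcls_iter k c0 (bump_flat 0 0)).
  by rewrite (der_derive1 (dg x)).
- move=> x xab; apply: bump_support; apply/negP => /andP[ax xb].
  have := ler_norm x; have := ler_norm (- a); have := ler_norm b; rewrite normrN.
  move=> h1 h2 h3; move: xab; rewrite ltNge => /negP; apply.
  by rewrite ler_norml; have := normr_ge0 a; have := normr_ge0 b; lra.
Qed.

Lemma flat0_le1 x : 0 < c -> flat c 0 x <= 1.
Proof.
move=> c0; rewrite /flat; case: ifPn => // x0; rewrite expr0 mul1r expR_le1.
by rewrite mulNr oppr_le0 mulr_ge0 ?invr_ge0 ?ltW.
Qed.

Lemma bump_bounds x : 0 < c -> 0 <= bump x <= 1.
Proof.
move=> c0; rewrite /bump mulr_ge0 ?flat_ge0//=.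
by rewrite mulr_ile1 ?flat_ge0// flat0_le1.
Qed.

End class.
End Bump.

(** * Density of test functions *)

Import HBNNSimple.

Section Density.
Context {R : realType}.
Local Notation mu := (@lebesgue_measure R).
Implicit Types (f g phi : R -> R) (x l c : R).

Lemma L2_dct (f_ : nat -> R -> R) f F : (forall n, measurable_fun setT (f_ n)) ->
  measurable_fun setT f -> L2 F -> (forall n x, `|f_ n x| <= F x) ->
  (forall x, `|f x| <= F x) -> {ae mu, forall x, f_ n x @[n --> \oo] --> f x} ->
  nrm (fun x => f_ n x - f x) @[n --> \oo] --> 0.
Proof.
move=> mf_ mf lF fF_ fF cf; rewrite -(@sqrtr0 R).
apply: (@cvg_comp _ _ _ _ (@Num.sqrt R) _ (nbhs (0 : R))); last exact: sqrt_continuous.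
rewrite -(@Int0 R).
apply: (@Int_dct _ _ _ (fun x => 4 * (F x ^+ 2))).
- by move=> n; apply: measurable_funX; exact: measurable_funB.
- exact: measurable_cst.
- exact: intgZ (L2_sqr lF).
- apply: ae_imply cf => x fx.
  rewrite [X in _ --> X](_ : 0 = (f x - f x) ^+ 2); last by rewrite subrr expr0n.
  apply: (@cvg_comp _ _ _ _ (fun y : R => y ^+ 2) _ (nbhs (f x - f x))); last exact: exprn_continuous.
  by apply: cvgB => //; exact: cvg_cst.
- move=> n x; rewrite ger0_norm ?sqr_ge0// -(real_normK (num_real _)).
  have := ler_normB (f_ n x) (f x); have := fF_ n x; have := fF x.
  have := normr_ge0 (f_ n x - f x); nra.
Qed.

Definition dense f := L2 f /\
  forall e, 0 < e -> exists2 phi, test_function phi & nrm (fun x => f x - phi x) <= e.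

Lemma dense_test phi : test_function phi -> dense phi.
Proof.
move=> tphi; split=> [|e e0]; first exact: test_L2.
exists phi => //; rewrite (_ : (fun x => _) = fun=> 0) ?nrm0 ?ltW//.
by apply/funext => x; rewrite subrr.
Qed.

Lemma denseD f g : dense f -> dense g -> dense (fun x => f x + g x).
Proof.
move=> [lf df] [lg dg]; split=> [|e e0]; first exact: L2D.
have e2 : 0 < e / 2 by rewrite divr_gt0.
have [phi tphi ephi] := df _ e2; have [psi tpsi epsi] := dg _ e2.
exists (fun x => phi x + psi x); first exact: testD.
rewrite (_ : (fun x => _) = fun x => (f x - phi x) + (g x - psi x)).
  apply: le_trans (nrmD _ _) _; [by apply: L2B => //; exact: test_L2..|lra].
by apply/funext => x; ring.
Qed.

Lemma denseZ c f : dense f -> dense (fun x => c * f x).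
Proof.
move=> [lf df]; split=> [|e e0]; first exact: L2Z.
have e2 : 0 < e / (`|c| + 1) by rewrite divr_gt0// ltr_wpDl.
have [phi tphi ephi] := df _ e2.
exists (fun x => c * phi x); first exact: testZ.
rewrite (_ : (fun x => _) = fun x => c * (f x - phi x)).
  rewrite nrmZ; last by apply: L2B => //; exact: test_L2.
  move: ephi; rewrite ler_pdivlMr ?ltr_wpDl// mulrC.
  have := nrm_ge0 (fun x => f x - phi x); nra.
by apply/funext => x; ring.
Qed.

Lemma denseB f g : dense f -> dense g -> dense (fun x => f x - g x).
Proof.
move=> df dg; rewrite (_ : (fun x => _) = fun x => f x + (-1) * g x).
  by apply: denseD => //; exact: denseZ.
by apply/funext => x; ring.
Qed.

Lemma dense_close f : L2 f ->
  (forall e, 0 < e -> exists2 g, dense g & nrm (fun x => g x - f x) <= e) -> dense f.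
Proof.
move=> lf H; split=> // e e0; have e2 : 0 < e / 2 by rewrite divr_gt0.
have [g [lg dg] gf] := H _ e2; have [phi tphi ephi] := dg _ e2.
exists phi => //; rewrite (_ : (fun x => _) = fun x => (f x - g x) + (g x - phi x)).
  apply: le_trans (nrmD _ _) _; [exact: L2B|by apply: L2B => //; exact: test_L2|].
  by move: gf; rewrite nrmBC; lra.
by apply/funext => x; ring.
Qed.

Lemma dense_lim (f_ : nat -> R -> R) f : L2 f -> (forall n, dense (f_ n)) ->
  nrm (fun x => f_ n x - f x) @[n --> \oo] --> 0 -> dense f.
Proof.
move=> lf df_ /cvgrPdist_le cf; apply: dense_close => // e e0.
have [n _ /(_ n (leqnn n))] := cf e e0.
by rewrite sub0r normrN ger0_norm ?nrm_ge0// => h; exists (f_ n).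
Qed.

Lemma dense_ae f g : measurable_fun setT g -> {ae mu, forall x, f x = g x} ->
  dense f -> dense g.
Proof.
move=> mg fg [lf df]; have lg := L2_ae mg fg lf.
split=> // e e0; have [phi tphi ephi] := df e e0; exists phi => //.
apply: le_trans ephi; rewrite le_eqVlt; apply/orP; left; apply/eqP/nrm_ae.
- exact: L2_measurable (L2B lg (test_L2 tphi)).
- exact: L2_measurable (L2B lf (test_L2 tphi)).
- by apply: ae_imply fg => x ->.
Qed.

Lemma dense0 : dense (fun=> 0 : R).
Proof. exact: dense_test test0. Qed.

Lemma dense_sum (I : Type) (s : seq I) (F : I -> R -> R) :
  (forall i, dense (F i)) -> dense (fun x => \sum_(i <- s) F i x).
Proof.
move=> dF; elim: s => [|i s IH].
  rewrite (_ : (fun x => _) = fun=> 0); first exact: dense0.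
  by apply/funext => x; rewrite big_nil.
rewrite (_ : (fun x => _) = fun x => F i x + \sum_(j <- s) F j x); first exact: denseD.
by apply/funext => x; rewrite big_cons.
Qed.

Lemma L2_indic_itv (a b : R) : L2 (\1_(`]a, b[%classic) : R -> R).
Proof.
apply: (@L2_bounded_support _ _ (`|a| + `|b|) 1); first exact: measurable_indic.
  by move=> x; rewrite indicE; case: (_ \in _); rewrite ?normr1 ?normr0.
move=> x xab; rewrite indicE memNset//= in_itv/= => /andP[ax xb].
have := ler_norm (- a); have := ler_norm b; rewrite normrN => h1 h2.
move: xab; rewrite ltNge => /negP; apply.
by rewrite ler_norml; have := normr_ge0 a; have := normr_ge0 b; lra.
Qed.

(** Inside the interval the bump of rate c equals exp(c K) with K depending on x alone, so it tends
    to 1 as c tends to 0; outside it is 0 for every c. *)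
Lemma dense_itv (a b : R) : dense (\1_(`]a, b[%classic) : R -> R).
Proof.
apply: (@dense_lim (fun n => bump a b n.+1%:R^-1)); first exact: L2_indic_itv.
  by move=> n; apply: dense_test; exact: bump_test.
have n0 n : 0 < n.+1%:R^-1 :> R by rewrite invr_gt0.
apply: (@L2_dct _ _ (\1_(`]a, b[%classic))) => //.
- by move=> n; apply: test_measurable; exact: bump_test.
- exact: L2_indic_itv.
- move=> n x; rewrite indicE; case: (boolP (_ \in _)) => [_|].
    by have /andP[h0 h1] := bump_bounds a b x (n0 n); rewrite ger0_norm.
  by rewrite notin_setE/= in_itv/= => /negP h; rewrite bump_support ?normr0.
- by move=> x; rewrite indicE; case: (_ \in _); rewrite ?normr1 ?normr0.
apply: aeW => x; rewrite indicE; case: (boolP (_ \in _)); last first.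
  rewrite notin_setE/= in_itv/= => /negP h.
  rewrite (_ : (fun n => _) = fun=> 0); first exact: cvg_cst.
  by apply/funext => n; rewrite bump_support.
rewrite inE/= in_itv/= => /andP[ax xb].
pose K := - (x - a)^-1 - (b - x)^-1.
rewrite (_ : (fun n => _) = fun n => expR (K * n.+1%:R^-1)); last first.
  apply/funext => n; rewrite /bump /flat !subr_gt0 ax xb !expr0 !mul1r -expRD.
  by congr expR; rewrite /K; ring.
rewrite [X in _ --> X](_ : _ = expR (K * 0)); last by rewrite mulr0 expR0.
apply: (@cvg_comp _ _ _ _ (@expR R) _ (nbhs (K * 0))); last exact: continuous_expR.
by apply: cvgM; [exact: cvg_cst|exact: cvg_harmonic].
Qed.

(** Dynkin's pi-lambda argument. Complements are taken inside a bounded interval, which keeps their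
    indicators square-integrable. *)
Lemma dense_indic (A : set R) (N : R) : measurable A ->
  dense (\1_(A `&` `](- N), N[%classic) : R -> R).
Proof.
move=> mA; pose I := `](- N), N[%classic : set R.
pose P (A : set R) := dense (\1_(A `&` I) : R -> R).
have mI : measurable I by exact: measurable_itv.
have lI : L2 (\1_I : R -> R) by exact: L2_indic_itv.
rewrite -/I -/(P A); apply: (@dynkin_induction _ (measurableTypeR R) (@ocitv R) P _ _ _ _ _ _ A mA) => //.
- by move=> B C hB hC; exact: ocitvI.
- by rewrite /P setTI; exact: dense_itv.
- move=> _ [[a b] _ <-]; rewrite /P/=.
  (* The generators are half-open while bumps approach open intervals; the two indicators differ at
     most at [b]. *)
  apply: (@dense_ae (\1_(`](Num.max a (- N)), (Num.min b N)[%classic))).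
  + by apply: measurable_indic; apply: measurableI.
  + exists [set b]; split => //; first exact: lebesgue_measure_set1.
    move=> x /= xab; apply: contrapT => xb; apply: xab.
    rewrite !indicE; congr (_%:R); congr nat_of_bool.
    apply/idP/idP; rewrite !inE /I/= !in_itv/= gt_max lt_min.
      by move=> /andP[/andP[ax Nx] /andP[xb' xN]]; split; rewrite ?ax ?Nx ?xN ?(ltW xb').
    move=> [/andP[ax xb'] /andP[Nx ->]]; rewrite ax Nx/= andbT lt_neqAle xb' andbT.
    exact/eqP.
  + exact: dense_itv.
- move=> B mB PB; rewrite /P.
  rewrite (_ : \1_ _ = fun x => \1_I x - \1_(B `&` I) x); first by apply: denseB => //; exact: dense_itv.
  apply/funext => x; rewrite !indicE !in_setI in_setC.
  by case: (x \in B); case: (x \in I); rewrite /= ?subrr ?subr0.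
- move=> F mF tF PF; rewrite /P.
  have mUF : measurable (\bigcup_k F k) by exact: bigcupT_measurable.
  have le1 (B : set R) x : `|\1_(B `&` I) x| <= \1_I x :> R.
    by rewrite !indicE in_setI; case: (x \in B); case: (x \in I); rewrite /= ?normr1 ?normr0.
  have mB (B : set R) : measurable B -> measurable_fun setT (\1_(B `&` I) : R -> R).
    by move=> ?; apply: measurable_indic; exact: measurableI.
  have mbig n : measurable (\big[setU/set0]_(i < n) F i) by exact: bigsetU_measurable.
  apply: (@dense_lim (fun n => \1_((\big[setU/set0]_(i < n) F i) `&` I))).
  + apply: L2P; first exact: mB.
    apply: (@intg_le _ _ (fun x => \1_I x ^+ 2)); [by apply: measurable_funX; exact: mB|exact: L2_sqr|].
    by move=> x; rewrite normrX ler_sqr ?nnegrE// indicE.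
  + elim=> [|n IH].
      rewrite big_ord0 set0I (_ : \1_ _ = fun=> 0); first exact: dense0.
      by apply/funext => x; rewrite indicE in_set0.
    rewrite big_ord_recr/= (_ : \1_ _ =
        fun x => \1_((\big[setU/set0]_(i < n) F i) `&` I) x + \1_(F n `&` I) x).
      by apply: denseD => //; exact: PF.
    apply/funext => x; rewrite !indicE !in_setI in_setU.
    have [xn|xn] := boolP (x \in F n); last by rewrite /= orbF addr0.
    rewrite orbT/= [x \in \big[_/_]_(_ < _) _]negbTE/= ?add0r//.
    apply/negP; rewrite inE -bigcup_mkord => -[k /= kn Fk].
    have := tF k n Logic.I Logic.I; rewrite inE in xn => /(_ (ex_intro _ x (conj Fk xn))).
    by move=> kn'; rewrite kn' ltnn in kn.
  + apply: (@L2_dct _ _ \1_I) => //; [by move=> n; exact: (mB _ (mbig n))|exact: (mB _ mUF)|].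
    apply: aeW => x; have [xF|xF] := pselect ((\bigcup_k F k) x); last first.
      rewrite (_ : (fun n => _) = fun=> \1_((\bigcup_k F k) `&` I) x); first exact: cvg_cst.
      apply/funext => n; rewrite !indicE !in_setI; congr (_ %:R); congr nat_of_bool; congr andb.
      apply/idP/idP; rewrite !inE -bigcup_mkord => // -[k _ Fk].
      by case: xF; exists k.
    case: xF (xF) => k _ Fk xF; apply: (@near_cst_continuous _ _ _ _) || apply: cvg_near_cst.
    exists k.+1 => // n /= kn; rewrite !indicE !in_setI; congr (_ %:R); congr nat_of_bool; congr andb.
    by rewrite !mem_set//; rewrite -bigcup_mkord; exists k.
Qed.

(** Positive and negative parts are limits of simple functions cut to ]-n, n[, which are
    combinations of the indicators already approximated. *)
Lemma dense_L2 f : L2 f -> dense f.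
Proof.
suff H g : L2 g -> (forall x, 0 <= g x) -> dense g.
  move=> lf; have mf := L2_measurable lf.
  have h (s : R -> R) : measurable_fun setT s -> (forall x, `|s x| = `|f x|) ->
      dense (fun x => Num.max (s x) 0).
    move=> ms sf; apply: H; last by move=> x; rewrite le_max lexx orbT.
    have mm : measurable_fun setT (fun x => Num.max (s x) 0) by apply: measurable_maxr.
    apply: L2P => //; apply: (@intg_le _ _ (fun x => f x ^+ 2)); [exact: measurable_funX|exact: L2_sqr|].
    move=> x; rewrite normrX -(real_normK (num_real (f x))) -sf ler_sqr ?nnegrE//.
    by rewrite /Num.max; case: ifPn => // _; rewrite normr0.
  rewrite (_ : f = fun x => Num.max (f x) 0 - Num.max (- f x) 0).
    apply: denseB; apply: h => //; first exact: measurableT_comp.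
    by move=> x; rewrite normrN.
  by apply/funext => x; rewrite /Num.max oppr_lt0; case: ltrgt0P; lra.
move=> lg g0; have mg := L2_measurable lg.
have mgE : measurable_fun setT (fun x => (g x)%:E) by apply/measurable_EFinP.
pose g_ n := nnsfun_approx measurableT mgE n.
have cg x : g_ n x @[n --> \oo] --> g x.
  have gE0 y : [set: R] y -> (0 <= (g y)%:E)%E by rewrite lee_fin.
  by have /fine_cvgP[_ h] := cvg_nnsfun_approx measurableT mgE gE0 (Logic.I : [set: R] x).
have g_le n x : 0 <= g_ n x <= g x.
  apply/andP; split; first exact: fun_ge0.
  rewrite -(cvg_lim (@Rhausdorff R) (cg x)).
  apply: (@nondecreasing_cvgn_le _ (fun n => g_ n x)); last by apply/cvg_ex; exists (g x); exact: cg.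
  by move=> a b ab; have /lefP := nd_nnsfun_approx measurableT mgE ab; exact.
pose I (n : nat) : set R := `](- n%:R), n%:R[%classic.
apply: (@dense_lim (fun n x => g_ n x * \1_(I n) x)) => //.
- move=> n.
  rewrite (_ : (fun x => _) = fun x => \sum_(y <- finmap.enum_fset (fset_set (range (g_ n))))
      y * \1_((g_ n @^-1` [set y]) `&` I n) x).
    by apply: dense_sum => y; apply: denseZ; exact: dense_indic.
  apply/funext => x; rewrite fimfunE fsbig_finite//= mulr_suml.
  apply: eq_bigr => y _; rewrite -mulrA; congr (_ * _).
  by rewrite indicI.
- have b01 n x : 0 <= (\1_(I n) x : R) <= 1 by rewrite indicE; case: (_ \in _); rewrite ?lexx ?ler01.
  apply: (@L2_dct _ _ g) => //.
  + by move=> n; apply: measurable_funM => //; apply: measurable_indic; exact: measurable_itv.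
  + move=> n x; have /andP[a b] := g_le n x; have /andP[c d] := b01 n x.
    rewrite ger0_norm ?mulr_ge0//; nra.
  + by move=> x; rewrite ger0_norm.
  + apply: aeW => x; rewrite -[X in _ --> X]mulr1; apply: cvgM; first exact: cg.
    apply: cvg_near_cst; exists (Num.trunc `|x|).+1 => // n /= xn.
    rewrite indicE mem_set// /I/= in_itv/= -ltr_norml.
    apply: (@lt_le_trans _ _ (Num.trunc `|x|).+1%:R); last by rewrite ler_nat.
    by rewrite truncnS_gt.
Qed.

End Density.

(** * Transport equations with a square-integrable source *)

Section Duality.
Context {R : realType}.
Local Notation mu := (@lebesgue_measure R).
Implicit Types (f g phi : R -> R) (x l c : R).

(** By density [f] itself can almost be taken as a test function. This converts bounds against test
    functions, all that a weak equation provides, into norm bounds. *)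
Lemma nrm_dual f K : L2 f -> 0 <= K ->
  (forall phi, test_function phi -> `|Int (fun x => f x * phi x)| <= K * nrm phi) ->
  nrm f <= K.
Proof.
move=> lf K0 H; rewrite leNgt; apply/negP => KN; set N := nrm f in KN *.
have N0 : 0 < N by exact: le_lt_trans KN.
(* Chosen so that e (K + N) is half of N (N - K), the excess to be contradicted. *)
pose e := N * (N - K) / (2 * (K + N)).
have e0 : 0 < e by rewrite divr_gt0 ?mulr_gt0 ?subr_gt0//; lra.
have [phi tphi ephi] := (dense_L2 lf).2 _ e0.
have lphi := test_L2 tphi; have lB := L2B lf lphi.
have E : N ^+ 2 = Int (fun x => f x * phi x) + Int (fun x => f x * (f x - phi x)).
  rewrite /N nrm_sqr -IntD; [|exact: intgM|exact: intgM].
  by apply: eq_Int => x; ring.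
have h1 := le_trans (ler_norm _) (H _ tphi).
have h2 := le_trans (ler_norm _) (cauchy_schwarz lf lB).
have h3 : nrm phi <= N + e.
  rewrite (_ : phi = fun x => f x - (f x - phi x)); last by apply/funext => x; ring.
  by have := nrmD lf (L2N lB); rewrite nrmN; rewrite -/N; lra.
have h4 : N ^+ 2 <= K * N + e * (K + N).
  have : K * nrm phi <= K * (N + e) by rewrite ler_wpM2l.
  have : N * nrm (fun x => f x - phi x) <= N * e by rewrite ler_wpM2l// ltW.
  move: h1 h2; rewrite -/N E; lra.
have : e * (K + N) = N * (N - K) / 2 by rewrite /e; field; rewrite gt_eqF//; lra.
move=> ee; move: h4; rewrite ee; have : 0 < N * (N - K) by rewrite mulr_gt0 ?subr_gt0.
rewrite expr2 mulrBr; lra.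
Qed.

Lemma ae0_test f : L2 f -> (forall phi, test_function phi -> Int (fun x => f x * phi x) = 0) ->
  {ae mu, forall x, f x = 0}.
Proof.
move=> lf H; apply: nrm_eq0_ae => //; apply/eqP; rewrite eq_le nrm_ge0 andbT.
by apply: nrm_dual => // phi /H ->; rewrite normr0 mul0r.
Qed.

Definition near0 (P : R -> Prop) := exists2 d : R, 0 < d & forall h, `|h| < d -> P h.

Lemma near0S (P Q : R -> Prop) : (forall h, P h -> Q h) -> near0 P -> near0 Q.
Proof. by move=> PQ [d d0 H]; exists d => // h /H /PQ. Qed.

Lemma near0S2 (P Q S : R -> Prop) : (forall h, P h -> Q h -> S h) -> near0 P -> near0 Q -> near0 S.
Proof.
move=> PQ [d d0 H] [e e0 K]; exists (Num.min d e); first by rewrite lt_min d0.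
by move=> h; rewrite lt_min => /andP[/H p /K]; exact: PQ.
Qed.

Lemma near0_le c : 0 < c -> near0 (fun h => `|h| <= c).
Proof. by move=> c0; exists c => // h /ltW. Qed.

Lemma near0_lt c : 0 < c -> near0 (fun h => `|h| < c).
Proof. by move=> c0; exists c. Qed.

Lemma near0_scale k (P : R -> Prop) : near0 P -> near0 (fun h => P (k * h)).
Proof.
move=> [d d0 H]; exists (d / (`|k| + 1)); first by rewrite divr_gt0// ltr_wpDl.
move=> h; rewrite ltr_pdivlMr ?ltr_wpDl// => hd; apply: H; rewrite normrM.
by have := normr_ge0 h; have := normr_ge0 k; nra.
Qed.

Definition cvL2 (F : R -> R -> R) g :=
  forall e, 0 < e -> near0 (fun h => nrm (fun x => F h x - g x) <= e).

(** For a test function this is Taylor's formula on a fixed support; since shifts are isometries,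
    the approximation error of [f] is paid twice, independently of [h]. *)
Lemma translation_continuous f k : L2 f -> cvL2 (fun h x => f (x + k * h)) f.
Proof.
move=> lf e e0; have e4 : 0 < e / 4 by rewrite divr_gt0.
have [phi tphi ephi] := (dense_L2 lf).2 _ e4.
have lphi := test_L2 tphi; have lB := L2B lf lphi.
have [K K0 HK] := test_taylor_nrm tphi.
set M := nrm (derive1 phi).
apply: (@near0_scale k (fun h => nrm (fun x => f (x + h) - f x) <= e)).
have c0 : 0 < e / (4 * (M + 1)) by rewrite divr_gt0// mulr_gt0// ltr_wpDl ?nrm_ge0.
have c1 : 0 < e / (4 * K) by rewrite divr_gt0// mulr_gt0.
apply: near0S2 (near0_le c0) (near0S2 (fun h a b => conj a b) (near0_le c1) (near0_le ltr01)) => h h1 [h2 h3].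
have l1 := L2_shift h lB; have l2 := L2_shift h lphi.
have lD := test_L2 (test_derive1 tphi).
have -> : (fun x => f (x + h) - f x) = fun x => ((f (x + h) - phi (x + h)) +
   (phi (x + h) - phi x - h * derive1 phi x)) + (h * derive1 phi x + - (f x - phi x)).
  by apply/funext => x; ring.
have l3 := L2B (L2B l2 lphi) (L2Z h lD).
apply: le_trans (nrmD (L2D l1 l3) (L2D (L2Z h lD) (L2N lB))) _.
apply: le_trans (lerD (nrmD l1 l3) (nrmD (L2Z h lD) (L2N lB))) _.
rewrite nrmN nrmZ// (nrm_shift h lB) -/M; have := HK _ h3.
move: h1 h2; rewrite !ler_pdivlMr ?mulr_gt0 ?ltr_wpDl ?nrm_ge0//.
have : h ^+ 2 = `|h| * `|h| by rewrite -expr2 real_normK// num_real.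
move=> ->; have := normr_ge0 h; have : 0 <= M := nrm_ge0 _; nra.
Qed.

End Duality.

(** * Differentiability in L^2 along characteristics *)

Section Transport.
Context {R : realType}.
Local Notation mu := (@lebesgue_measure R).
Implicit Types (phi psi : R -> R) (f g s z : R -> R -> R) (x l c sg t : R).

(* [f_t = sg f_x + s] *)
Record transport sg f s : Prop := Transport {
  transport_L2 : forall t, 0 < t -> L2 (f t) ;
  source_L2 : forall t, 0 < t -> L2 (s t) ;
  transport_cont : forall t, 0 < t -> cvL2 (fun h => f (t + h)) (f t) ;
  source_cont : forall t, 0 < t -> cvL2 (fun h => s (t + h)) (s t) ;
  transport_eq : forall phi, test_function phi -> forall t, 0 < t ->
    der (fun r => Int (fun x => f r x * phi x)) t
        (Int (fun x => s t x * phi x) - sg * Int (fun x => f t x * derive1 phi x)) }.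

Lemma derP_near0 (f : R -> R) x l : der f x l <->
  forall e, 0 < e -> near0 (fun h => `|f (x + h) - f x - h * l| <= e * `|h|).
Proof. exact: derP. Qed.

(** A test function carried along the characteristic contributes sg int f phi', which cancels the
    transport term of the weak equation and leaves the source alone. *)
Lemma transport_moving sg f s : transport sg f s -> forall phi, test_function phi ->
  forall t, 0 < t ->
  der (fun h => Int (fun x => f (t + h) x * phi (x + sg * h))) 0 (Int (fun x => s t x * phi x)).
Proof.
move=> T phi tphi t t0; apply/derP_near0 => e e0.
have e3 : 0 < e / 3 by rewrite divr_gt0.
have lphi := test_L2 tphi; have lD := test_L2 (test_derive1 tphi).
have [K K0 HK] := test_taylor_nrm tphi.
have lf := transport_L2 T t0.
have Eq := (derP_near0 _ _ _).1 (transport_eq T tphi t0) _ e3.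
pose B := `|sg| * nrm (derive1 phi) + K * sg ^+ 2.
have B0 : 0 <= B by rewrite addr_ge0// mulr_ge0 ?nrm_ge0 ?sqr_ge0 ?(ltW K0).
have c1 : 0 < e / 3 / (B + 1) by rewrite divr_gt0// ltr_wpDl.
have Ct := transport_cont T t0 c1.
pose A := nrm (f t) * K * sg ^+ 2.
have A0 : 0 <= A by rewrite mulr_ge0 ?sqr_ge0// mulr_ge0 ?nrm_ge0// ltW.
have c2 : 0 < e / 3 / (A + 1) by rewrite divr_gt0// ltr_wpDl.
have small := near0_scale sg (near0_le (@ltr01 R)).
apply: near0S2 (near0S2 (fun h a b => conj a b) (near0_lt t0) (near0S2 (fun h a b => conj a b) Eq Ct))
  (near0S2 (fun h a b => conj a b) (near0_le c2) (near0S2 (fun h a b => conj a b) small (near0_le (@ltr01 R)))).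
move=> h [ht [h1 h2]] [h3 [h4 h5]].
have th : 0 < t + h by move: ht; rewrite ltr_norml; lra.
have lfh := transport_L2 T th.
rewrite add0r addr0.
pose d x := f (t + h) x - f t x.
pose rho x := phi (x + sg * h) - phi x - sg * h * derive1 phi x.
have ld : L2 d by exact: L2B.
have lrho : L2 rho by exact: (L2B (L2B (L2_shift _ lphi) lphi) (L2Z _ lD)).
have lp : L2 (fun x => phi (x + sg * h) - phi x) by exact: L2B (L2_shift _ lphi) lphi.
have nrho := HK _ h4; rewrite -/rho in nrho.
have np : nrm (fun x => phi (x + sg * h) - phi x) <= B * `|h|.
  rewrite (_ : (fun x => _) = fun x => rho x + (sg * h) * derive1 phi x).
    apply: le_trans (nrmD lrho (L2Z _ lD)) _; rewrite nrmZ// normrM /B.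
    move: nrho; rewrite exprMn; have -> : h ^+ 2 = `|h| * `|h|.
      by rewrite -expr2 real_normK// num_real.
    have : 0 <= K * sg ^+ 2 * `|h| * (1 - `|h|).
      by apply: mulr_ge0; rewrite ?subr_ge0// mulr_ge0// mulr_ge0 ?sqr_ge0// ltW.
    nra.
  by apply/funext => x; rewrite /rho; ring.
(* Three errors, each worth e/3 |h|: the weak equation for the fixed [phi], the Taylor remainder
   [rho] against [f t], and a product of two increments, which is of higher order by continuity of
   [f] in time. *)
have -> : Int (fun x => f (t + h) x * phi (x + sg * h)) - Int (fun x => f t x * phi (x + sg * 0)) -
    h * Int (fun x => s t x * phi x) =
  (Int (fun x => f (t + h) x * phi x) - Int (fun x => f t x * phi x) -
   h * (Int (fun x => s t x * phi x) - sg * Int (fun x => f t x * derive1 phi x))) +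
  Int (fun x => f t x * rho x) + Int (fun x => d x * (phi (x + sg * h) - phi x)).
  have -> : Int (fun x => f t x * phi (x + sg * 0)) = Int (fun x => f t x * phi x).
    by apply: eq_Int => x; rewrite mulr0 addr0.
  have -> : Int (fun x => f t x * rho x) = Int (fun x => f t x * phi (x + sg * h)) -
      Int (fun x => f t x * phi x) - sg * h * Int (fun x => f t x * derive1 phi x).
    rewrite -IntZ ?(intgM lf lD)// -IntB ?(intgM lf lphi) ?(intgM lf (L2_shift _ lphi))//.
    rewrite -IntB; last 2 first.
    - exact: intgB (intgM lf (L2_shift _ lphi)) (intgM lf lphi).
    - exact: intgZ (intgM lf lD).
    by apply: eq_Int => x; rewrite /rho; ring.
  have -> : Int (fun x => d x * (phi (x + sg * h) - phi x)) =
      (Int (fun x => f (t + h) x * phi (x + sg * h)) - Int (fun x => f (t + h) x * phi x)) -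
      (Int (fun x => f t x * phi (x + sg * h)) - Int (fun x => f t x * phi x)).
    have i1 := intgM lfh (L2_shift (sg * h) lphi); have i2 := intgM lfh lphi.
    have i3 := intgM lf (L2_shift (sg * h) lphi); have i4 := intgM lf lphi.
    rewrite -(IntB i1 i2) -(IntB i3 i4) -(IntB (intgB i1 i2) (intgB i3 i4)).
    by apply: eq_Int => x; rewrite /d; ring.
  ring.
have b2 : `|Int (fun x => f t x * rho x)| <= e / 3 * `|h|.
  apply: le_trans (cauchy_schwarz lf lrho) _.
  apply: (@le_trans _ _ (A * `|h| * `|h|)).
    rewrite /A -!mulrA ler_wpM2l ?nrm_ge0//; apply: le_trans nrho _.
    rewrite le_eqVlt; apply/orP; left; apply/eqP.
    by rewrite exprMn -(real_normK (num_real h)); ring.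
  rewrite ler_wpM2r//; move: h3; rewrite ler_pdivlMr ?ltr_wpDl//.
  have := normr_ge0 h; nra.
have b3 : `|Int (fun x => d x * (phi (x + sg * h) - phi x))| <= e / 3 * `|h|.
  apply: le_trans (cauchy_schwarz ld lp) _.
  apply: (@le_trans _ _ (e / 3 / (B + 1) * (B * `|h|))).
    by apply: ler_pM => //; exact: nrm_ge0.
  rewrite mulrA ler_wpM2r// -mulrA ger_pMr// mulrC ler_pdivrMr ?ltr_wpDl//; lra.
apply: le_trans (ler_normD _ _) _; apply: le_trans (lerD (ler_normD _ _) (lexx _)) _.
lra.
Qed.

(** Against a fixed test function the remainder has a derivative in the step, namely the variation
    of the shifted source; the mean value theorem bounds it and duality removes the test
    function. *)
Lemma transport_strong sg f s : transport sg f s -> forall t, 0 < t ->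
  forall e, 0 < e -> near0 (fun h => nrm (fun x => f (t + h) (x - sg * h) - f t x - h * s t x) <= e * `|h|).
Proof.
move=> T t t0 e e0; have e2 : 0 < e / 2 by rewrite divr_gt0.
have ls := source_L2 T t0; have lf := transport_L2 T t0.
have [d d0 Hd] : near0 (fun h => `|h| < t /\ nrm (fun x => s (t + h) (x - sg * h) - s t x) <= e).
  apply: near0S2 (near0_lt t0) (near0S2 (fun h a b => conj a b) (source_cont T t0 e2)
    (translation_continuous (- sg) ls e2)) => h ht [h1 h2]; split=> //.
  have th : 0 < t + h by move: ht; rewrite ltr_norml; lra.
  have lsh := source_L2 T th.
  have -> : (fun x => s (t + h) (x - sg * h) - s t x) = fun x =>
    (s (t + h) (x - sg * h) - s t (x - sg * h)) + (s t (x + - sg * h) - s t x).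
    by apply/funext => x; rewrite -mulNr; ring.
  apply: le_trans (nrmD _ _) _.
  - exact: L2_shift (L2B lsh ls).
  - exact: L2B (L2_shift _ ls) ls.
  - by rewrite (nrm_shift _ (L2B lsh ls)); lra.
(* The radius [d] depends only on the continuity of [s] and of its translates, not on the test
   function; this uniformity is what [nrm_dual] requires. *)
exists d => // h hd.
have [ht _] := Hd _ hd.
have th : 0 < t + h by move: ht; rewrite ltr_norml; lra.
have lF : L2 (fun x => f (t + h) (x - sg * h)) by exact: L2_shift (transport_L2 T th).
apply: nrm_dual; first exact: L2B (L2B lF lf) (L2Z h ls).
  by rewrite mulr_ge0// ltW.
move=> phi tphi; have lphi := test_L2 tphi.
pose a r := Int (fun x => f (t + r) x * phi (x + sg * r)) - r * Int (fun x => s t x * phi x).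
pose a' r := Int (fun x => s (t + r) x * phi (x + sg * r)) - Int (fun x => s t x * phi x).
have -> : Int (fun x => (f (t + h) (x - sg * h) - f t x - h * s t x) * phi x) = a (0 + h) - a 0.
  rewrite /a add0r mul0r subr0.
  have -> : Int (fun x => f (t + 0) x * phi (x + sg * 0)) = Int (fun x => f t x * phi x).
    by apply: eq_Int => x; rewrite mulr0 !addr0.
  rewrite -(Int_shift (- (sg * h)) (intgM (transport_L2 T th) (L2_shift (sg * h) lphi))).
  have i1 := intgM lF lphi; have i2 := intgM lf lphi; have i3 := intgM ls lphi.
  have -> : Int (fun x => f (t + h) (x + - (sg * h)) * phi (x + - (sg * h) + sg * h)) =
     Int (fun x => f (t + h) (x - sg * h) * phi x) by apply: eq_Int => x; rewrite subrK.
  rewrite -(IntZ h i3) -(IntB i1 (intgZ h i3)) -(IntB (intgB i1 (intgZ h i3)) i2).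
  by apply: eq_Int => x; ring.
have key r : `|r| < d -> der a r (a' r) /\ `|a' r| <= e * nrm phi.
  move=> rd; have [rt rs] := Hd _ rd.
  have tr : 0 < t + r by move: rt; rewrite ltr_norml; lra.
  have lsr := source_L2 T tr.
  split.
    have h0 := transport_moving T (test_shift (sg * r) tphi) tr.
    have h1 : der (fun y => Int (fun x => f (t + y) x * phi (x + sg * y))) r
      (Int (fun x => s (t + r) x * phi (x + sg * r))).
      apply/derP_near0 => e' e'0; apply: near0S ((derP_near0 _ _ _).1 h0 _ e'0) => k.
      rewrite add0r addr0; congr (`|Int _ - Int _ - _| <= _); apply/funext => x.
        by rewrite addrA; congr (_ * phi _); ring.
      by congr (_ * phi _); ring.
    apply: (derB h1 (derM (der_id r) (der_cst _ r) (erefl _))).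
    by rewrite mul1r mulr0 addr0.
  rewrite /a' -(Int_shift (- (sg * r)) (intgM lsr (L2_shift (sg * r) lphi))).
  have lS : L2 (fun x => s (t + r) (x - sg * r)) by exact: L2_shift lsr.
  have -> : Int (fun x => s (t + r) (x + - (sg * r)) * phi (x + - (sg * r) + sg * r)) =
     Int (fun x => s (t + r) (x - sg * r) * phi x) by apply: eq_Int => x; rewrite subrK.
  rewrite -(IntB (intgM lS lphi) (intgM ls lphi)).
  rewrite (eq_Int (g := fun x => (s (t + r) (x - sg * r) - s t x) * phi x)); last by move=> x; ring.
  apply: le_trans (cauchy_schwarz (L2B lS ls) lphi) _.
  by rewrite ler_wpM2r ?nrm_ge0.
rewrite mulrAC; apply: (mvt_bound (df := a')) => y; rewrite subr0 => yh;
  by have [] := key y (le_lt_trans yh hd).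
Qed.

End Transport.

(** * Bilinear identity along characteristics *)

Section Bilinear.
Context {R : realType}.
Local Notation mu := (@lebesgue_measure R).
Implicit Types (phi psi : R -> R) (f g s z : R -> R -> R) (x l c sg t K : R).

(** The Taylor remainder is uniform in [x], so that difference quotients of the weight converge
    uniformly and may multiply products of merely square-integrable functions. *)
Definition weight psi psi1 := [/\ measurable_fun setT psi, measurable_fun setT psi1 &
  exists2 K, 0 < K & [/\ forall x, `|psi x| <= K, forall x, `|psi1 x| <= K &
    forall x h, `|psi (x + h) - psi x - h * psi1 x| <= K * h ^+ 2]].

Lemma weight_der psi psi1 psi2 K : (forall x, der psi x (psi1 x)) ->
  (forall x, der psi1 x (psi2 x)) -> (forall x, `|psi x| <= K) ->
  (forall x, `|psi1 x| <= K) -> (forall x, `|psi2 x| <= K) -> weight psi psi1.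
Proof.
move=> d1 d2 K0 K1 K2; split.
- by apply: continuous_measurable_fun => x; exact: der_continuous (d1 x).
- by apply: continuous_measurable_fun => x; exact: der_continuous (d2 x).
have h0 : 0 <= K by exact: le_trans (K0 0).
exists (K + 1); [by rewrite ltr_wpDl|split].
- by move=> x; rewrite (le_trans (K0 x))// lerDl.
- by move=> x; rewrite (le_trans (K1 x))// lerDl.
- move=> x h; apply: le_trans (taylor2 x h d1 d2 K2) _.
  by rewrite ler_wpM2r ?sqr_ge0// lerDl.
Qed.

Lemma weight_test phi : test_function phi -> weight phi (derive1 phi).
Proof.
move=> t0; have t1 := test_derive1 t0; have t2 := test_derive1 t1.
have [K0 K00 h0] := test_bounded t0; have [K1 K10 h1] := test_bounded t1.
have [K2 K20 h2] := test_bounded t2.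
apply: (@weight_der _ _ (derive1 (derive1 phi)) (K0 + K1 + K2)) => x.
- exact: test_der.
- exact: test_der.
- by rewrite (le_trans (h0 x))//; lra.
- by rewrite (le_trans (h1 x))//; lra.
- by rewrite (le_trans (h2 x))//; lra.
Qed.

Definition cv0 (a : R -> R) l := forall e, 0 < e -> near0 (fun h => h != 0 -> `|a h - l| <= e).

Lemma cv0D a b k l : cv0 a k -> cv0 b l -> cv0 (fun h => a h + b h) (k + l).
Proof.
move=> ak bl e e0; have e2 : 0 < e / 2 by rewrite divr_gt0.
apply: near0S2 (ak _ e2) (bl _ e2) => h ah bh h0.
rewrite (_ : _ - _ = (a h - k) + (b h - l)); last by ring.
by apply: le_trans (ler_normD _ _) _; have := ah h0; have := bh h0; lra.
Qed.

Lemma cv0_der (f : R -> R) x l : cv0 (fun h => h^-1 * (f (x + h) - f x)) l -> der f x l.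
Proof.
move=> H; apply/derP_near0 => e e0; apply: near0S (H e e0) => h Hh.
have [->|h0] := eqVneq h 0; first by rewrite addr0 mul0r subrr subr0 normr0 mulr0.
rewrite (_ : _ - _ = (h^-1 * (f (x + h) - f x) - l) * h); last by field.
by rewrite normrM ler_wpM2r// Hh.
Qed.

(** Difference quotients need [h != 0], and membership in L^2 is part of the notion because [t + h]
    may be a negative time, where nothing is known of the fields. *)
Definition cvL2' (F : R -> R -> R) (g : R -> R) :=
  forall e, 0 < e -> near0 (fun h => h != 0 -> L2 (F h) /\ nrm (fun x => F h x - g x) <= e).

Lemma trilinear_cvg (a : R -> R -> R) (a0 : R -> R) K (F G : R -> R -> R) (F0 G0 : R -> R) :
  measurable_fun setT a0 -> (forall x, `|a0 x| <= K) ->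
  (forall h, measurable_fun setT (a h)) ->
  (forall e, 0 < e -> near0 (fun h => h != 0 -> forall x, `|a h x - a0 x| <= e)) ->
  L2 F0 -> L2 G0 -> cvL2' F F0 -> cvL2' G G0 ->
  cv0 (fun h => Int (fun x => a h x * F h x * G h x)) (Int (fun x => a0 x * F0 x * G0 x)).
Proof.
move=> ma0 aK ma ca lF0 lG0 cF cG e e0.
have K0 : 0 <= K by exact: le_trans (aK 0).
set nF := nrm F0; set nG := nrm G0.
have nF0 : 0 <= nF by exact: nrm_ge0.
have nG0 : 0 <= nG by exact: nrm_ge0.
(* The three summands bound the three terms of the telescoped difference (coefficient, then [F],
   then [G]) once the errors [d] are at most 1. *)
pose C := (nF + 1) * (nG + 1) + K * (nG + 1) + K * nF + 1.
have C0 : 0 < C by rewrite ltr_wpDl// !addr_ge0// mulr_ge0// addr_ge0.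
pose d := Num.min 1 (e / C).
have d0 : 0 < d by rewrite lt_min ltr01 divr_gt0.
have d1 : d <= 1 by rewrite ge_min lexx.
have dC : d * C <= e by rewrite -ler_pdivlMr// ge_min lexx orbT.
apply: near0S2 (ca d d0) (near0S2 (fun h a b => conj a b) (cF d d0) (cG d d0)) => h Ha [HF HG] h0.
have {}Ha := Ha h0; have {HF}[lF HF] := HF h0; have {HG}[lG HG] := HG h0.
have lFB := L2B lF lF0; have lGB := L2B lG lG0.
have mah x : `|a h x| <= K + 1.
  rewrite (_ : a h x = (a h x - a0 x) + a0 x); last by ring.
  by apply: le_trans (ler_normD _ _) _; have := Ha x; have := aK x; lra.
have mB : measurable_fun setT (fun x => a h x - a0 x) by exact: measurable_funB.
have nFh : nrm (F h) <= nF + d.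
  rewrite (_ : F h = fun x => F0 x + (F h x - F0 x)); last by apply/funext => x; ring.
  by apply: le_trans (nrmD lF0 lFB) _; rewrite lerD2l.
have nGh : nrm (G h) <= nG + d.
  rewrite (_ : G h = fun x => G0 x + (G h x - G0 x)); last by apply/funext => x; ring.
  by apply: le_trans (nrmD lG0 lGB) _; rewrite lerD2l.
have i1 := intgM3 mB Ha lF lG; have i2 := intgM3 ma0 aK lFB lG; have i3 := intgM3 ma0 aK lF0 lGB.
rewrite -IntB; [|exact: (intgM3 (ma h) mah lF lG)|exact: (intgM3 ma0 aK lF0 lG0)].
rewrite (eq_Int (g := fun x => ((a h x - a0 x) * F h x * G h x + a0 x * (F h x - F0 x) * G h x)
   + a0 x * F0 x * (G h x - G0 x))); last by move=> x; ring.
rewrite (IntD (intgD i1 i2) i3) (IntD i1 i2).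
have b1 := le_trans (cauchy_schwarz (L2M mB Ha lF) lG)
  (ler_wpM2r (nrm_ge0 (G h)) (nrmM mB Ha lF)).
have b2 := le_trans (cauchy_schwarz (L2M ma0 aK lFB) lG)
  (ler_wpM2r (nrm_ge0 (G h)) (nrmM ma0 aK lFB)).
have b3 := le_trans (cauchy_schwarz (L2M ma0 aK lF0) lGB)
  (ler_wpM2r (nrm_ge0 _) (nrmM ma0 aK lF0)).
apply: le_trans (ler_normD _ _) _; apply: le_trans (lerD (ler_normD _ _) (lexx _)) _.
apply: le_trans (lerD (lerD b1 b2) b3) _.
apply: le_trans dC; rewrite /C.
have t1 : d * nrm (F h) * nrm (G h) <= d * ((nF + 1) * (nG + 1)).
  rewrite -mulrA ler_wpM2l ?(ltW d0)// ler_pM ?nrm_ge0//; lra.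
have t2 : K * nrm (fun x => F h x - F0 x) * nrm (G h) <= d * (K * (nG + 1)).
  rewrite [leRHS](_ : _ = K * (d * (nG + 1))); last by ring.
  rewrite -mulrA ler_wpM2l// ler_pM ?nrm_ge0//; lra.
have t3 : K * nrm F0 * nrm (fun x => G h x - G0 x) <= d * (K * nF).
  rewrite [leRHS](_ : _ = K * nF * d); last by ring.
  by rewrite ler_wpM2l// mulr_ge0.
rewrite !mulrDr mulr1 in t1 t2 t3 *; lra.
Qed.

Let shifted sg f t h x := f (t + h) (x - sg * h).

Let cv_shifted sg f s t : transport sg f s -> 0 < t -> cvL2' (shifted sg f t) (f t).
Proof.
move=> T t0 e e0; have e2 : 0 < e / 2 by rewrite divr_gt0.
have lf := transport_L2 T t0.
apply: near0S2 (near0_lt t0) (near0S2 (fun h a b => conj a b) (transport_cont T t0 e2)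
    (translation_continuous (- sg) lf e2)) => h ht [h1 h2] _.
have th : 0 < t + h by move: ht; rewrite ltr_norml; lra.
have lfh := transport_L2 T th.
split; first exact: L2_shift lfh.
have -> : (fun x => shifted sg f t h x - f t x) = fun x =>
    (f (t + h) (x - sg * h) - f t (x - sg * h)) + (f t (x + - sg * h) - f t x).
  by apply/funext => x; rewrite /shifted -mulNr; ring.
apply: le_trans (nrmD _ _) _.
- exact: L2_shift (L2B lfh lf).
- exact: L2B (L2_shift _ lf) lf.
- by rewrite (nrm_shift _ (L2B lfh lf)); lra.
Qed.

Let cv_quotient sg f s t : transport sg f s -> 0 < t ->
  cvL2' (fun h x => h^-1 * (shifted sg f t h x - f t x)) (s t).
Proof.
move=> T t0 e e0; have lf := transport_L2 T t0; have ls := source_L2 T t0.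
apply: near0S2 (near0_lt t0) (transport_strong T t0 e0) => h ht H h0.
have th : 0 < t + h by move: ht; rewrite ltr_norml; lra.
have lfh : L2 (shifted sg f t h) by exact: L2_shift (transport_L2 T th).
split; first exact: L2Z (L2B lfh lf).
rewrite (_ : (fun x => _) = fun x => h^-1 * (f (t + h) (x - sg * h) - f t x - h * s t x)).
  rewrite nrmZ; last exact: L2B (L2B lfh lf) (L2Z h ls).
  by rewrite normfV mulrC ler_pdivrMr ?normr_gt0.
by apply/funext => x; rewrite /shifted; field.
Qed.

Section bilinear.
Variables (sg : R) (f s g z : R -> R -> R).
Hypotheses (Tf : transport sg f s) (Tg : transport sg g z).
Variables (psi psi1 : R -> R).
Hypothesis w : weight psi psi1.

(** Translation invariance of the integral passes to the moving frame, where both fields are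
    differentiable in L^2 and the weight becomes psi(x - sg h); the three terms are the derivatives
    of the three factors. *)
Lemma transport_bilinear t : 0 < t -> der (fun r => Int (fun x => psi x * f r x * g r x)) t
  (- sg * Int (fun x => psi1 x * f t x * g t x) +
   (Int (fun x => psi x * s t x * g t x) + Int (fun x => psi x * f t x * z t x))).
Proof.
move=> t0; case: w => mpsi mpsi1 [K K0 [pK p1K pT]].
have [lf ls] := (transport_L2 Tf t0, source_L2 Tf t0).
have [lg lz] := (transport_L2 Tg t0, source_L2 Tg t0).
apply: cv0_der.
pose Psi h x := psi (x - sg * h).
have mPsi h : measurable_fun setT (Psi h).
  exact: (measurableT_comp mpsi (measurable_shift (- (sg * h)))).
have PsiK h x : `|Psi h x| <= K by exact: pK.
have mq h : measurable_fun setT (fun x => h^-1 * (Psi h x - psi x)).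
  by apply: measurable_funM => //; exact: measurable_funB.
have mp : measurable_fun setT (fun x => - sg * psi1 x) by exact: measurable_funM.
have pK' x : `|- sg * psi1 x| <= `|sg| * K by rewrite normrM normrN ler_wpM2l.
have quad h x : `|Psi h x - psi x - - sg * h * psi1 x| <= K * (sg ^+ 2 * h ^+ 2).
  by have := pT x (- (sg * h)); rewrite /Psi sqrrN exprMn !mulNr.
have cq (e : R) : 0 < e -> near0 (fun h => h != 0 -> forall x, `|h^-1 * (Psi h x - psi x) - - sg * psi1 x| <= e).
  move=> e0; pose A := K * sg ^+ 2.
  have A0 : 0 <= A by rewrite mulr_ge0 ?sqr_ge0 ?ltW.
  have c0 : 0 < e / (A + 1) by rewrite divr_gt0// ltr_wpDl.
  apply: near0S (near0_le c0) => h; rewrite ler_pdivlMr ?ltr_wpDl// => hA h0 x.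
  rewrite (_ : _ - _ = h^-1 * (Psi h x - psi x - - sg * h * psi1 x)); last by field.
  rewrite normrM normfV mulrC ler_pdivrMr ?normr_gt0//; apply: le_trans (quad h x) _.
  rewrite -(real_normK (num_real h)) expr2 !mulrA ler_wpM2r//.
  by move: hA; rewrite /A; have := normr_ge0 h; nra.
have cP (e : R) : 0 < e -> near0 (fun h => h != 0 -> forall x, `|Psi h x - psi x| <= e).
  move=> e0; pose B := `|sg| * K + K * sg ^+ 2.
  have B0 : 0 <= B by apply: addr_ge0; rewrite mulr_ge0 ?sqr_ge0 ?(ltW K0).
  have c0 : 0 < e / (B + 1) by rewrite divr_gt0// ltr_wpDl.
  apply: near0S2 (near0_le c0) (near0_le ltr01) => h; rewrite ler_pdivlMr ?ltr_wpDl// => hB h1 h0 x.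
  rewrite (_ : _ - _ = (Psi h x - psi x - - sg * h * psi1 x) + h * (- sg * psi1 x)); last by ring.
  apply: le_trans (ler_normD _ _) _; apply: le_trans (lerD (quad h x) (lexx _)) _.
  rewrite normrM -(real_normK (num_real h)).
  have : `|h| * `|- sg * psi1 x| <= `|h| * (`|sg| * K) by rewrite ler_wpM2l.
  have : 0 <= K * sg ^+ 2 * `|h| * (1 - `|h|).
    by apply: mulr_ge0; rewrite ?subr_ge0// mulr_ge0// mulr_ge0 ?sqr_ge0// ltW.
  move: hB; rewrite /B; have := normr_ge0 h; nra.
(* Discrete product rule: the factor being differenced has the earlier factors at time [t] and the
   later ones at time [t + h]. *)
have c1 := trilinear_cvg mp pK' mq cq lf lg (cv_shifted Tf t0) (cv_shifted Tg t0).
have c2 := trilinear_cvg mpsi pK (fun=> mpsi) _ ls lg (cv_quotient Tf t0) (cv_shifted Tg t0).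
have c3 := trilinear_cvg mpsi pK (fun=> mpsi) _ lf lz _ (cv_quotient Tg t0).
have cst (e : R) : 0 < e -> near0 (fun h : R => h != 0 -> forall x, `|psi x - psi x| <= e).
  by move=> e0; exists 1 => // h _ _ x; rewrite subrr normr0 ltW.
have cf (e : R) : 0 < e -> near0 (fun h : R => h != 0 -> L2 (f t) /\ nrm (fun x => f t x - f t x) <= e).
  move=> e0; exists 1 => // h _ _; split => //.
  rewrite (_ : (fun x => _) = fun=> 0) ?nrm0 ?ltW//.
  by apply/funext => x; rewrite subrr.
have e1 : Int (fun x => - sg * psi1 x * f t x * g t x) = - sg * Int (fun x => psi1 x * f t x * g t x).
  by rewrite -IntZ ?(intgM3 mpsi1 p1K lf lg)//; apply: eq_Int => x; ring.
have := cv0D c1 (cv0D (c2 cst) (c3 (fun=> f t) cst cf)).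
rewrite e1 => H e e0; apply: near0S2 (near0_lt t0) (H e e0) => h ht {}H h0.
have th : 0 < t + h by move: ht; rewrite ltr_norml; lra.
move: (H h0); congr (`|_ - _| <= _).
have lF : L2 (shifted sg f t h) by exact: L2_shift (transport_L2 Tf th).
have lG : L2 (shifted sg g t h) by exact: L2_shift (transport_L2 Tg th).
have i0 := intgM3 mpsi pK (transport_L2 Tf th) (transport_L2 Tg th).
rewrite -(Int_shift (- (sg * h)) i0).
have -> : Int (fun x => psi (x + - (sg * h)) * f (t + h) (x + - (sg * h)) * g (t + h) (x + - (sg * h))) =
  Int (fun x => Psi h x * shifted sg f t h x * shifted sg g t h x) by [].
have j0 := intgM3 (mPsi h) (PsiK h) lF lG; have j1 := intgM3 mpsi pK lf lg.
have k1 := intgM3 mpsi pK lF lG; have k2 := intgM3 mpsi pK lf lG.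
have E1 : Int (fun x => h^-1 * (Psi h x - psi x) * shifted sg f t h x * shifted sg g t h x) =
   h^-1 * (Int (fun x => Psi h x * shifted sg f t h x * shifted sg g t h x) -
     Int (fun x => psi x * shifted sg f t h x * shifted sg g t h x)).
  by rewrite -(IntB j0 k1) -(IntZ _ (intgB j0 k1)); apply: eq_Int => x; ring.
have E2 : Int (fun x => psi x * (h^-1 * (shifted sg f t h x - f t x)) * shifted sg g t h x) =
   h^-1 * (Int (fun x => psi x * shifted sg f t h x * shifted sg g t h x) -
     Int (fun x => psi x * f t x * shifted sg g t h x)).
  by rewrite -(IntB k1 k2) -(IntZ _ (intgB k1 k2)); apply: eq_Int => x; ring.
have E3 : Int (fun x => psi x * f t x * (h^-1 * (shifted sg g t h x - g t x))) =
   h^-1 * (Int (fun x => psi x * f t x * shifted sg g t h x) - Int (fun x => psi x * f t x * g t x)).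
  by rewrite -(IntB k2 j1) -(IntZ _ (intgB k2 j1)); apply: eq_Int => x; ring.
by rewrite E1 E2 E3; ring.
Qed.

End bilinear.
End Bilinear.

(** * Hyperbolic tangent weights *)

Section Tanh.
Context {R : realType}.
Implicit Types (x y k b : R) (P : {poly R}).

Definition tanh x : R := 1 - 2 / (expR (2 * x) + 1).

Let E1 x : 0 < expR (2 * x) + 1.
Proof. by rewrite addr_gt0 ?expR_gt0. Qed.

Lemma tanh_lt1 x : tanh x < 1.
Proof. by rewrite /tanh ltrBlDr ltrDl divr_gt0. Qed.

Lemma tanh_gtN1 x : -1 < tanh x.
Proof.
rewrite /tanh ltrBrDr -ltrBrDl opprK ltr_pdivrMr//; have := expR_gt0 (2 * x); lra.
Qed.

Lemma tanh_norm x : `|tanh x| <= 1.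
Proof. by rewrite ler_norml !ltW ?tanh_lt1 ?tanh_gtN1. Qed.

Lemma tanhN x : tanh (- x) = - tanh x.
Proof.
rewrite /tanh mulrN expRN; have := expR_gt0 (2 * x); set e := expR _ => e0.
by field; rewrite ?gt_eqF// addr_gt0.
Qed.

Lemma tanh0 : tanh 0 = 0.
Proof. by rewrite /tanh mulr0 expR0; field. Qed.

Lemma tanh_ge0 x : 0 <= x -> 0 <= tanh x.
Proof.
move=> x0; rewrite /tanh subr_ge0 ler_pdivrMr// mul1r.
have : 1 <= expR (2 * x) by rewrite -expR0 ler_expR mulr_ge0.
lra.
Qed.

Lemma der_tanh x : der tanh x (1 - tanh x ^+ 2).
Proof.
have d1 : der (fun y => expR (2 * y)) x (2 * expR (2 * x)).
  by apply: (der_expR (derZ (der_id x) (erefl (2 * 1)))); rewrite mulr1.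
have d2 : der (fun y => expR (2 * y) + 1) x (2 * expR (2 * x)).
  by apply: (derD d1 (der_cst 1 x)); rewrite addr0.
have d3 := derV (f := fun y => expR (2 * y) + 1) (lt0r_neq0 (E1 x)) d2 (erefl _).
apply: (derB (der_cst 1 x) (derZ d3 (erefl _))).
by rewrite /tanh; field; rewrite gt_eqF.
Qed.

Lemma tanh_le x : `|tanh x| <= `|x|.
Proof.
have := @mvt_bound R tanh (fun y => 1 - tanh y ^+ 2) 1 0 x.
rewrite add0r tanh0 subr0 mul1r; apply => y _; first exact: der_tanh.
have := tanh_norm y; rewrite ler_norml => /andP[a b].
rewrite ger0_norm; nra.
Qed.

(** The action of d/dx on polynomials in tanh. It shows at once that all their derivatives are
    bounded, because tanh stays in [-1, 1]. *)
Definition derP_tanh P : {poly R} := P^`() * (1 - 'X ^+ 2).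

Lemma der_poly P x : der (fun y => P.[y]) x (P^`()).[x].
Proof. exact: is_derive_poly. Qed.

Lemma poly_bounded P : exists2 K, 0 <= K & forall y, `|y| <= 1 -> `|P.[y]| <= K.
Proof.
exists (\sum_(i < size P) `|P`_i|); first exact: sumr_ge0.
move=> y y1; rewrite horner_coef; apply: le_trans (ler_norm_sum _ _ _) _.
by apply: ler_sum => i _; rewrite normrM normrX ler_piMr// exprn_ile1.
Qed.

Lemma der_poly_tanh P k b x :
  der (fun x => P.[tanh (k * x + b)]) x (k * (derP_tanh P).[tanh (k * x + b)]).
Proof.
have d1 := der_comp (g := fun y => k * y + b) (der_tanh (k * x + b)) (der_affine k b x) (erefl _).
apply: (der_comp (g := fun y => tanh (k * y + b)) (der_poly P (tanh (k * x + b))) d1).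
by rewrite /derP_tanh hornerM hornerD hornerN hornerXn -polyC1 hornerC; ring.
Qed.

Lemma weight_poly_affine P k b : weight (fun x => P.[tanh (k * x + b)])
  (fun x => k * (derP_tanh P).[tanh (k * x + b)]).
Proof.
have [K0 K00 H0] := poly_bounded P; have [K1 K10 H1] := poly_bounded (derP_tanh P).
have [K2 K20 H2] := poly_bounded (derP_tanh (derP_tanh P)).
have nk := normr_ge0 k.
have p1 : 0 <= `|k| * K1 by rewrite mulr_ge0.
have p2 : 0 <= `|k| * (`|k| * K2) by rewrite !mulr_ge0.
apply: (@weight_der _ _ _ (fun x => k * (k * (derP_tanh (derP_tanh P)).[tanh (k * x + b)]))
   (K0 + `|k| * K1 + `|k| * (`|k| * K2))) => x.
- exact: der_poly_tanh.
- exact: (derZ (der_poly_tanh _ _ _ _) (erefl _)).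
- by have := H0 _ (tanh_norm (k * x + b)); lra.
- rewrite normrM; have := ler_wpM2l nk (H1 _ (tanh_norm (k * x + b))); lra.
- rewrite !normrM; have := ler_wpM2l nk (ler_wpM2l nk (H2 _ (tanh_norm (k * x + b)))); lra.
Qed.

Lemma weight_poly P : weight (fun x => P.[tanh x]) (fun x => (derP_tanh P).[tanh x]).
Proof.
have := weight_poly_affine P 1 0.
have -> : (fun x => P.[tanh (1 * x + 0)]) = (fun x => P.[tanh x]).
  by apply/funext => x; rewrite mul1r addr0.
by have -> : (fun x => 1 * (derP_tanh P).[tanh (1 * x + 0)]) = (fun x => (derP_tanh P).[tanh x])
  by apply/funext => x; rewrite !mul1r addr0.
Qed.

End Tanh.

(** * Pointwise bounds from averages over balls *)

Section Averages.
Context {R : realType}.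
Local Notation mu := (@lebesgue_measure R).

(** Almost every point is a Lebesgue point, hence a limit of averages over balls of radius 1/(n+1).
    Sup bounds follow without choosing a continuous representative. *)
Lemma ae_le_averages (f : R -> R) M : intg f ->
  (forall a d, 0 < d -> Int (fun x => f x * \1_(ball a d) x) <= M * (d *+ 2)) ->
  {ae mu, forall x, f x <= M}.
Proof.
move=> fi H.
have lf : locally_integrable setT f by apply: open_integrable_locally => //; exact: openT.
pose E (x : R) (n : nat) : set R := ball x n.+1%:R^-1.
have hE x : nicely_shrinking x (E x).
  split=> [n|]; first exact: measurable_ball.
  exists (1, fun n => PosNum (divr_gt0 (@ltr01 R) (ltr0Sn R n))); split => //=.
  - by under eq_fun do rewrite div1r; exact: cvg_harmonic.
  - by move=> n; rewrite /E div1r.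
  - by move=> n; rewrite mul1e /E div1r.
apply: ae_imply (lebesgue_differentiation lf) => x fx.
have := nice_lebesgue_differentiation hE lf fx.
move=> /fine_cvgP[_ cf].
apply: (@closed_cvg _ _ _ eventually_filter (fun n => fine ((mu (E x n))^-1 * \int[mu]_(y in E x n) (f y)%:E)%E) (fun y => y <= M) _ _ _ cf).
  exact: closed_le.
apply: nearW => n.
have n0 : 0 < n.+1%:R^-1 :> R by rewrite invr_gt0.
have := H x _ n0; set d := n.+1%:R^-1 in n0 *.
have mB : measurable (ball x d) by exact: measurable_ball.
have -> : Int (fun y => f y * \1_(ball x d) y) = fine (\int[mu]_(y in ball x d) (f y)%:E)%E.
  rewrite /Int /Rintegral; congr fine; rewrite [RHS]integral_mkcond.
  apply: eq_integral => y _; rewrite indicE patchE; case: ifPn => _; by rewrite ?mulr1 ?mulr0.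
have fin : (\int[mu]_(y in ball x d) (f y)%:E)%E \is a fin_num.
  by apply: integrable_fin_num => //; apply: integrableS fi.
rewrite -[E x n]/(ball x d).
have -> : mu (ball x d) = (d *+ 2)%:E by rewrite lebesgue_measure_ball// ltW.
rewrite inver mulrn_eq0/= gt_eqF// -(fineK fin) -EFinM/=.
by move=> h; rewrite mulrC ler_pdivrMr// pmulrn_lgt0.
Qed.

End Averages.

(** * Weak derivatives *)

Section Sobolev.
Context {R : realType}.
Local Notation mu := (@lebesgue_measure R).
Implicit Types (u v p q phi psi : R -> R) (x l c sg t K : R).

Definition wd u p := [/\ L2 u, L2 p & weak_derivative u p].

Lemma wdP u p phi : wd u p -> test_function phi ->
  Int (fun x => u x * derive1 phi x) = - Int (fun x => p x * phi x).
Proof. by move=> [_ _ H] /H. Qed.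

Lemma wdD u p v q : wd u p -> wd v q -> wd (fun x => u x + v x) (fun x => p x + q x).
Proof.
move=> wu wv; have [[lu lp _] [lv lq _]] := (wu, wv).
split; [exact: L2D|exact: L2D|move=> phi tphi].
have l0 := test_L2 tphi; have l1 := test_L2 (test_derive1 tphi).
transitivity (Int (fun x => u x * derive1 phi x) + Int (fun x => v x * derive1 phi x)).
  rewrite -(IntD (intgM lu l1) (intgM lv l1)); apply: eq_Int => x; ring.
rewrite (wdP wu)// (wdP wv)// -opprD; congr (- _).
by rewrite -(IntD (intgM lp l0) (intgM lq l0)); apply: eq_Int => x; ring.
Qed.

Lemma wdZ c u p : wd u p -> wd (fun x => c * u x) (fun x => c * p x).
Proof.
move=> wu; have [lu lp _] := wu.
split; [exact: L2Z|exact: L2Z|move=> phi tphi].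
have l0 := test_L2 tphi; have l1 := test_L2 (test_derive1 tphi).
transitivity (c * Int (fun x => u x * derive1 phi x)).
  rewrite -(IntZ _ (intgM lu l1)); apply: eq_Int => x; ring.
rewrite (wdP wu)// mulrN; congr (- _).
by rewrite -(IntZ _ (intgM lp l0)); apply: eq_Int => x; ring.
Qed.

Lemma wdB u p v q : wd u p -> wd v q -> wd (fun x => u x - v x) (fun x => p x - q x).
Proof.
move=> wu wv; have := wdD wu (wdZ (-1) wv); congr wd; apply/funext => x; ring.
Qed.

Lemma wd_unique u p q : wd u p -> wd u q -> {ae mu, forall x, p x = q x}.
Proof.
move=> wp wq; have [[lu lp _] [_ lq _]] := (wp, wq).
have : {ae mu, forall x, p x - q x = 0}.
  apply: ae0_test; first exact: L2B.
  move=> phi tphi; have l0 := test_L2 tphi.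
  rewrite (eq_Int (g := fun x => p x * phi x - q x * phi x)); last by move=> x; ring.
  rewrite (IntB (intgM lp l0) (intgM lq l0)).
  by rewrite -[Int (fun x => p x * phi x)]opprK -(wdP wp)// (wdP wq)// opprK subrr.
by apply: ae_imply => x /eqP; rewrite subr_eq0 => /eqP.
Qed.

Lemma wderivP u : H1 u -> wd u (wderiv u).
Proof.
move=> [lu [g lg wg]]; rewrite /wderiv; case: xgetP => [q _ [lq wq]|/(_ g)]; first by [].
by case; split.
Qed.

Lemma wd_H1 u p : wd u p -> H1 u.
Proof. by move=> [lu lp wp]; split=> //; exists p. Qed.

Lemma wderiv_ae u p : wd u p -> {ae mu, forall x, wderiv u x = p x}.
Proof. by move=> wu; apply: wd_unique (wderivP (wd_H1 wu)) wu. Qed.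

Lemma wd_test phi : test_function phi -> wd phi (derive1 phi).
Proof.
move=> tphi; have tphi' := test_derive1 tphi.
have l0 := test_L2 tphi; have l1 := test_L2 tphi'.
split=> // psi tpsi; have tpsi' := test_derive1 tpsi.
have k0 := test_L2 tpsi; have k1 := test_L2 tpsi'.
(* differentiate [h |-> Int (phi (x + h) psi (x + h))], which is constant *)
have c (e : R) : 0 < e -> near0 (fun h : R => h != 0 -> forall x : R, `|(1 : R) - 1| <= e).
  by move=> e0; exists 1 => // h _ _ _; rewrite subrr normr0 ltW.
have shL (chi : R -> R) : test_function chi -> cvL2' (fun h x => chi (x + h)) chi.
  move=> tchi e e0; have lchi := test_L2 tchi.
  apply: near0S (translation_continuous 1 lchi e0) => h H _; split; first exact: L2_shift.
  by move: H; rewrite mul1r.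
have shD (chi : R -> R) : test_function chi ->
    cvL2' (fun h x => h^-1 * (chi (x + h) - chi x)) (derive1 chi).
  move=> tchi e e0; have lchi := test_L2 tchi; have lchi' := test_L2 (test_derive1 tchi).
  have [K K0 HK] := test_taylor_nrm tchi.
  have eK : 0 < e / K by rewrite divr_gt0.
  apply: near0S2 (near0_le eK) (near0_le ltr01) => h hK h1 h0.
  have lB := L2B (L2_shift h lchi) lchi; split; first exact: L2Z.
  rewrite (_ : (fun x => _) = fun x => h^-1 * (chi (x + h) - chi x - h * derive1 chi x)).
    rewrite nrmZ; last exact: L2B lB (L2Z h lchi').
    rewrite normfV mulrC ler_pdivrMr ?normr_gt0//; apply: le_trans (HK _ h1) _.
    rewrite -(real_normK (num_real h)) expr2 mulrA ler_wpM2r//.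
    by rewrite mulrC -ler_pdivlMr.
  by apply/funext => x; field.
have m1 : measurable_fun setT (fun _ : R => 1 : R) by exact: measurable_cst.
have b1 (x : R) : `|1 : R| <= 1 by rewrite normr1.
have c1 := trilinear_cvg m1 b1 (fun=> m1) c l1 k0 (shD _ tphi) (shL _ tpsi).
have cstphi : cvL2' (fun=> phi) phi.
  move=> e e0; exists 1 => // h _ _; split => //.
  by rewrite (_ : (fun x => _) = fun=> 0) ?nrm0 ?ltW//; apply/funext => x; rewrite subrr.
have c2 := trilinear_cvg m1 b1 (fun=> m1) c l0 k1 cstphi (shD _ tpsi).
have D := cv0_der (f := fun=> 0) (x := 0) (l := Int (fun x => 1 * derive1 phi x * psi x) +
   Int (fun x => 1 * phi x * derive1 psi x)).
have : der (fun=> 0) 0 (Int (fun x => 1 * derive1 phi x * psi x) +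
   Int (fun x => 1 * phi x * derive1 psi x)).
  apply: D => e e0; apply: near0S (cv0D c1 c2 e0) => h H h0; move: (H h0); congr (`|_ - _| <= _).
  have s0 := L2_shift h l0; have s1 := L2_shift h k0.
  rewrite (eq_Int (g := fun x => h^-1 * (phi (x + h) * psi (x + h) - phi x * psi (x + h)))); last by move=> x; ring.
  rewrite (eq_Int (f := fun x => 1 * phi x * (h^-1 * (psi (x + h) - psi x))) (g := fun x => h^-1 * (phi x * psi (x + h) - phi x * psi x))); last by move=> x; ring.
  have i1 := intgM s0 s1; have i2 := intgM l0 s1; have i3 := intgM l0 k0.
  rewrite (IntZ _ (intgB i1 i2)) (IntZ _ (intgB i2 i3)) (IntB i1 i2) (IntB i2 i3).
  by rewrite (Int_shift h i3); ring.
move=> /(der_uniq (der_cst 0 0)) E.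
have e1 : Int (fun x => 1 * derive1 phi x * psi x) = Int (fun x => derive1 phi x * psi x).
  by apply: eq_Int => x; ring.
have e2 : Int (fun x => 1 * phi x * derive1 psi x) = Int (fun x => phi x * derive1 psi x).
  by apply: eq_Int => x; ring.
apply/eqP; rewrite -addr_eq0 addrC; apply/eqP; rewrite -[RHS]/(0 : R) [RHS]E e1 e2.
by [].
Qed.

Lemma cvL2_cst (f : R -> R) : cvL2 (fun=> f) f.
Proof.
move=> e e0; exists 1 => // h _; rewrite (_ : (fun x => _) = fun=> 0) ?nrm0 ?ltW//.
by apply/funext => x; rewrite subrr.
Qed.

(* A time-independent [u] solves [u_t = u_x - p]: integration by parts becomes an instance of
   [transport_bilinear]. *)
Lemma wd_transport u p : wd u p -> transport 1 (fun=> u) (fun _ x => - p x).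
Proof.
move=> wu; have [lu lp _] := wu.
split=> [//|t _|t _|t _|phi tphi t t0].
- exact: L2N.
- exact: cvL2_cst.
- exact: cvL2_cst.
- rewrite mul1r (wdP wu)// opprK (eq_Int (f := fun x => - p x * phi x) (g := fun x => - (p x * phi x))); last by move=> x; ring.
  by rewrite (IntN (intgM lp (test_L2 tphi))) addNr; exact: der_cst.
Qed.

Lemma wd_product u p v q psi psi1 : wd u p -> wd v q -> weight psi psi1 ->
  Int (fun x => psi1 x * u x * v x) =
  - (Int (fun x => psi x * p x * v x) + Int (fun x => psi x * u x * q x)).
Proof.
move=> wu wv w; have [[lu lp _] [lv lq _]] := (wu, wv).
have := transport_bilinear (wd_transport wu) (wd_transport wv) w ltr01.
move=> /(der_uniq (der_cst _ 1)) /esym; case: w => m m1 [K _ [K0 K1 _]].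
rewrite mulN1r (eq_Int (f := fun x => psi x * (- p x) * v x) (g := fun x => - (psi x * p x * v x))); last by move=> x; ring.
rewrite (eq_Int (f := fun x => psi x * u x * (- q x)) (g := fun x => - (psi x * u x * q x))); last by move=> x; ring.
rewrite (IntN (intgM3 m K0 lp lv)) (IntN (intgM3 m K0 lu lq)); lra.
Qed.

(** Integrating (tanh(k x + b) u^2)' gives k int sech^2(k x + b) u^2 <= 2 |u| |p| <= M in L^2 norms.
    With k = 1/(2d) and the weight centred at [a], sech^2 is at least 3/4 on the ball, so the
    average of u^2 there is at most 4M/3. *)
Lemma wd_sup_bound u p M : wd u p -> nrm u ^+ 2 + nrm p ^+ 2 <= M ->
  {ae mu, forall x, u x ^+ 2 <= 2 * M}.
Proof.
move=> wu uM; have [lu lp _] := wu; apply: ae_le_averages; first exact: L2_sqr.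
move=> a d d0; pose k := (2 * d)^-1; pose b := - a * k.
have k0 : 0 < k by rewrite invr_gt0 mulr_gt0.
have w := weight_poly_affine 'X k b.
have := wd_product wu wu w; case: (w) => m m1 [K _ [K0 K1 _]].
have TK x : `|('X : {poly R}).[tanh (k * x + b)]| <= 1 by rewrite hornerX tanh_norm.
have L (s : R -> R) : L2 s -> nrm (fun x => ('X : {poly R}).[tanh (k * x + b)] * s x) <= nrm s.
  by move=> ls; have := nrmM m TK ls; rewrite mul1r.
have b1 : `|Int (fun x => ('X : {poly R}).[tanh (k * x + b)] * p x * u x)| <= nrm p * nrm u.
  by apply: le_trans (cauchy_schwarz (L2M m TK lp) lu) _; rewrite ler_wpM2r ?nrm_ge0// L.
have b2 : `|Int (fun x => ('X : {poly R}).[tanh (k * x + b)] * u x * p x)| <= nrm u * nrm p.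
  by apply: le_trans (cauchy_schwarz (L2M m TK lu) lp) _; rewrite ler_wpM2r ?nrm_ge0// L.
move=> E.
have {b1 b2 E}up : Int (fun x => k * (derP_tanh 'X).[tanh (k * x + b)] * u x * u x) <= M.
  rewrite E; move: b1 b2; rewrite !ler_norml => /andP[h1 _] /andP[h2 _].
  by apply: le_trans uM; have := sqr_ge0 (nrm u - nrm p); nra.
have iB : intg (fun x => u x ^+ 2 * \1_(ball a d) x).
  apply: (@intg_le _ _ (fun x => u x ^+ 2)); last 2 first.
  - exact: L2_sqr.
  - move=> x; rewrite indicE; case: (_ \in _); rewrite ?mulr1 ?mulr0 ?normr0 ?sqr_ge0//.
    by rewrite ger0_norm ?sqr_ge0.
  - apply: measurable_funM; first by apply: measurable_funX; exact: L2_measurable.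
    by apply: measurable_indic; exact: measurable_ball.
have key : 3 / 4 * k * Int (fun x => u x ^+ 2 * \1_(ball a d) x) <= M.
  apply: le_trans up; rewrite -(IntZ _ iB); apply: le_Int; [exact: intgZ|exact: (intgM3 m1 K1 lu lu)|].
  move=> x; have W0 : 0 <= (derP_tanh 'X).[tanh (k * x + b)].
    rewrite /derP_tanh derivX mul1r hornerD hornerN hornerXn -polyC1 hornerC.
    have := tanh_norm (k * x + b); rewrite ler_norml; nra.
  rewrite indicE; case: (boolP (_ \in _)) => [|_]; last first.
    by rewrite !mulr0 -mulrA -expr2 mulr_ge0 ?sqr_ge0// mulr_ge0// ltW.
  rewrite inE/= /ball/= => xd; rewrite mulr1.
  have h : `|tanh (k * x + b)| <= 1 / 2.
    apply: le_trans (tanh_le _) _; rewrite /b (_ : _ + _ = k * (x - a)); last by ring.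
    rewrite normrM (gtr0_norm k0) /k mulrC ler_pdivrMr ?mulr_gt0// distrC.
    by apply: le_trans (ltW xd) _; rewrite mulrA mul1r mulVf// mul1r.
  have dW : 3 / 4 <= (derP_tanh 'X).[tanh (k * x + b)].
    rewrite /derP_tanh derivX mul1r hornerD hornerN hornerXn -polyC1 hornerC.
    by move: h; rewrite ler_norml => /andP[h1 h2]; nra.
  rewrite [leLHS](_ : _ = 3 / 4 * (k * (u x ^+ 2))); last by ring.
  rewrite [leRHS](_ : _ = (derP_tanh 'X).[tanh (k * x + b)] * (k * (u x ^+ 2))); last by ring.
  by rewrite ler_wpM2r// mulr_ge0 ?sqr_ge0 ?(ltW k0).
have I0 : 0 <= Int (fun x => u x ^+ 2 * \1_(ball a d) x).
  by apply: Int_ge0 => x; rewrite mulr_ge0 ?sqr_ge0// indicE.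
have kd : k * (2 * d) = 1 by rewrite mulVf// gt_eqF// mulr_gt0.
rewrite (_ : d *+ 2 = 2 * d); last by rewrite mulr_natl.
have M0 : 0 <= M by apply: le_trans uM; rewrite addr_ge0 ?sqr_ge0.
have d2 : 0 < 2 * d by rewrite mulr_gt0.
have := ler_wpM2r (ltW d2) key.
rewrite (_ : _ * _ * (2 * d) = 3 / 4 * Int (fun x => u x ^+ 2 * \1_(ball a d) x) * (k * (2 * d))); last by ring.
by rewrite kd mulr1; have := mulr_ge0 M0 (ltW d2); lra.
Qed.

End Sobolev.

(** * Odd functions *)

Section OddFunctions.
Context {R : realType}.
Local Notation mu := (@lebesgue_measure R).
Implicit Types (u v p q phi psi : R -> R) (x y l c t K : R).

(** From exp(2y) >= 1 + 2 y^2; quadratic decay is all that the dominated convergence arguments below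
    use. *)
Lemma one_sub_tanh_le y : 0 <= y -> 1 - tanh y <= 1 / (1 + y ^+ 2).
Proof.
move=> y0; have E0 := expR_gt0 (2 * y).
have y2 : 0 < 1 + y ^+ 2 by rewrite ltr_wpDr ?sqr_ge0.
rewrite /tanh opprB addrC subrK.
have h : 1 + 2 * y ^+ 2 <= expR (2 * y).
  apply: le_trans (expR_ge1Dxn 1 _); last by rewrite mulr_ge0.
  by rewrite lerD2l (_ : 2`!%:R = 2)// exprMn; lra.
rewrite ler_pdivrMr ?addr_gt0// mulrAC ler_pdivlMr// mul1r; lra.
Qed.

Lemma one_sub_tanh_sqr_le y : 1 - tanh y ^+ 2 <= 2 / (1 + y ^+ 2).
Proof.
wlog y0 : y / 0 <= y => [H|].
  have [/H//|/ltW y0] := lerP 0 y.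
  by have := H (- y); rewrite oppr_ge0 tanhN !sqrrN; exact.
have := one_sub_tanh_le y0; have := tanh_ge0 y0; have := ltW (tanh_lt1 y).
set T := tanh y; set d := (1 + y ^+ 2)^-1; rewrite mul1r => T1 T0 h.
rewrite (_ : 1 - T ^+ 2 = (1 - T) * (1 + T)); last by ring.
have : (1 - T) * (1 + T) <= d * 2 by rewrite ler_pM ?subr_ge0//; lra.
lra.
Qed.

Lemma tanh_cvg_sg x : tanh (n.+1%:R * x) @[n --> \oo] --> Num.sg x.
Proof.
wlog x0 : x / 0 <= x => [H|].
  have [/H//|/ltW x0] := lerP 0 x.
  have -> : (fun n : nat => tanh (n.+1%:R * x)) = (fun n => - tanh (n.+1%:R * - x)).
    by apply/funext => n; rewrite mulrN tanhN opprK.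
  have -> : Num.sg x = - Num.sg (- x) by rewrite sgrN opprK.
  by apply: cvgN; apply: H; rewrite oppr_ge0.
have [<-|x1] := eqVneq 0 x.
  by under eq_fun do rewrite mulr0 tanh0; rewrite sgr0; exact: cvg_cst.
have {}x0 : 0 < x by rewrite lt_neqAle x1.
rewrite gtr0_sg//.
have H : 1 - x^-1 * n.+1%:R^-1 @[n --> \oo] --> (1 : R).
  rewrite -[X in _ --> X]subr0 -[X in _ --> _ - X](mulr0 x^-1).
  apply: cvgB; first exact: cvg_cst.
  by apply: cvgM; [exact: cvg_cst|exact: cvg_harmonic].
apply: (@squeeze_cvgr _ _ _ _ _ (fun=> 1) _ _ _ H); last exact: cvg_cst.
apply: nearW => n; rewrite (ltW (tanh_lt1 _)) andbT.
have k0 : 0 < n.+1%:R * x by rewrite mulr_gt0.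
rewrite -invfM mulrC lerBlDr -lerBlDl; apply: le_trans (one_sub_tanh_le (ltW k0)) _.
set y := _ * x in k0 *.
rewrite div1r lef_pV2 ?posrE//; last by rewrite ltr_wpDr ?sqr_ge0.
have := sqr_ge0 (y - 1); nra.
Qed.

Lemma Int_odd (F : R -> R) : intg F -> {ae mu, forall x, F (- x) = - F x} -> Int F = 0.
Proof.
move=> iF oF; have := Int_opp iF; rewrite (eq_Int_ae (g := fun x => - F x)).
- by rewrite (IntN iF); lra.
- exact: intg_measurable (intg_opp iF).
- exact: intg_measurable (intgN iF).
- exact: oF.
Qed.

Lemma measurable_sg : measurable_fun setT (Num.sg : R -> R).
Proof.
have -> : (Num.sg : R -> R) = fun x => \1_(`]0, +oo[%classic) x - \1_(`]-oo, 0[%classic) x.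
  apply/funext => x; rewrite !indicE !mem_setE !in_itv/= andbT.
  by case: sgrP; rewrite ?subrr ?subr0 ?sub0r.
by apply: measurable_funB; apply: measurable_indic; exact: measurable_itv.
Qed.

Lemma sg_norm1 x : `|Num.sg x| <= 1.
Proof. by rewrite normr_sg; case: (x != 0). Qed.

Lemma Int_tanh_cvg f : intg f ->
  Int (fun x => tanh (n.+1%:R * x) * f x) @[n --> \oo] --> Int (fun x => Num.sg x * f x).
Proof.
move=> fi; have mf := intg_measurable fi.
apply: (@Int_dct _ _ _ (fun x => `|f x|)).
- move=> n; apply: measurable_funM => //.
  have [m _ _] := weight_poly_affine 'X (n.+1%:R : R) 0.
  by move: m; congr measurable_fun; apply/funext => x; rewrite hornerX addr0.
- by apply: measurable_funM => //; exact: measurable_sg.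
- exact: intg_norm.
- by apply: aeW => x; apply: cvgM; [exact: tanh_cvg_sg|exact: cvg_cst].
- by move=> n x; rewrite normrM ler_piMl// tanh_norm.
Qed.

(* Since [u] is odd only the odd part of [phi], which is O(x) at 0, is seen by the even
   approximate Dirac masses [k (1 - tanh^2 (k x))]. *)
Lemma odd_dirac_cvg u phi : L2 u -> test_function phi ->
  {ae mu, forall x, u (- x) = - u x} ->
  Int (fun x => n.+1%:R * (1 - tanh (n.+1%:R * x) ^+ 2) * u x * phi x) @[n --> \oo] --> (0 : R).
Proof.
move=> lu tphi ou.
have [N N0 sN] := test_support tphi.
have [L L0 bL] := test_bounded (test_derive1 tphi).
pose phio x := (1 / 2) * (phi x - phi (- x)).
have mphi := test_measurable tphi; have lphi := test_L2 tphi.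
have mphiN : measurable_fun setT (fun x => phi (- x)) by apply: (measurableT_comp mphi).
have lphiN : L2 (fun x => phi (- x)).
  have [M _ bM] := test_bounded tphi.
  by apply: (@L2_bounded_support _ _ N M) => // x h; rewrite sN// normrN.
have le : L2 (fun x => (1 / 2) * (phi x + phi (- x))) by exact: L2Z (L2D lphi lphiN).
have lo : L2 phio by exact: L2Z (L2B lphi lphiN).
(* The factor 1/2 in [phio] compensates the length 2 |x| of the segment from -x to x. *)
have phiox x : `|phio x| <= L * `|x|.
  rewrite /phio normrM ger0_norm//.
  have := @mvt_bound R phi (derive1 phi) L (- x) (2 * x) (fun y _ => test_der y tphi) (fun y _ => bL y).
  by rewrite (_ : - x + 2 * x = x) ?normrM ?(ger0_norm (ler0n _ 2)); [lra|ring].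
pose I : R -> R := \1_(`](- (N + 1)), (N + 1)[%classic).
have lI : L2 (fun x => L * I x) by apply: L2Z; exact: L2_indic_itv.
have phioN x : N + 1 <= `|x| -> phio x = 0.
  by move=> h; rewrite /phio !sN ?normrN ?subrr ?mulr0//; lra.
have mT (k : R) : measurable_fun setT (fun x => k * (1 - tanh (k * x) ^+ 2)).
  have [m _ _] := weight_poly_affine 'X k 0.
  apply: measurable_funM => //; apply: measurable_funB => //; apply: measurable_funX.
  by move: m; congr measurable_fun; apply/funext => x; rewrite hornerX addr0.
have T0 y : 0 <= 1 - tanh y ^+ 2.
  by rewrite subr_ge0 -(real_normK (num_real _)) exprn_ile1// tanh_norm.
have H : Int (fun x => n.+1%:R * (1 - tanh (n.+1%:R * x) ^+ 2) * u x * phio x) @[n --> \oo] --> (0 : R).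
  rewrite -(@Int0 R).
  apply: (@Int_dct _ _ _ (fun x => `|u x * (L * I x)|)).
  - move=> n; apply: measurable_funM; last exact: L2_measurable.
    by apply: measurable_funM; [exact: mT|exact: L2_measurable].
  - exact: measurable_cst.
  - exact: intg_norm (intgM lu lI).
  - apply: aeW => x; have [->|x0] := eqVneq x 0.
      rewrite [X in X @ _ --> _](_ : _ = fun=> 0); first exact: cvg_cst.
      by apply/funext => n; rewrite /phio oppr0 subrr !mulr0.
    (* Away from 0 the approximate Dirac mass is at most 2 / (k x^2), so the integrand is at most
       [A] / k. *)
    pose A := 2 / x ^+ 2 * `|u x * phio x|.
    have H0 : A * n.+1%:R^-1 @[n --> \oo] --> (0 : R).
      by rewrite -[X in _ --> X](mulr0 A); apply: cvgM; [exact: cvg_cst|exact: cvg_harmonic].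
    have H1 : - (A * n.+1%:R^-1) @[n --> \oo] --> (0 : R).
      by rewrite -[X in _ --> X]oppr0; exact: cvgN.
    apply: (@squeeze_cvgr _ _ _ _ _ _ _ _ _ H1 H0); apply: nearW => n; rewrite -ler_norml.
    set k : R := n.+1%:R; have k0 : 0 < k by [].
    rewrite -mulrA normrM /A mulrAC ler_wpM2r// normrM (gtr0_norm k0) (ger0_norm (T0 _)).
    have x2 : 0 < x ^+ 2 by rewrite lt_def sqrf_eq0 x0 sqr_ge0.
    have kx2 : 0 < (k * x) ^+ 2 by rewrite lt_def sqrf_eq0 mulf_neq0 ?(gt_eqF k0)// sqr_ge0.
    rewrite -(@ler_pM2l _ k^-1) ?invr_gt0// mulKf ?gt_eqF//.
    apply: le_trans (one_sub_tanh_sqr_le _) _.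
    rewrite (_ : k^-1 * (2 / x ^+ 2 / k) = 2 / (k * x) ^+ 2).
      by rewrite ler_pM2l// lef_pV2 ?posrE ?ltr_wpDl ?(ltW kx2)//; lra.
    by field; rewrite x0 gt_eqF.
  - move=> n x; set k : R := n.+1%:R; have k0 : 0 < k by [].
    have [xN|xN] := ltrP `|x| (N + 1); last by rewrite phioN// mulr0 normr0.
    rewrite /I indicE mem_set ?mulr1; last by rewrite /= in_itv/= -ltr_norml.
    rewrite (_ : k * _ * u x * phio x = u x * (k * (1 - tanh (k * x) ^+ 2) * phio x)); last by ring.
    rewrite normrM [leRHS]normrM ler_wpM2l// normrM (gtr0_norm L0).
    rewrite normrM (gtr0_norm k0) (ger0_norm (T0 _)).
    apply: le_trans (ler_wpM2l _ (phiox x)) _; first by rewrite mulr_ge0 ?(ltW k0).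
    (* With y = k x the domination, uniform in k, reduces to |y| (1 - tanh^2 y) <= 1, which follows
       from 2 |y| <= 1 + y^2. *)
    rewrite mulrCA ler_piMr ?(ltW L0)//.
    rewrite (_ : k * _ * `|x| = `|k * x| * (1 - tanh (k * x) ^+ 2)); last first.
      by rewrite normrM (gtr0_norm k0); ring.
    set y := k * x; have y2 : 0 < 1 + y ^+ 2 by rewrite ltr_wpDr ?sqr_ge0.
    apply: le_trans (ler_wpM2l (normr_ge0 y) (one_sub_tanh_sqr_le y)) _.
    rewrite mulrA ler_pdivrMr// mul1r.
    have := sqr_ge0 (`|y| - 1); rewrite -(real_normK (num_real y)); nra.
apply: cvg_trans H; apply: near_eq_cvg; apply: nearW => n.
set k : R := n.+1%:R; have k0 : 0 < k by [].
have TK x : `|k * (1 - tanh (k * x) ^+ 2)| <= k.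
  by rewrite normrM gtr0_norm// ler_piMr ?(ltW k0)// ger0_norm// gerBl sqr_ge0.
have ie := intgM3 (mT k) TK lu le; have io := intgM3 (mT k) TK lu lo.
(* The even part of [phi] meets an even mass and the odd [u], so its contribution is exactly 0 for
   every k; only [phio] remains. *)
rewrite [RHS](eq_Int (g := fun x => k * (1 - tanh (k * x) ^+ 2) * u x * ((1 / 2) * (phi x + phi (- x))) +
  k * (1 - tanh (k * x) ^+ 2) * u x * phio x)); last by move=> x; rewrite /phio; lra.
rewrite (IntD ie io) (Int_odd ie) ?add0r//.
by apply: ae_imply ou => x ->; rewrite (mulrN k x) tanhN sqrrN opprK; ring.
Qed.

(** Integrate by parts with the weight tanh(k x) and let k tend to infinity: the weight tends to
    sgn, and its derivative, an approximate Dirac mass at 0, gives nothing in the limit because [u]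
    is odd. *)
Lemma wd_sg u p : wd u p -> {ae mu, forall x, u (- x) = - u x} ->
  wd (fun x => Num.sg x * u x) (fun x => Num.sg x * p x).
Proof.
move=> wu ou; have [lu lp _] := wu; have msg := measurable_sg.
split; [exact: (L2M msg sg_norm1 lu)|exact: (L2M msg sg_norm1 lp)|move=> phi tphi].
have l0 := test_L2 tphi; have l1 := test_L2 (test_derive1 tphi).
have c1 := Int_tanh_cvg (intgM lu l1); have c2 := Int_tanh_cvg (intgM lp l0).
have c3 := odd_dirac_cvg lu tphi ou.
have E n : Int (fun x => n.+1%:R * (1 - tanh (n.+1%:R * x) ^+ 2) * u x * phi x) =
   - (Int (fun x => tanh (n.+1%:R * x) * (p x * phi x)) +
      Int (fun x => tanh (n.+1%:R * x) * (u x * derive1 phi x))).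
  have w := weight_poly_affine 'X (n.+1%:R : R) 0.
  have := wd_product wu (wd_test tphi) w.
  rewrite (eq_Int (g := fun x => n.+1%:R * (1 - tanh (n.+1%:R * x) ^+ 2) * u x * phi x)); last first.
    by move=> x; rewrite /derP_tanh derivX mul1r hornerD hornerN hornerXn -polyC1 hornerC addr0.
  move=> ->; congr (- (_ + _)); apply: eq_Int => x; rewrite hornerX addr0; ring.
have c4 := cvgN (cvgD c2 c1).
have c5 : Int (fun x => n.+1%:R * (1 - tanh (n.+1%:R * x) ^+ 2) * u x * phi x) @[n --> \oo] -->
    - (Int (fun x => Num.sg x * (p x * phi x)) + Int (fun x => Num.sg x * (u x * derive1 phi x))).
  by under eq_fun do rewrite E; exact: c4.
have := cvg_lim (@Rhausdorff R) c3; rewrite (cvg_lim (@Rhausdorff R) c5) => E0.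
have -> : pairing (fun x => Num.sg x * u x) (derive1 phi) = Int (fun x => Num.sg x * (u x * derive1 phi x)).
  by apply: eq_Int => x; ring.
have -> : pairing (fun x => Num.sg x * p x) phi = Int (fun x => Num.sg x * (p x * phi x)).
  by apply: eq_Int => x; ring.
by have {}E0 := E0 eventually_filter; lra.
Qed.

End OddFunctions.

(** * The system in characteristic form *)

Section Families.
Context {R : realType}.
Local Notation mu := (@lebesgue_measure R).
Implicit Types (phi psi : R -> R) (f g s z u n : R -> R -> R) (x c sg t K M : R).

Definition contL2 f := (forall t, 0 < t -> L2 (f t)) /\
  (forall t, 0 < t -> cvL2 (fun h => f (t + h)) (f t)).

Lemma near0_pos t : 0 < t -> near0 (fun h => 0 < t + h).
Proof. by move=> t0; apply: near0S (near0_lt t0) => h; rewrite ltr_norml; lra. Qed.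

Lemma contL2D f g : contL2 f -> contL2 g -> contL2 (fun t x => f t x + g t x).
Proof.
move=> [lf cf] [lg cg]; split=> [t t0|t t0 e e0]; first by apply: L2D; [exact: lf|exact: lg].
have e2 : 0 < e / 2 by rewrite divr_gt0.
apply: near0S2 (near0_pos t0) (near0S2 (fun h a b => conj a b) (cf t t0 _ e2) (cg t t0 _ e2)) => h th [h1 h2].
rewrite (_ : (fun x => _) = fun x => (f (t + h) x - f t x) + (g (t + h) x - g t x)).
  by apply: le_trans (nrmD (L2B (lf _ th) (lf _ t0)) (L2B (lg _ th) (lg _ t0))) _; lra.
by apply/funext => x; ring.
Qed.

Lemma contL2Z c f : contL2 f -> contL2 (fun t x => c * f t x).
Proof.
move=> [lf cf]; split=> [t t0|t t0 e e0]; first by apply: L2Z; exact: lf.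
have e2 : 0 < e / (`|c| + 1) by rewrite divr_gt0// ltr_wpDl.
apply: near0S2 (near0_pos t0) (cf t t0 _ e2) => h th h1.
rewrite (_ : (fun x => _) = fun x => c * (f (t + h) x - f t x)).
  rewrite (nrmZ c (L2B (lf _ th) (lf _ t0))); move: h1; rewrite ler_pdivlMr ?ltr_wpDl//.
  have := nrm_ge0 (fun x => f (t + h) x - f t x); have := normr_ge0 c; nra.
by apply/funext => x; ring.
Qed.

Lemma contL2_eq f g : (forall t x, f t x = g t x) -> contL2 f -> contL2 g.
Proof. by move=> fg; have -> : f = g by apply/funext => t; apply/funext => x. Qed.

Lemma contL2B f g : contL2 f -> contL2 g -> contL2 (fun t x => f t x - g t x).
Proof.
by move=> cf cg; apply: contL2_eq (contL2D cf (contL2Z (-1) cg)) => t x; ring.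
Qed.

Lemma contL2N f : contL2 f -> contL2 (fun t x => - f t x).
Proof. by move=> cf; apply: contL2_eq (contL2Z (-1) cf) => t x; ring. Qed.

Definition contLoo M u := (forall t, 0 < t -> {ae mu, forall x, `|u t x| <= M}) /\
  (forall t, 0 < t -> forall e, 0 < e -> near0 (fun h => {ae mu, forall x, `|u (t + h) x - u t x| <= e})).

(** The sources n u and u p are products of fields in L^2; boundedness and uniform continuity in
    time of one factor keep the product continuous in L^2. *)
Lemma contL2_mul M u n : 0 <= M -> contLoo M u -> contL2 u -> contL2 n ->
  contL2 (fun t x => u t x * n t x).
Proof.
move=> M0 [uM cu] [lu _] [ln cn].
have lun t r : 0 < t -> 0 < r -> L2 (fun x => u t x * n r x).
  by move=> t0 r0; apply: (L2M_ae (L2_measurable (lu t t0)) (uM t t0)); exact: ln.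
split=> [t t0|t t0 e e0]; first exact: lun.
have e2 : 0 < e / 2 / (M + 1) by rewrite !divr_gt0// ltr_wpDl.
have e3 : 0 < e / 2 / (nrm (n t) + 1) by rewrite !divr_gt0// ltr_wpDl ?nrm_ge0.
apply: near0S2 (near0_pos t0) (near0S2 (fun h a b => conj a b) (cn t t0 _ e2) (cu t t0 _ e3)) => h th [h1 h2].
have lB := L2B (ln _ th) (ln _ t0); have lu' := L2B (lu _ th) (lu _ t0).
rewrite (_ : (fun x => _) = fun x => u (t + h) x * (n (t + h) x - n t x) + (u (t + h) x - u t x) * n t x).
  have l1 := L2M_ae (L2_measurable (lu _ th)) (uM _ th) lB.
  have l2 := L2M_ae (L2_measurable lu') h2 (ln _ t0).
  apply: le_trans (nrmD l1 l2) _.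
  apply: le_trans (lerD (nrmM_ae (L2_measurable (lu _ th)) (uM _ th) lB)
    (nrmM_ae (L2_measurable lu') h2 (ln _ t0))) _.
  move: h1; rewrite ler_pdivlMr ?ltr_wpDl// => h1.
  have : e / 2 / (nrm (n t) + 1) * nrm (n t) <= e / 2.
    rewrite -mulrA ler_piMr ?divr_ge0 ?(ltW e0)// mulrC ler_pdivrMr ?ltr_wpDl ?nrm_ge0//; lra.
  have := nrm_ge0 (fun x => n (t + h) x - n t x); nra.
by apply/funext => x; ring.
Qed.

Lemma transport_of sg f s : contL2 f -> contL2 s ->
  (forall phi, test_function phi -> forall t, 0 < t ->
     der (fun r => Int (fun x => f r x * phi x)) t
       (Int (fun x => s t x * phi x) - sg * Int (fun x => f t x * derive1 phi x))) ->
  transport sg f s.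
Proof. by move=> [lf cf] [ls cs] eq; split. Qed.

(** The equation is [transport_bilinear] with a test function as weight. Continuity of the product
    and of its source is assumed, as products of L^2 functions need not lie in L^2. *)
Lemma transport_mul sg f s g z : transport sg f s -> transport sg g z ->
  contL2 (fun t x => f t x * g t x) -> contL2 (fun t x => s t x * g t x + f t x * z t x) ->
  transport sg (fun t x => f t x * g t x) (fun t x => s t x * g t x + f t x * z t x).
Proof.
move=> Tf Tg cf cs; apply: transport_of => // phi tphi t t0.
have w := weight_test tphi; have l0 := test_L2 tphi.
case: (w) => m m1 [K _ [K0 K1 _]].
have [lf ls] := (transport_L2 Tf t0, source_L2 Tf t0).
have [lg lz] := (transport_L2 Tg t0, source_L2 Tg t0).
have := transport_bilinear Tf Tg w t0.
have -> : (fun r => Int (fun x => phi x * f r x * g r x)) = (fun r => Int (fun x => f r x * g r x * phi x)).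
  by apply/funext => r; apply: eq_Int => x; ring.
congr (is_derive _ _ _ _); rewrite -(IntD (intgM3 m K0 ls lg) (intgM3 m K0 lf lz)) addrC mulNr.
by congr (_ - sg * _); apply: eq_Int => x; ring.
Qed.

Definition Q (w a b : R -> R) := Int (fun x => w x * a x * b x).

Definition bounded_weight (w : R -> R) := measurable_fun setT w /\ exists K, forall x, `|w x| <= K.

Lemma weight_bw psi psi1 : weight psi psi1 -> bounded_weight psi /\ bounded_weight psi1.
Proof. by move=> [m m1 [K _ [K0 K1 _]]]; split; split=> //; exists K. Qed.

Lemma intgQ (w a b : R -> R) : bounded_weight w -> L2 a -> L2 b -> intg (fun x => w x * a x * b x).
Proof. by move=> [m [K K0]] la lb; exact: (intgM3 m K0 la lb). Qed.

Lemma QC (w a b : R -> R) : Q w a b = Q w b a.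
Proof. by apply: eq_Int => x; ring. Qed.

Lemma QD (w a b c : R -> R) : bounded_weight w -> L2 a -> L2 b -> L2 c ->
  Q w (fun x => a x + b x) c = Q w a c + Q w b c.
Proof.
move=> bw la lb lc; rewrite /Q -(IntD (intgQ bw la lc) (intgQ bw lb lc)).
by apply: eq_Int => x; ring.
Qed.

Lemma QZ k (w a c : R -> R) : bounded_weight w -> L2 a -> L2 c ->
  Q w (fun x => k * a x) c = k * Q w a c.
Proof. by move=> bw la lc; rewrite /Q -(IntZ k (intgQ bw la lc)); apply: eq_Int => x; ring. Qed.

Lemma QN (w a c : R -> R) : bounded_weight w -> L2 a -> L2 c ->
  Q w (fun x => - a x) c = - Q w a c.
Proof.
by move=> bw la lc; rewrite -mulN1r -QZ//; apply: eq_Int => x; ring.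
Qed.

Lemma QB (w a b c : R -> R) : bounded_weight w -> L2 a -> L2 b -> L2 c ->
  Q w (fun x => a x - b x) c = Q w a c - Q w b c.
Proof. by move=> bw la lb lc; rewrite QD// ?QN//; exact: L2N. Qed.

Lemma transport_Q sg f s g z psi psi1 t : transport sg f s -> transport sg g z ->
  weight psi psi1 -> 0 < t ->
  der (fun r => Q psi (f r) (g r)) t
    (- sg * Q psi1 (f t) (g t) + (Q psi (s t) (g t) + Q psi (f t) (z t))).
Proof. by move=> Tf Tg w t0; exact: transport_bilinear. Qed.

End Families.

(** * Regularity in time of the fields and their transport equations *)

Section KGZ.
Context {R : realType}.
Local Notation mu := (@lebesgue_measure R).
Implicit Types (t r e x k sg : R) (w : R -> R -> R) (phi : R -> R).
Variables (eps : R) (u q n v : R -> R -> R).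
Hypothesis eps0 : 0 < eps.
Hypothesis sol : KGZ_solution u q n v.
Hypothesis u_eps : forall t, 0 <= t -> (H1norm setT (u t) <= eps%:E)%E.

Let p t := wderiv (u t).
Let s t x := - u t x - n t x * u t x.
Let up t x := u t x * p t x.

Lemma H1norm_nrm (w : R -> R) : H1 w ->
  H1norm setT w = (Num.sqrt (nrm w ^+ 2 + nrm (wderiv w) ^+ 2))%:E.
Proof.
move=> Hw; have [lw lp _] := wderivP Hw.
rewrite /H1norm !L2norm_nrm// -!EFin_expe -EFinD poweR_EFin powR12_sqrt//.
by rewrite addr_ge0 ?sqr_ge0.
Qed.

Lemma KGZ_wd t : 0 < t -> wd (u t) (p t).
Proof. by move=> t0; have [Hu _ _ _] := KGZ_mem sol (ltW t0); exact: wderivP. Qed.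

Lemma KGZ_u_le t : 0 < t -> nrm (u t) ^+ 2 + nrm (p t) ^+ 2 <= eps ^+ 2.
Proof.
move=> t0; have [Hu _ _ _] := KGZ_mem sol (ltW t0).
have := u_eps (ltW t0); rewrite H1norm_nrm// lee_fin => h.
rewrite -[leLHS]sqr_sqrtr ?addr_ge0 ?sqr_ge0// ler_sqr ?nnegrE ?sqrtr_ge0//.
exact: ltW.
Qed.

Lemma KGZ_u_sup t : 0 < t -> {ae mu, forall x, u t x ^+ 2 <= 2 * eps ^+ 2}.
Proof. by move=> t0; exact: wd_sup_bound (KGZ_wd t0) (KGZ_u_le t0). Qed.

Lemma time_continuous_near0 (N : (R -> R) -> \bar R) (w : R -> R -> R) (t : R) : 0 < t ->
  time_continuous N w -> (forall f, 0 <= N f)%E ->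
  forall e : R, 0 < e -> near0 (fun h => N (fun x => w (t + h)%R x - w t x)%R <= e%:E)%E.
Proof.
move=> t0 cw N0 e e0; have /fine_cvgP[F /cvgrPdist_le /(_ e e0) G] := cw t (ltW t0).
have /nbhs_ballP[d /= d0 H] : nbhs t (fun r => 0 <= r -> N (w r \- w t) \is a fin_num /\
    `|0 - fine (N (w r \- w t))| <= e) by exact: (filterI F G).
apply: near0S2 (near0_pos t0) (near0_lt d0) => h th hd.
have [] := H (t + h); [by rewrite /ball/= opprD addrA subrr sub0r normrN|exact: ltW|].
move=> fin /=; rewrite sub0r normrN ger0_norm ?fine_ge0// => h1.
by rewrite -(fineK fin) lee_fin.
Qed.

Let contL2_of w : (forall t, 0 < t -> L2 (w t)) -> time_continuous (L2norm setT) w -> contL2 w.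
Proof.
move=> lw cw; split=> // t t0 e e0.
have N0 (f : R -> R) : (0 <= L2norm setT f)%E by exact: Lnorm_ge0.
apply: near0S2 (near0_pos t0) (time_continuous_near0 t0 cw N0 e0) => h th.
by rewrite L2norm_nrm ?lee_fin//; exact: (L2B (lw _ th) (lw _ t0)).
Qed.

Lemma KGZ_u_close t : 0 < t -> forall e, 0 < e -> near0 (fun h =>
  nrm (fun x => u (t + h) x - u t x) ^+ 2 + nrm (fun x => p (t + h) x - p t x) ^+ 2 <= e ^+ 2).
Proof.
move=> t0 e e0; have [cu _ _ _] := KGZ_cont sol.
have N0 (f : R -> R) : (0 <= H1norm setT f)%E by exact: poweR_ge0.
apply: near0S2 (near0_pos t0) (time_continuous_near0 t0 cu N0 e0) => h th.
have wB := wdB (KGZ_wd th) (KGZ_wd t0).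
rewrite (H1norm_nrm (wd_H1 wB)) lee_fin => hh.
have [_ lw _] := wderivP (wd_H1 wB); have [_ lp _] := wB.
(* [wderiv] selects an arbitrary representative, so it commutes with subtraction only almost
   everywhere, which is enough for norms. *)
have <- : nrm (wderiv (fun x => u (t + h) x - u t x)) = nrm (fun x => p (t + h) x - p t x).
  by apply: nrm_ae; [exact: L2_measurable|exact: L2_measurable|exact: wderiv_ae].
rewrite -[leLHS]sqr_sqrtr ?addr_ge0 ?sqr_ge0// ler_sqr ?nnegrE ?sqrtr_ge0//.
exact: ltW.
Qed.

Lemma le_of_sqr_sum (a b c : R) : 0 <= c -> a ^+ 2 + b ^+ 2 <= c ^+ 2 -> 0 <= a -> a <= c.
Proof.
by move=> c0 h a0; rewrite -(@ler_sqr R) ?nnegrE//; have := sqr_ge0 b; lra.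
Qed.

Lemma contL2_u : contL2 u.
Proof.
split=> [t t0|t t0 e e0]; first by have [] := KGZ_wd t0.
apply: near0S (KGZ_u_close t0 e0) => h hh.
by apply: le_of_sqr_sum hh (nrm_ge0 _); exact: ltW.
Qed.

Lemma contL2_p : contL2 p.
Proof.
split=> [t t0|t t0 e e0]; first by have [] := KGZ_wd t0.
apply: near0S (KGZ_u_close t0 e0) => h; rewrite addrC => hh.
by apply: le_of_sqr_sum hh (nrm_ge0 _); exact: ltW.
Qed.

Lemma contL2_q : contL2 q.
Proof.
apply: contL2_of => [t t0|]; first by have [] := KGZ_mem sol (ltW t0).
by have [] := KGZ_cont sol.
Qed.

Lemma contL2_n : contL2 n.
Proof.
apply: contL2_of => [t t0|]; first by have [] := KGZ_mem sol (ltW t0).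
by have [] := KGZ_cont sol.
Qed.

Lemma contL2_v : contL2 v.
Proof.
apply: contL2_of => [t t0|]; first by have [] := KGZ_mem sol (ltW t0).
by have [] := KGZ_cont sol.
Qed.

(** The sup bound for H^1 functions applied to [u t] and to its time increments; the square root of
    2 is rounded up to 2. *)
Lemma contLoo_u : contLoo (2 * eps) u.
Proof.
split=> [t t0|t t0 e e0].
  apply: ae_imply (KGZ_u_sup t0) => x h.
  rewrite -(@ler_sqr R) ?nnegrE ?mulr_ge0 ?(ltW eps0)// real_normK ?num_real//.
  by apply: le_trans h _; have := sqr_ge0 eps; nra.
have e2 : 0 < e / 2 by rewrite divr_gt0.
apply: near0S2 (near0_pos t0) (KGZ_u_close t0 e2) => h th hh.
apply: ae_imply (wd_sup_bound (wdB (KGZ_wd th) (KGZ_wd t0)) hh) => x hx.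
rewrite -(@ler_sqr R) ?nnegrE ?(ltW e0)// real_normK ?num_real//.
by apply: le_trans hx _; have := sqr_ge0 e; nra.
Qed.

Let eps2 : 0 <= 2 * eps. Proof. by rewrite mulr_ge0 ?(ltW eps0). Qed.

Lemma contL2_umul w : contL2 w -> contL2 (fun t x => u t x * w t x).
Proof. exact: (contL2_mul eps2 contLoo_u contL2_u). Qed.

Lemma contL2_s : contL2 s.
Proof.
apply: contL2B; first exact: contL2N contL2_u.
by apply: contL2_eq (contL2_umul contL2_n) => t x; ring.
Qed.

Lemma contL2_up : contL2 up.
Proof. exact: contL2_umul contL2_p. Qed.

Lemma pairing_p t phi : 0 < t -> test_function phi ->
  Int (fun x => u t x * derive1 phi x) = - Int (fun x => p t x * phi x).
Proof. by move=> t0; exact: wdP (KGZ_wd t0). Qed.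

Lemma der_u phi t : test_function phi -> 0 < t ->
  der (fun r => Int (fun x => u r x * phi x)) t (Int (fun x => q t x * phi x)).
Proof. by move=> tphi t0; have [] := KGZ_eq sol tphi t0. Qed.

(** This is u_t = q tested against phi': mixed derivatives commute in the weak sense. *)
Lemma der_p phi t : test_function phi -> 0 < t ->
  der (fun r => Int (fun x => p r x * phi x)) t (- Int (fun x => q t x * derive1 phi x)).
Proof.
move=> tphi t0; have h := derN (der_u (test_derive1 tphi) t0) (erefl _).
apply: der_near h; first exact: t0.
by move=> r; rewrite ltr_norml => rt; rewrite pairing_p ?opprK//; lra.
Qed.

Lemma der_q phi t : test_function phi -> 0 < t ->
  der (fun r => Int (fun x => q r x * phi x)) t
    (Int (fun x => s t x * phi x) - Int (fun x => p t x * derive1 phi x)).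
Proof.
move=> tphi t0; have [_ h _ _] := KGZ_eq sol tphi t0.
have l0 := test_L2 tphi; have [lu _ _] := KGZ_wd t0.
have lnu : L2 (fun x => n t x * u t x).
  by have := (contL2_umul contL2_n).1 t t0; congr L2; apply/funext => x; rewrite mulrC.
move: h; congr (is_derive _ _ _ _).
have -> : pairing (u t) (derive1n 2 phi) = - Int (fun x => p t x * derive1 phi x).
  by rewrite derive1nS derive1n1; exact: pairing_p t0 (test_derive1 tphi).
have -> : pairing (u t) phi = Int (fun x => u t x * phi x) by [].
have -> : pairing (n t \* u t) phi = Int (fun x => n t x * u t x * phi x) by [].
rewrite -addrA addrC; congr (_ - _).
rewrite -opprD -(IntD (intgM lu l0) (intgM lnu l0)) -(IntN (intgD (intgM lu l0) (intgM lnu l0))).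
by apply: eq_Int => x; rewrite /s; ring.
Qed.

Lemma der_n phi t : test_function phi -> 0 < t ->
  der (fun r => Int (fun x => n r x * phi x)) t (Int (fun x => v t x * derive1 phi x)).
Proof. by move=> tphi t0; have [] := KGZ_eq sol tphi t0. Qed.

Lemma pairing_uu t phi : 0 < t -> test_function phi ->
  Int (fun x => u t x ^+ 2 * derive1 phi x) = - 2 * Int (fun x => up t x * phi x).
Proof.
move=> t0 tphi; have := wd_product (KGZ_wd t0) (KGZ_wd t0) (weight_test tphi).
have -> : Int (fun x => derive1 phi x * u t x * u t x) = Int (fun x => u t x ^+ 2 * derive1 phi x).
  by apply: eq_Int => x; ring.
have -> : Int (fun x => phi x * p t x * u t x) = Int (fun x => up t x * phi x).
  by apply: eq_Int => x; rewrite /up; ring.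
have -> : Int (fun x => phi x * u t x * p t x) = Int (fun x => up t x * phi x).
  by apply: eq_Int => x; rewrite /up; ring.
lra.
Qed.

Lemma contL2_uu : contL2 (fun t x => u t x * u t x).
Proof. exact: contL2_umul contL2_u. Qed.

Lemma der_v phi t : test_function phi -> 0 < t ->
  der (fun r => Int (fun x => v r x * phi x)) t
    (Int (fun x => n t x * derive1 phi x) - 2 * Int (fun x => up t x * phi x)).
Proof.
move=> tphi t0; have [_ _ _ h] := KGZ_eq sol tphi t0.
have l1 := test_L2 (test_derive1 tphi).
have ln := contL2_n.1 t t0; have luu := contL2_uu.1 t t0.
have {}luu : L2 (fun x => u t x ^+ 2) by move: luu; congr L2; apply/funext => x; rewrite expr2.
move: h; congr (is_derive _ _ _ _).
rewrite -mulNr -(pairing_uu t0 tphi) -(IntD (intgM ln l1) (intgM luu l1)).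
by apply: eq_Int => x; ring.
Qed.

Let IntDphi (a b phi : R -> R) : L2 a -> L2 b -> test_function phi ->
  Int (fun x => (a x + b x) * phi x) = Int (fun x => a x * phi x) + Int (fun x => b x * phi x).
Proof.
move=> la lb tphi; have l0 := test_L2 tphi; rewrite -(IntD (intgM la l0) (intgM lb l0)).
by apply: eq_Int => x; ring.
Qed.

Let IntZphi (k : R) (a phi : R -> R) : L2 a -> test_function phi ->
  Int (fun x => (k * a x) * phi x) = k * Int (fun x => a x * phi x).
Proof.
move=> la tphi; have l0 := test_L2 tphi; rewrite -(IntZ k (intgM la l0)).
by apply: eq_Int => x; ring.
Qed.

(** Any speed is allowed, since the term sg u_x can be compensated in the source. As bilinear
    identities need a common speed, [u] can thus be paired with either characteristic field, or with
    itself at speed 0. *)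
Lemma transport_u sg : transport sg u (fun t x => q t x + (- sg) * p t x).
Proof.
apply: transport_of; first exact: contL2_u.
  exact: contL2D contL2_q (contL2Z _ contL2_p).
move=> phi tphi t t0; move: (der_u tphi t0); congr (is_derive _ _ _ _).
rewrite (pairing_p t0 tphi) IntDphi// ?IntZphi//; [ring| | |].
- exact: contL2_p.1.
- exact: contL2_q.1.
- exact: L2Z (contL2_p.1 _ t0).
Qed.

Let sg2 (sg : R) : sg = 1 \/ sg = -1 -> sg * sg = 1.
Proof. by case=> ->; ring. Qed.

(** A Riemann invariant, like [n - sg v] below: [sg * sg = 1] is what recombines the cross terms
    into sg f_x. *)
Lemma transport_qp sg : sg = 1 \/ sg = -1 ->
  transport sg (fun t x => q t x + sg * p t x) s.
Proof.
move=> /sg2 sgE; apply: transport_of; last first.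
- move=> phi tphi t t0; have tphi' := test_derive1 tphi.
  have H r : 0 < r -> forall chi, test_function chi -> Int (fun x => (q r x + sg * p r x) * chi x) =
      Int (fun x => q r x * chi x) + sg * Int (fun x => p r x * chi x).
    move=> r0 chi tchi; rewrite IntDphi// ?IntZphi//; [exact: contL2_p.1|exact: contL2_q.1|].
    exact: L2Z (contL2_p.1 _ r0).
  have h := derD (der_q tphi t0) (derZ (k := sg) (der_p tphi t0) (erefl _)) (erefl _).
  rewrite (H t t0 _ tphi').
  have -> : Int (fun x => s t x * phi x) - sg * (Int (fun x => q t x * derive1 phi x) +
    sg * Int (fun x => p t x * derive1 phi x)) = Int (fun x => s t x * phi x) -
    Int (fun x => p t x * derive1 phi x) + sg * - Int (fun x => q t x * derive1 phi x).
    by rewrite mulrDr mulrA sgE; ring.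
  apply: der_near h; first exact: t0.
  by move=> r; rewrite ltr_norml => rt; rewrite H//; lra.
- exact: contL2_s.
- exact: contL2D contL2_q (contL2Z _ contL2_p).
Qed.

Lemma transport_nv sg : sg = 1 \/ sg = -1 ->
  transport sg (fun t x => n t x + (- sg) * v t x) (fun t x => 2 * sg * up t x).
Proof.
move=> /sg2 sgE; apply: transport_of; last first.
- move=> phi tphi t t0; have tphi' := test_derive1 tphi.
  have H r : 0 < r -> forall chi, test_function chi -> Int (fun x => (n r x + (- sg) * v r x) * chi x) =
      Int (fun x => n r x * chi x) + (- sg) * Int (fun x => v r x * chi x).
    move=> r0 chi tchi; rewrite IntDphi// ?IntZphi//; [exact: contL2_v.1|exact: contL2_n.1|].
    exact: L2Z (contL2_v.1 _ r0).
  have h := derD (der_n tphi t0) (derZ (k := - sg) (der_v tphi t0) (erefl _)) (erefl _).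
  rewrite (H t t0 _ tphi') IntZphi//; last exact: contL2_up.1.
  have -> : 2 * sg * Int (fun x => up t x * phi x) - sg * (Int (fun x => n t x * derive1 phi x) +
    - sg * Int (fun x => v t x * derive1 phi x)) = Int (fun x => v t x * derive1 phi x) +
    - sg * (Int (fun x => n t x * derive1 phi x) - 2 * Int (fun x => up t x * phi x)).
    by rewrite [sg * (_ + _)]mulrDr mulrA mulrN sgE; ring.
  apply: der_near h; first exact: t0.
  by move=> r; rewrite ltr_norml => rt; rewrite H//; lra.
- exact: contL2Z contL2_up.
- exact: contL2D contL2_n (contL2Z _ contL2_v).
Qed.

Lemma transport_uu sg : transport sg (fun t x => u t x * u t x)
  (fun t x => (q t x + (- sg) * p t x) * u t x + u t x * (q t x + (- sg) * p t x)).
Proof.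
apply: transport_mul (transport_u sg) (transport_u sg) contL2_uu _.
have c : contL2 (fun t x => u t x * (q t x + (- sg) * p t x)).
  exact: contL2_umul (contL2D contL2_q (contL2Z _ contL2_p)).
by apply: contL2_eq (contL2Z 2 c) => t x; ring.
Qed.

End KGZ.

(** * Derivatives of weighted quadratic quantities *)

Section Identities.
Context {R : realType}.
Local Notation mu := (@lebesgue_measure R).
Implicit Types (t r e x k sg : R) (w : R -> R).

Lemma der_congr (f g : R -> R) x l l' d : 0 < d -> (forall y, `|y - x| < d -> f y = g y) ->
  l = l' -> der f x l -> der g x l'.
Proof. by move=> d0 fg <-; exact: (der_near d0 fg). Qed.

Lemma QDZ w k (a b c : R -> R) : bounded_weight w -> L2 a -> L2 b -> L2 c ->
  Q w (fun x => a x + k * b x) c = Q w a c + k * Q w b c.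
Proof. by move=> bw la lb lc; rewrite QD// ?QZ//; exact: L2Z. Qed.

Lemma QDZr w k (a b c : R -> R) : bounded_weight w -> L2 a -> L2 b -> L2 c ->
  Q w c (fun x => a x + k * b x) = Q w c a + k * Q w c b.
Proof. by move=> bw la lb lc; rewrite QC QDZ// (QC _ a) (QC _ b). Qed.

Lemma L2DZ k (a b : R -> R) : L2 a -> L2 b -> L2 (fun x => a x + k * b x).
Proof. by move=> la lb; apply: L2D => //; exact: L2Z. Qed.

Lemma Q_sqr w k (a b : R -> R) : bounded_weight w -> L2 a -> L2 b ->
  Q w (fun x => a x + k * b x) (fun x => a x + k * b x) =
  Q w a a + 2 * k * Q w a b + k ^+ 2 * Q w b b.
Proof.
move=> bw la lb; rewrite QDZ ?QDZr//; try exact: L2DZ.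
by rewrite (QC w b a); ring.
Qed.

Variables (u p q n v : R -> R -> R).
Let s t x := - u t x - n t x * u t x.
Let nu t x := n t x * u t x.
Let up t x := u t x * p t x.
Let uq t x := u t x * q t x.
Let uu t x := u t x * u t x.
Hypotheses (cu : contL2 u) (cp : contL2 p) (cq : contL2 q) (cn : contL2 n) (cv : contL2 v).
Hypothesis cmul : forall f : R -> R -> R, contL2 f -> contL2 (fun t x => u t x * f t x).
Hypothesis Tu : forall sg, transport sg u (fun t x => q t x + (- sg) * p t x).
Hypothesis Tqp : forall sg, sg = 1 \/ sg = -1 -> transport sg (fun t x => q t x + sg * p t x) s.
Hypothesis Tnv : forall sg, sg = 1 \/ sg = -1 ->
  transport sg (fun t x => n t x + (- sg) * v t x) (fun t x => 2 * sg * up t x).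
Hypothesis Tuu : forall sg, transport sg uu
  (fun t x => (q t x + (- sg) * p t x) * u t x + u t x * (q t x + (- sg) * p t x)).

Let one1 : (1 : R) = 1 \/ (1 : R) = -1. Proof. by left. Qed.
Let oneN1 : (-1 : R) = 1 \/ (-1 : R) = -1. Proof. by right. Qed.

Let lu t : 0 < t -> L2 (u t). Proof. exact: cu.1. Qed.
Let lp t : 0 < t -> L2 (p t). Proof. exact: cp.1. Qed.
Let lq t : 0 < t -> L2 (q t). Proof. exact: cq.1. Qed.
Let ln t : 0 < t -> L2 (n t). Proof. exact: cn.1. Qed.
Let lv t : 0 < t -> L2 (v t). Proof. exact: cv.1. Qed.
Let lnu t : 0 < t -> L2 (nu t).
Proof. by move=> t0; have := (cmul cn).1 t t0; congr L2; apply/funext => x; rewrite mulrC. Qed.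
Let lup t : 0 < t -> L2 (up t). Proof. exact: (cmul cp).1. Qed.
Let luq t : 0 < t -> L2 (uq t). Proof. exact: (cmul cq).1. Qed.
Let luu t : 0 < t -> L2 (uu t). Proof. exact: (cmul cu).1. Qed.
Let ls t : 0 < t -> L2 (s t).
Proof. by move=> t0; exact: (L2B (L2N (lu t0)) (lnu t0)). Qed.

Variables (psi psi1 : R -> R).
Hypothesis W : weight psi psi1.
Let b0 : bounded_weight psi. Proof. by case: (weight_bw W). Qed.
Let b1 : bounded_weight psi1. Proof. by case: (weight_bw W). Qed.

Let Qs t (a : R -> R) : 0 < t -> L2 a -> Q psi (s t) a = - Q psi (u t) a - Q psi (nu t) a.
Proof.
by move=> t0 la; rewrite QB ?QN//; [exact: lu|exact: L2N (lu t0)|exact: lnu].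
Qed.

Variable t : R.
Hypothesis t0 : 0 < t.
Let pos r : `|r - t| < t -> 0 < r. Proof. by rewrite ltr_norml; lra. Qed.
Let luT := lu t0. Let lpT := lp t0. Let lqT := lq t0. Let lnT := ln t0. Let lvT := lv t0.
Let lupT := lup t0. Let luqT := luq t0. Let luuT := luu t0. Let lsT := ls t0.

(** Polarization: 4 q p = (q + p)^2 - (q - p)^2, each square being transported at its own speed. The
    next three identities rest on the same device, with sums of squares or with n and v. *)
Lemma der_qp : der (fun r => Q psi (q r) (p r)) t
  (- (1 / 2) * (Q psi1 (q t) (q t) + Q psi1 (p t) (p t)) + Q psi (s t) (p t)).
Proof.
have h1 := transport_Q (Tqp one1) (Tqp one1) W t0.
have h2 := transport_Q (Tqp oneN1) (Tqp oneN1) W t0.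
have := derB (derZ (k := 1 / 4) h1 (erefl _)) (derZ (k := 1 / 4) h2 (erefl _)) (erefl _).
apply: (der_congr t0) => [r /pos r0|].
  have [a b] := (lq r0, lp r0); rewrite !Q_sqr//; lra.
rewrite !Q_sqr// !QDZ// !QDZr// (QC psi (q t)) (QC psi (p t)); lra.
Qed.

Lemma der_qq_pp : der (fun r => Q psi (q r) (q r) + Q psi (p r) (p r)) t
  (- 2 * Q psi1 (q t) (p t) + 2 * Q psi (s t) (q t)).
Proof.
have h1 := transport_Q (Tqp one1) (Tqp one1) W t0.
have h2 := transport_Q (Tqp oneN1) (Tqp oneN1) W t0.
have := derD (derZ (k := 1 / 2) h1 (erefl _)) (derZ (k := 1 / 2) h2 (erefl _)) (erefl _).
apply: (der_congr t0) => [r /pos r0|].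
  have [a b] := (lq r0, lp r0); rewrite !Q_sqr//; lra.
rewrite !Q_sqr// !QDZ// !QDZr// (QC psi (q t)) (QC psi (p t)); lra.
Qed.

Let QZup k (a : R -> R) : L2 a -> Q psi (fun x => 2 * k * up t x) a = 2 * k * Q psi (up t) a.
Proof. by move=> la; rewrite QZ. Qed.

Lemma der_nv : der (fun r => Q psi (n r) (v r)) t
  (1 / 2 * (Q psi1 (n t) (n t) + Q psi1 (v t) (v t)) - 2 * Q psi (up t) (n t)).
Proof.
have h1 := transport_Q (Tnv one1) (Tnv one1) W t0.
have h2 := transport_Q (Tnv oneN1) (Tnv oneN1) W t0.
have := derB (derZ (k := 1 / 4) h2 (erefl _)) (derZ (k := 1 / 4) h1 (erefl _)) (erefl _).
apply: (der_congr t0) => [r /pos r0|].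
  have [a b] := (ln r0, lv r0); rewrite !Q_sqr//; lra.
rewrite !Q_sqr// (QC psi _ (fun x => 2 * _ * up t x)) (QC psi _ (fun x => 2 * _ * up t x)).
rewrite !QZup//; [|exact: L2DZ..].
rewrite !QDZr//; lra.
Qed.

Lemma der_nn_vv : der (fun r => Q psi (n r) (n r) + Q psi (v r) (v r)) t
  (2 * Q psi1 (n t) (v t) - 4 * Q psi (up t) (v t)).
Proof.
have h1 := transport_Q (Tnv one1) (Tnv one1) W t0.
have h2 := transport_Q (Tnv oneN1) (Tnv oneN1) W t0.
have := derD (derZ (k := 1 / 2) h2 (erefl _)) (derZ (k := 1 / 2) h1 (erefl _)) (erefl _).
apply: (der_congr t0) => [r /pos r0|].
  have [a b] := (ln r0, lv r0); rewrite !Q_sqr//; lra.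
rewrite !Q_sqr// (QC psi _ (fun x => 2 * _ * up t x)) (QC psi _ (fun x => 2 * _ * up t x)).
rewrite !QZup//; [|exact: L2DZ..].
rewrite !QDZr//; lra.
Qed.

Lemma der_uu : der (fun r => Q psi (u r) (u r)) t (2 * Q psi (u t) (q t)).
Proof.
have := transport_Q (Tu 0) (Tu 0) W t0; rewrite !QDZ// !QDZr//.
by congr (is_derive _ _ _ _); rewrite (QC psi (q t)); lra.
Qed.

(** Half the sum of u (q + p) and u (q - p), with [u] transported at speed 1 in the first product
    and -1 in the second. *)
Lemma der_uq : der (fun r => Q psi (u r) (q r)) t
  (- Q psi1 (u t) (p t) + (Q psi (q t) (q t) - Q psi (p t) (p t)) + Q psi (s t) (u t)).
Proof.
have h1 := transport_Q (Tu 1) (Tqp one1) W t0.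
have h2 := transport_Q (Tu (-1)) (Tqp oneN1) W t0.
have := derD (derZ (k := 1 / 2) h1 (erefl _)) (derZ (k := 1 / 2) h2 (erefl _)) (erefl _).
apply: (der_congr t0) => [r /pos r0|].
  have [a b] := (lq r0, lp r0); have c := lu r0; rewrite !QDZr//; lra.
rewrite !QDZ//; try exact: L2DZ.
by rewrite !QDZr// (QC psi (u t) (s t)) (QC psi (p t) (q t)); lra.
Qed.

Lemma der_nuu : der (fun r => Q psi (n r) (uu r)) t
  (Q psi1 (v t) (uu t) + 2 * (Q psi (n t) (uq t) + Q psi (v t) (up t))).
Proof.
have h1 := transport_Q (Tnv one1) (Tuu 1) W t0.
have h2 := transport_Q (Tnv oneN1) (Tuu (-1)) W t0.
have := derD (derZ (k := 1 / 2) h1 (erefl _)) (derZ (k := 1 / 2) h2 (erefl _)) (erefl _).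
apply: (der_congr t0) => [r /pos r0|].
  have [a b] := (ln r0, lv r0); have c := luu r0; rewrite !QDZ//; lra.
have E k (a : R -> R) : L2 a -> Q psi a (fun x => (q t x + k * p t x) * u t x + u t x * (q t x + k * p t x)) =
    2 * Q psi a (uq t) + 2 * k * Q psi a (up t).
  move=> la; rewrite (_ : (fun x => _ + _) = fun x => 2 * (uq t x + k * up t x)).
    rewrite QC QZ//; last exact: L2DZ.
    by rewrite QC QDZr//; ring.
  by apply/funext => x; rewrite /uq /up; ring.
have lsrc k : L2 (fun x => (q t x + k * p t x) * u t x + u t x * (q t x + k * p t x)).
  have := L2Z 2 (L2DZ k luqT lupT); congr L2; apply/funext => x; rewrite /uq /up; ring.
rewrite !QZup// !QDZ// !E//; lra.
Qed.

(** All terms carrying [psi] cancel (u q, n u q and u p v), leaving fluxes with [psi1]. A constant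
    weight therefore gives conservation and a localized one a bound on the time derivative. *)
Lemma der_energy : der (fun r => 1 / 2 * (Q psi (q r) (q r) + Q psi (p r) (p r) + Q psi (u r) (u r)) +
   1 / 4 * (Q psi (n r) (n r) + Q psi (v r) (v r)) + 1 / 2 * Q psi (n r) (uu r)) t
  (- Q psi1 (q t) (p t) + 1 / 2 * Q psi1 (n t) (v t) + 1 / 2 * Q psi1 (v t) (uu t)).
Proof.
have h1 := derZ (k := 1 / 2) (derD der_qq_pp der_uu (erefl _)) (erefl _).
have h2 := derZ (k := 1 / 4) der_nn_vv (erefl _).
have h3 := derZ (k := 1 / 2) der_nuu (erefl _).
apply: (der_congr t0 _ _ (derD (derD h1 h2 (erefl _)) h3 (erefl _))) => //.
rewrite Qs// (QC psi (up t)).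
have -> : Q psi (nu t) (q t) = Q psi (n t) (uq t) by apply: eq_Int => x; rewrite /nu /uq; ring.
lra.
Qed.

End Identities.

(** * Pointwise inequalities *)

Section Coercivity.
Context {R : realType}.
Local Notation mu := (@lebesgue_measure R).

(* With [y = - (1 - T) P], [P = 1 - 7/10 T + 3/10 T^2] and [z = p - T u], the right-hand side is
   [(z + y u)^2 + (1 - T) H u^2] for a polynomial [H >= 18/100] on [0, 1]. *)
Lemma pointwise_coercive_ge0 (T u p : R) : 0 <= T <= 1 ->
  (p - T * u) ^+ 2 / 10 + 3 / 100 * (1 - T ^+ 2) * u ^+ 2 <=
  p ^+ 2 - T * u * p +
    ((6 / 5 - 2 * T + 9 / 10 * T ^+ 2) * (1 - T ^+ 2)
     - 2 * T * (6 / 5 * T + 3 / 10 * T ^+ 3 - (1 + T ^+ 2))) * u ^+ 2 +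
    2 * (6 / 5 * T + 3 / 10 * T ^+ 3 - (1 + T ^+ 2)) * u * p.
Proof.
move=> /andP[T0 T1].
pose P := 1 - 7 / 10 * T + 3 / 10 * T ^+ 2.
pose y := - (1 - T) * P.
pose S := (1 - T) * (166 / 100 - 33 / 100 * T + 9 / 100 * T ^+ 2).
pose H := 2 / 10 + T * (1 - T) * (S - 6 / 100).
rewrite -subr_ge0.
(* Setting z^2 / 10 aside leaves 9/10 z^2; completing the square again replaces y by 10 y / 9 and
   costs y^2 / 9 = (1 - T)^2 P^2 / 9. *)
have -> : p ^+ 2 - T * u * p +
    ((6 / 5 - 2 * T + 9 / 10 * T ^+ 2) * (1 - T ^+ 2)
     - 2 * T * (6 / 5 * T + 3 / 10 * T ^+ 3 - (1 + T ^+ 2))) * u ^+ 2 +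
    2 * (6 / 5 * T + 3 / 10 * T ^+ 3 - (1 + T ^+ 2)) * u * p -
    ((p - T * u) ^+ 2 / 10 + 3 / 100 * (1 - T ^+ 2) * u ^+ 2) =
  9 / 10 * ((p - T * u) + 10 / 9 * y * u) ^+ 2 +
  (1 - T) * (H - (1 - T) * P ^+ 2 / 9 - 3 / 100 * (1 + T)) * u ^+ 2.
  by rewrite /H /y /S /P; field.
have P0 : 0 <= P by rewrite /P; nra.
have P1 : P <= 1 by rewrite /P; nra.
have S0 : 0 <= S by rewrite /S mulr_ge0 ?subr_ge0//; nra.
have TT : 0 <= T * (1 - T) by rewrite mulr_ge0 ?subr_ge0.
have TT' : T * (1 - T) <= 1 / 4 by have := sqr_ge0 (T - 1 / 2); nra.
have H0 : 18 / 100 <= H.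
  have : 0 <= T * (1 - T) * S by rewrite mulr_ge0.
  by rewrite /H; lra.
have PP : (1 - T) * P ^+ 2 <= 1.
  by rewrite mulr_ile1 ?subr_ge0 ?sqr_ge0 ?exprn_ile1//; lra.
apply: addr_ge0; first by rewrite mulr_ge0 ?sqr_ge0.
by apply: mulr_ge0; rewrite ?sqr_ge0// mulr_ge0 ?subr_ge0//; lra.
Qed.

(** Here [s] stands for sgn(x). Both sides are invariant under (T, p, s) -> (-T, -p, -s), which
    reduces T <= 0 to the half-line case; at the origin all mixed terms vanish. *)
Lemma pointwise_coercive (T u p s : R) : `|T| <= 1 ->
  (s = 1 /\ 0 <= T) \/ (s = -1 /\ T <= 0) \/ (s = 0 /\ T = 0) ->
  (p - T * u) ^+ 2 / 10 + 3 / 100 * (1 - T ^+ 2) * u ^+ 2 <=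
  p ^+ 2 - T * u * p +
    ((6 / 5 + 9 / 10 * T ^+ 2) * (1 - T ^+ 2) - 2 * T * (6 / 5 * T + 3 / 10 * T ^+ 3)) * u ^+ 2 +
    2 * (6 / 5 * T + 3 / 10 * T ^+ 3) * u * p +
    s * ((- 2 * T * (1 - T ^+ 2) + 2 * T * (1 + T ^+ 2)) * u ^+ 2 - 2 * (1 + T ^+ 2) * u * p).
Proof.
rewrite ler_norml => /andP[h1 h2] [[-> T0]|[[-> T0]|[-> ->]]].
- have := @pointwise_coercive_ge0 T u p; rewrite T0 h2 => /(_ isT) h.
  apply: le_trans h _; rewrite le_eqVlt; apply/orP; left; apply/eqP; ring.
- have := @pointwise_coercive_ge0 (- T) u (- p); rewrite oppr_ge0 T0 lerNl h1 => /(_ isT) h.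
  have -> : (p - T * u) ^+ 2 / 10 + 3 / 100 * (1 - T ^+ 2) * u ^+ 2 =
    (- p - - T * u) ^+ 2 / 10 + 3 / 100 * (1 - (- T) ^+ 2) * u ^+ 2 by ring.
  apply: le_trans h _; rewrite le_eqVlt; apply/orP; left; apply/eqP; ring.
- have := sqr_ge0 p; have := sqr_ge0 u; rewrite !expr0n/= !(mul0r, mulr0, subr0, addr0); lra.
Qed.

(* Young: [u^2 n] is absorbed by [n^2] and [u^4]; the last summand, an exact derivative, gives
   [W (1 + T^2) u^4 / 2] up to a cross term with [z = p - T u], small since [u^2 <= 1/200]. *)
Lemma pointwise_virial (T u p n v s W : R) : W = 1 - T ^+ 2 -> `|T| <= 1 ->
  (s = 1 /\ 0 <= T) \/ (s = -1 /\ T <= 0) \/ (s = 0 /\ T = 0) -> u ^+ 2 <= 1 / 200 ->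
  1 / 100 * W ^+ 2 * (p ^+ 2 + u ^+ 2 + n ^+ 2 + v ^+ 2) <=
  W * (p ^+ 2 - T * u * p +
    ((6 / 5 + 9 / 10 * T ^+ 2) * W - 2 * T * (6 / 5 * T + 3 / 10 * T ^+ 3)) * u ^+ 2 +
    2 * (6 / 5 * T + 3 / 10 * T ^+ 3) * u * p +
    s * ((- 2 * T * W + 2 * T * (1 + T ^+ 2)) * u ^+ 2 - 2 * (1 + T ^+ 2) * u * p))
  + 1 / 2 * W * n * u ^+ 2 + 1 / 4 * W * (n ^+ 2 + v ^+ 2)
  + 1 / 2 * (W * (1 - 3 * T ^+ 2) * u ^+ 4 + 4 * W * T * (u * p) * u ^+ 2).
Proof.
move=> WE T1 sT u2; have h := pointwise_coercive u p T1 sT.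
have W0 : 0 <= W by rewrite WE subr_ge0 -(real_normK (num_real T)) exprn_ile1.
have W1 : W <= 1 by rewrite WE gerBl sqr_ge0.
have T2 : T ^+ 2 <= 1 by move: W0; rewrite WE subr_ge0.
rewrite -WE in h; set A := (X in _ <= X) in h.
set z := p - T * u in h.
have -> : W * (1 - 3 * T ^+ 2) * u ^+ 4 + 4 * W * T * (u * p) * u ^+ 2 =
  W * ((1 + T ^+ 2) * u ^+ 4 + 4 * (T * u ^+ 2) * (u * z)) by rewrite /z; ring.
rewrite -[X in _ <= X + _ + _ + _]/(W * A).
have -> : 1 / 100 * W ^+ 2 * (p ^+ 2 + u ^+ 2 + n ^+ 2 + v ^+ 2) =
  W * (1 / 100 * W * (p ^+ 2 + u ^+ 2 + n ^+ 2 + v ^+ 2)) by ring.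
have -> : W * A + 1 / 2 * W * n * u ^+ 2 + 1 / 4 * W * (n ^+ 2 + v ^+ 2) +
    1 / 2 * (W * ((1 + T ^+ 2) * u ^+ 4 + 4 * (T * u ^+ 2) * (u * z))) =
  W * (A + 1 / 2 * n * u ^+ 2 + 1 / 4 * (n ^+ 2 + v ^+ 2) +
    1 / 2 * ((1 + T ^+ 2) * u ^+ 4 + 4 * (T * u ^+ 2) * (u * z))) by ring.
rewrite ler_wpM2l//.
have y1 : - (1 / 8) * n ^+ 2 - 1 / 2 * u ^+ 4 <= 1 / 2 * n * u ^+ 2.
  have := sqr_ge0 (n / 2 + u ^+ 2); rewrite (_ : u ^+ 4 = (u ^+ 2) ^+ 2) -?exprM//; nra.
have y2 : - (1 / 2) * (T ^+ 2 * u ^+ 4) - 8 * (u ^+ 2 * z ^+ 2) <= 4 * (T * u ^+ 2) * (u * z).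
  have := sqr_ge0 (T * u ^+ 2 / 2 + 2 * (u * z)) ; rewrite (_ : u ^+ 4 = (u ^+ 2) ^+ 2) -?exprM//; nra.
have y3 : u ^+ 2 * z ^+ 2 <= 1 / 200 * z ^+ 2 by rewrite ler_wpM2r ?sqr_ge0.
have y4 : 0 <= T ^+ 2 * u ^+ 4 by rewrite mulr_ge0 ?sqr_ge0// (_ : u ^+ 4 = (u ^+ 2) ^+ 2) ?sqr_ge0// -exprM.
have pz : p ^+ 2 <= 2 * z ^+ 2 + 2 * u ^+ 2.
  have -> : p = z + T * u by rewrite /z; ring.
  have := sqr_ge0 (z - T * u); have : (T * u) ^+ 2 <= u ^+ 2.
    by rewrite exprMn ler_piMl ?sqr_ge0.
  nra.
have w1 : W * p ^+ 2 <= 2 * z ^+ 2 + 2 * (W * u ^+ 2).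
  apply: le_trans (ler_wpM2l W0 pz) _; rewrite mulrDr.
  have : W * z ^+ 2 <= z ^+ 2 by rewrite ler_piMl ?sqr_ge0.
  lra.
have w2 : W * n ^+ 2 <= n ^+ 2 by rewrite ler_piMl ?sqr_ge0.
have w3 : W * v ^+ 2 <= v ^+ 2 by rewrite ler_piMl ?sqr_ge0.
have n0 := sqr_ge0 n; have v0 := sqr_ge0 v; have z0 := sqr_ge0 z.
(* The budget: z^2 spends 2/100 in [w1] and 4/200 in [y3] out of 1/10; W u^2 spends 1/100 + 2/100,
   exactly the 3/100 available; n^2 spends 1/8 + 1/100 out of 1/4; the u^4 terms leave T^2 u^4 / 4,
   nonnegative by [y4]. *)
rewrite mulrDl mul1r; lra.
Qed.

End Coercivity.

(** * Coercivity of the virial form *)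

Section Static.
Context {R : realType}.
Local Notation mu := (@lebesgue_measure R).
Local Notation T := (@tanh R).

(** A list of coefficients and integrands reduces each inequality between the quadratic quantities
    [Q] to a pointwise polynomial one. *)
Lemma Int_lin_ge0 (l : seq (R * (R -> R))) :
  foldr (fun i P => intg i.2 /\ P) True l ->
  {ae mu, forall x, 0 <= \sum_(i <- l) i.1 * i.2 x} ->
  0 <= \sum_(i <- l) i.1 * Int i.2.
Proof.
move=> il; suff [ii ->] : intg (fun x => \sum_(i <- l) i.1 * i.2 x) /\
    \sum_(i <- l) i.1 * Int i.2 = Int (fun x => \sum_(i <- l) i.1 * i.2 x).
  by move=> h; have := le_Int_ae (intg0 (R := R)) ii h; rewrite Int0.
elim: l il => [_|i l IH [ii /IH[il e]]].
  rewrite (_ : (fun x => _) = fun=> 0); last by apply/funext => x; rewrite big_nil.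
  by rewrite big_nil Int0; split => //; exact: intg0.
rewrite (_ : (fun x => _) = fun x => i.1 * i.2 x + \sum_(j <- l) j.1 * j.2 x); last first.
  by apply/funext => x; rewrite big_cons.
rewrite big_cons e (IntD (intgZ _ ii) il) (IntZ _ ii); split => //.
exact: intgD (intgZ _ ii) il.
Qed.

Lemma weight_polyE (P : {poly R}) (f f1 : R -> R) : (forall y, P.[y] = f y) ->
  (forall y, P^`().[y] * (1 - y ^+ 2) = f1 y) -> weight (fun x => f (T x)) (fun x => f1 (T x)).
Proof.
move=> Pf Pf1; have := weight_poly P; congr weight; apply/funext => x; first exact: Pf.
by rewrite -Pf1 /derP_tanh hornerM hornerD hornerN hornerXn -polyC1 hornerC.
Qed.

Let evalE := (derivM, derivD, derivN, derivXn, derivX, derivC, hornerM, hornerD, hornerN,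
  hornerMn, hornerXn, hornerX, hornerC).

Lemma weight_tanh : weight (fun x => T x) (fun x => 1 - T x ^+ 2).
Proof.
apply: (@weight_polyE 'X (fun y => y) (fun y => 1 - y ^+ 2)) => y; first by rewrite hornerX.
by rewrite derivX -polyC1 hornerC mul1r.
Qed.

Lemma weight_sech2 : weight (fun x => 1 - T x ^+ 2) (fun x => - 2 * T x * (1 - T x ^+ 2)).
Proof.
by apply: (@weight_polyE (1%:P - 'X^2) (fun y => 1 - y ^+ 2) (fun y => - 2 * y * (1 - y ^+ 2))) => y;
  rewrite !evalE/=; ring.
Qed.

Lemma weight_odd : weight (fun x => (1 - T x ^+ 2) * (6 / 5 * T x + 3 / 10 * T x ^+ 3))
  (fun x => (1 - T x ^+ 2) * ((6 / 5 + 9 / 10 * T x ^+ 2) * (1 - T x ^+ 2)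
     - 2 * T x * (6 / 5 * T x + 3 / 10 * T x ^+ 3))).
Proof.
by apply: (@weight_polyE ((1%:P - 'X^2) * ((6 / 5)%:P * 'X + (3 / 10)%:P * 'X^3))
  (fun y => (1 - y ^+ 2) * (6 / 5 * y + 3 / 10 * y ^+ 3))
  (fun y => (1 - y ^+ 2) * ((6 / 5 + 9 / 10 * y ^+ 2) * (1 - y ^+ 2)
     - 2 * y * (6 / 5 * y + 3 / 10 * y ^+ 3)))) => y; rewrite !evalE/=; field.
Qed.

Lemma weight_even : weight (fun x => - ((1 - T x ^+ 2) * (1 + T x ^+ 2)))
  (fun x => 4 * T x ^+ 3 * (1 - T x ^+ 2)).
Proof.
by apply: (@weight_polyE ('X^4 - 1%:P)
  (fun y => - ((1 - y ^+ 2) * (1 + y ^+ 2))) (fun y => 4 * y ^+ 3 * (1 - y ^+ 2))) => y;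
  rewrite !evalE/=; ring.
Qed.

Lemma weight_cubic : weight (fun x => T x * (1 - T x ^+ 2)) (fun x => (1 - 3 * T x ^+ 2) * (1 - T x ^+ 2)).
Proof.
by apply: (@weight_polyE ('X - 'X^3)
  (fun y => y * (1 - y ^+ 2)) (fun y => (1 - 3 * y ^+ 2) * (1 - y ^+ 2))) => y;
  rewrite !evalE/=; ring.
Qed.

Lemma weight_sech4 : weight (fun x => (1 - T x ^+ 2) ^+ 2) (fun x => - 4 * T x * (1 - T x ^+ 2) ^+ 2).
Proof.
by apply: (@weight_polyE ((1%:P - 'X^2) * (1%:P - 'X^2))
  (fun y => (1 - y ^+ 2) ^+ 2) (fun y => - 4 * y * (1 - y ^+ 2) ^+ 2)) => y;
  rewrite !evalE/=; ring.
Qed.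

Lemma weight_1 : weight (fun _ : R => 1 : R) (fun _ : R => 0 : R).
Proof.
by apply: (@weight_polyE 1%:P (fun=> 1) (fun=> 0)) => y; rewrite !evalE/=; ring.
Qed.

Lemma wd_sqr (u p : R -> R) M : wd u p -> {ae mu, forall x, `|u x| <= M} ->
  wd (fun x => u x * u x) (fun x => 2 * (u x * p x)).
Proof.
move=> wu uM; have [lu lp _] := wu; have mu' := L2_measurable lu.
have lup := L2M_ae mu' uM lp.
split; [exact: (L2M_ae mu' uM lu)|exact: L2Z|move=> phi tphi].
have := wd_product wu wu (weight_test tphi); rewrite /pairing -/(Int _).
have l0 := test_L2 tphi.
have -> : Int (fun x => derive1 phi x * u x * u x) = Int (fun x => u x * u x * derive1 phi x).
  by apply: eq_Int => x; ring.
have -> : Int (fun x => phi x * p x * u x) = Int (fun x => u x * p x * phi x).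
  by apply: eq_Int => x; ring.
have -> : Int (fun x => phi x * u x * p x) = Int (fun x => u x * p x * phi x).
  by apply: eq_Int => x; ring.
move=> ->; rewrite -/(Int (fun x => 2 * (u x * p x) * phi x)).
have -> : Int (fun x => 2 * (u x * p x) * phi x) = 2 * Int (fun x => u x * p x * phi x).
  by rewrite -(IntZ 2 (intgM lup l0)); apply: eq_Int => x; ring.
ring.
Qed.

Definition W (x : R) := 1 - T x ^+ 2.
Definition dW (x : R) := - 2 * T x * (1 - T x ^+ 2).
Definition Wsq (x : R) := (1 - T x ^+ 2) ^+ 2.

Lemma virial_coercive (u p n v : R -> R) : wd u p -> {ae mu, forall x, u (- x) = - u x} ->
  {ae mu, forall x, u x ^+ 2 <= 1 / 200} -> L2 n -> L2 v ->
  1 / 100 * (Q Wsq p p + Q Wsq u u + Q Wsq n n + Q Wsq v v) <=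
  Q W p p + 1 / 2 * Q dW u p + 1 / 2 * Q W n (fun x => u x * u x) +
  1 / 4 * (Q W n n + Q W v v).
Proof.
move=> wu ou u2 lN lv; have [lu lp _] := wu.
have uM : {ae mu, forall x, `|u x| <= 1}.
  by apply: ae_imply u2 => x h; rewrite -(@ler_sqr R) ?nnegrE// real_normK ?num_real// expr1n; lra.
(* Oddness of [u] enters here: it provides the null integral [I2], whose weight jumps at the
   origin. *)
have wsg := wd_sg wu ou; have [lsu lsp _] := wsg.
have wuu := wd_sqr wu uM; have [luu l2up _] := wuu.
have lup : L2 (fun x => u x * p x) by exact: (L2M_ae (L2_measurable lu) uM lp).
(* Adding these three null integrals makes the integrand pointwise nonnegative, by
   [pointwise_virial]; the coefficients 6/5 and 3/10 in the first weight were found numerically. *)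
have I1 := wd_product wu wu weight_odd.
have I2 := wd_product wu wsg weight_even.
have I3 := wd_product wuu wuu weight_cubic.
have [bT bW] := weight_bw weight_tanh; have [_ bdW] := weight_bw weight_sech2.
have [bO bO1] := weight_bw weight_odd; have [bE bE1] := weight_bw weight_even.
have [bC bC1] := weight_bw weight_cubic; have [bWsq _] := weight_bw weight_sech4.
rewrite -subr_ge0.
pose O x := (1 - T x ^+ 2) * (6 / 5 * T x + 3 / 10 * T x ^+ 3).
pose O1 x := (1 - T x ^+ 2) * ((6 / 5 + 9 / 10 * T x ^+ 2) * (1 - T x ^+ 2)
     - 2 * T x * (6 / 5 * T x + 3 / 10 * T x ^+ 3)).
pose E x := - ((1 - T x ^+ 2) * (1 + T x ^+ 2)).
pose E1 x := 4 * T x ^+ 3 * (1 - T x ^+ 2).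
pose C x := T x * (1 - T x ^+ 2).
pose C1 x := (1 - 3 * T x ^+ 2) * (1 - T x ^+ 2).
pose su x := Num.sg x * u x.
pose sp x := Num.sg x * p x.
pose uu x := u x * u x.
pose up2 x := 2 * (u x * p x).
pose q (w a b : R -> R) x := w x * a x * b x.
have := @Int_lin_ge0 [:: (1, q W p p); (1 / 2, q dW u p); (1 / 2, q W n uu);
  (1 / 4, q W n n); (1 / 4, q W v v);
  (1, q O1 u u); (1, q O p u); (1, q O u p);
  (1, q E1 u su); (1, q E p su); (1, q E u sp);
  (1 / 2, q C1 uu uu); (1 / 2, q C up2 uu); (1 / 2, q C uu up2);
  (- (1 / 100), q Wsq p p); (- (1 / 100), q Wsq u u); (- (1 / 100), q Wsq n n); (- (1 / 100), q Wsq v v)].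
rewrite !big_cons !big_nil /= => H.
have : 0 <= 1 * Q W p p + (1 / 2 * Q dW u p + (1 / 2 * Q W n uu + (1 / 4 * Q W n n + (1 / 4 * Q W v v + (1
    * Q O1 u u + (1 * Q O p u + (1 * Q O u p + (1 * Q E1 u su + (1 * Q E p su + (1 * Q E u sp + (1
    / 2 * Q C1 uu uu + (1 / 2 * Q C up2 uu + (1 / 2 * Q C uu up2 + (- (1 / 100) * Q Wsq p p + (- (1
    / 100) * Q Wsq u u + (- (1 / 100) * Q Wsq n n + (- (1 / 100) * Q Wsq v v + 0))))))))))))))))).
  apply: H; first by do !split; exact: intgQ.
  apply: ae_imply u2 => x hx.
  have sT : (Num.sg x = 1 /\ 0 <= T x) \/ (Num.sg x = -1 /\ T x <= 0) \/ (Num.sg x = 0 /\ T x = 0).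
    case: sgrP => [->|x0|x0]; [right; right|left|right; left]; split=> //.
    - exact: tanh0.
    - by apply: tanh_ge0; exact: ltW.
    - by rewrite -oppr_ge0 -tanhN; apply: tanh_ge0; rewrite oppr_ge0 ltW.
  have := pointwise_virial (p x) (n x) (v x) (erefl (1 - T x ^+ 2)) (tanh_norm x) sT hx.
  rewrite -subr_ge0; congr (0 <= _); rewrite !big_cons !big_nil /=.
  by rewrite /q /W /dW /Wsq /O /O1 /E /E1 /C /C1 /su /sp /uu /up2; field.
move: I1 I2 I3; rewrite -/(Q O1 u u) -/(Q O p u) -/(Q O u p).
rewrite -/(Q E1 u su) -/(Q E p su) -/(Q E u sp) -/(Q C1 uu uu) -/(Q C up2 uu) -/(Q C uu up2).
move=> -> -> ->; lra.
Qed.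

End Static.

(** * Local energy and virial functional *)

Section Decay.
Context {R : realType}.
Local Notation mu := (@lebesgue_measure R).
Implicit Types (t r e x : R).

Lemma nondecreasing_der (f f1 : R -> R) t r : 0 < t -> t <= r ->
  (forall x, 0 < x -> der f x (f1 x)) -> (forall x, 0 < x -> 0 <= f1 x) -> f t <= f r.
Proof.
move=> t0 tr df f10; have [x /andP[tx _]|c /andP[tc _] e] := mvt (f := f) (df := f1) tr.
  by apply: df; exact: lt_le_trans tx.
by rewrite -subr_ge0 e mulr_ge0 ?subr_ge0// f10//; exact: lt_le_trans tc.
Qed.

(** No time integral is taken. A bounded nondecreasing [M] has small increments after some [t0]; the
    mean value theorem on [t0, t0 + 1] gives a time where [F] is at most such an increment, and
    afterwards [F] cannot grow back because 4 M - F is nondecreasing. *)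
Lemma barbalat (M M1 F F1 : R -> R) B : (forall t, 0 < t -> der M t (M1 t)) ->
  (forall t, 0 < t -> der F t (F1 t)) -> (forall t, 0 < t -> 0 <= F t <= M1 t) ->
  (forall t, 0 < t -> `|F1 t| <= 4 * M1 t) -> (forall t, 0 < t -> `|M t| <= B) ->
  forall e, 0 < e -> exists2 t0, 0 < t0 & forall t, t0 <= t -> F t <= e.
Proof.
move=> dM dF FM1 F1M1 MB e e0.
have M1_ge0 t : 0 < t -> 0 <= M1 t by move=> /FM1 /andP[a b]; exact: le_trans b.
have incM t r : 0 < t -> t <= r -> M t <= M r.
  by move=> t0 tr; exact: (nondecreasing_der t0 tr dM M1_ge0).
have FM t r : 0 < t -> t <= r -> F r - F t <= 4 * (M r - M t).
  move=> t0 tr; have d x : 0 < x -> der (fun y => 4 * M y - F y) x (4 * M1 x - F1 x).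
    by move=> x0; exact: (derB (derZ (dM x x0) (erefl _)) (dF x x0)).
  have d0 x : 0 < x -> 0 <= 4 * M1 x - F1 x.
    by move=> x0; have := F1M1 x x0; rewrite ler_norml => /andP[_]; lra.
  by have := nondecreasing_der t0 tr d d0; lra.
have hs : has_sup [set M t | t in [set t | 0 < t]].
  split; first by exists (M 1), 1 => //=.
  by exists B => _ [t /= t0 <-]; exact: le_trans (ler_norm _) (MB t t0).
(* One share bounds [F] at the selected time, the other four its later growth. *)
have e5 : 0 < e / 5 by rewrite divr_gt0.
have [_ [t0 /= t00 <-] Mt0] := sup_adherent e5 hs.
have Msup t : 0 < t -> M t <= sup [set M t | t in [set t | 0 < t]].
  by move=> tt; apply: sup_ubound; [case: hs|exists t].
have small t r : t0 <= t -> t <= r -> M r - M t <= e / 5.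
  move=> tt tr; have t1 : 0 < t by exact: lt_le_trans tt.
  have := Msup r (lt_le_trans t1 tr); have := incM _ _ t00 tt; lra.
have [s /andP[s0 s1] Fs] : exists2 s, t0 <= s <= t0 + 1 & F s <= e / 5.
  have tle : t0 <= t0 + 1 by rewrite lerDl.
  have [x /andP[tx _]|c /andP[tc c1] ec] := mvt (f := M) (df := M1) tle.
    by apply: dM; exact: lt_le_trans tx.
  exists c; first by rewrite tc.
  have /andP[_ h] := FM1 c (lt_le_trans t00 tc); apply: le_trans h _.
  have := small _ _ (lexx _) tle; rewrite ec (addrC t0) addrK mulr1; exact.
exists (t0 + 1) => [|t tt]; first by rewrite addr_gt0.
have st : s <= t by exact: le_trans s1 tt.
have := FM s t (lt_le_trans t00 s0) st; have := small s t s0 st; lra.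
Qed.

Local Notation W := (@W R).
Local Notation dW := (@dW R).
Local Notation Wsq := (@Wsq R).
Let dWsq x := - 4 * tanh x * (1 - tanh x ^+ 2) ^+ 2.

Definition energy_norm (w u p q n v : R -> R) := Q w q q + Q w p p + Q w u u + Q w n n + Q w v v.
(** Half of the energy E_KG, with its density weighted by [w]. *)
Definition local_energy (w u p q n v : R -> R) := 1 / 2 * (Q w q q + Q w p p + Q w u u) +
   1 / 4 * (Q w n n + Q w v v) + 1 / 2 * Q w n (fun x => u x * u x).

(** * Inequalities at a fixed time *)

Section pointwise_in_time.
Variables (u p q n v : R -> R).
Hypotheses (wu : wd u p) (lq : L2 q) (ln : L2 n) (lv : L2 v).
Hypothesis u2 : {ae mu, forall x, u x ^+ 2 <= 1 / 200}.

Let lu : L2 u. Proof. by case: wu. Qed.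
Let lp : L2 p. Proof. by case: wu. Qed.
Let uM : {ae mu, forall x, `|u x| <= 1}.
Proof.
by apply: ae_imply u2 => x h; rewrite -(@ler_sqr R) ?nnegrE// real_normK ?num_real// expr1n; lra.
Qed.
Let luu : L2 (fun x => u x * u x). Proof. exact: (L2M_ae (L2_measurable lu) uM lu). Qed.
Let uu x := u x * u x.
Let iq (w a b : R -> R) x := w x * a x * b x.

(** Young's inequality with u^4 / 2, then one factor u^2 is replaced by its bound 1/200. *)
Let cubic (c : R) x : u x ^+ 2 <= 1 / 200 -> c ^+ 2 / 8 + u x ^+ 2 / 400 >= `|1 / 2 * c * u x ^+ 2|.
Proof.
move=> h; have h4 : u x ^+ 2 * u x ^+ 2 <= 1 / 200 * u x ^+ 2 by rewrite ler_wpM2r ?sqr_ge0.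
rewrite ler_norml; apply/andP; split.
  by have := sqr_ge0 (c / 2 + u x ^+ 2); nra.
by have := sqr_ge0 (c / 2 - u x ^+ 2); nra.
Qed.

Lemma energy_lower (w : R -> R) : bounded_weight w -> (forall x, 0 <= w x) ->
  energy_norm w u p q n v <= 8 * local_energy w u p q n v.
Proof.
move=> bw w0; have := @Int_lin_ge0 R [:: (3, iq w q q); (3, iq w p p); (3, iq w u u); (1, iq w n n);
  (1, iq w v v); (4, iq w n uu)].
rewrite !big_cons big_nil /= => H.
have : 0 <= 3 * Q w q q + (3 * Q w p p + (3 * Q w u u + (1 * Q w n n + (1 * Q w v v + (4 * Q w n uu + 0))))).
  apply: H; first by do !split; exact: intgQ.
  apply: ae_imply u2 => x hx; rewrite !big_cons big_nil /= /iq /uu.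
  have -> : 3 * (w x * q x * q x) + (3 * (w x * p x * p x) + (3 * (w x * u x * u x) +
   (1 * (w x * n x * n x) + (1 * (w x * v x * v x) + (4 * (w x * n x * (u x * u x)) + 0))))) =
   w x * (3 * q x ^+ 2 + 3 * p x ^+ 2 + 3 * u x ^+ 2 + n x ^+ 2 + v x ^+ 2 + 8 * (1 / 2 * n x * u x ^+ 2)) by field.
  rewrite mulr_ge0//; have := cubic (n x) hx; rewrite ler_norml => /andP[h _].
  have := sqr_ge0 (q x); have := sqr_ge0 (p x); have := sqr_ge0 (u x).
  have := sqr_ge0 (n x); have := sqr_ge0 (v x); lra.
rewrite /energy_norm /local_energy -/uu; lra.
Qed.

Lemma energy_upper (w : R -> R) : bounded_weight w -> (forall x, 0 <= w x) ->
  0 <= local_energy w u p q n v <= energy_norm w u p q n v.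
Proof.
move=> bw w0.
have D0 : 0 <= energy_norm w u p q n v.
  have Q0 (a : R -> R) : 0 <= Q w a a.
    by apply: Int_ge0 => x; rewrite -mulrA -expr2 mulr_ge0 ?sqr_ge0.
  by rewrite /energy_norm !addr_ge0.
apply/andP; split; first by have := energy_lower bw w0; lra.
have := @Int_lin_ge0 R [:: (1 / 2, iq w q q); (1 / 2, iq w p p); (1 / 2, iq w u u); (3 / 4, iq w n n);
  (3 / 4, iq w v v); (- (1 / 2), iq w n uu)].
rewrite !big_cons big_nil /= => H.
have : 0 <= 1 / 2 * Q w q q + (1 / 2 * Q w p p + (1 / 2 * Q w u u + (3 / 4 * Q w n n + (3 / 4 * Q w v v + (- (1 / 2) * Q w n uu + 0))))).
  apply: H; first by do !split; exact: intgQ.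
  apply: ae_imply u2 => x hx; rewrite !big_cons big_nil /= /iq /uu.
  have -> : 1 / 2 * (w x * q x * q x) + (1 / 2 * (w x * p x * p x) + (1 / 2 * (w x * u x * u x) +
   (3 / 4 * (w x * n x * n x) + (3 / 4 * (w x * v x * v x) + (- (1 / 2) * (w x * n x * (u x * u x)) + 0))))) =
   w x * (1 / 2 * q x ^+ 2 + 1 / 2 * p x ^+ 2 + 1 / 2 * u x ^+ 2 + 3 / 4 * n x ^+ 2 + 3 / 4 * v x ^+ 2 - 1 / 2 * n x * u x ^+ 2) by field.
  rewrite mulr_ge0//; have := cubic (n x) hx; rewrite ler_norml => /andP[_ h].
  have := sqr_ge0 (q x); have := sqr_ge0 (p x); have := sqr_ge0 (u x).
  have := sqr_ge0 (n x); have := sqr_ge0 (v x); lra.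
rewrite /energy_norm /local_energy -/uu; lra.
Qed.

Let bWsq : bounded_weight Wsq. Proof. by case: (weight_bw (weight_sech4 (R := R))). Qed.
Let bW3 : bounded_weight dWsq. Proof. by case: (weight_bw (weight_sech4 (R := R))). Qed.
Let bW : bounded_weight W. Proof. by case: (weight_bw (weight_sech2 (R := R))). Qed.
Let bT : bounded_weight (@tanh R). Proof. by case: (weight_bw (weight_tanh (R := R))). Qed.
Let b1 : bounded_weight (fun _ : R => 1 : R). Proof. by case: (weight_bw (weight_1 (R := R))). Qed.

Let W01 x : 0 <= W x <= 1.
Proof.
rewrite /W gerBl sqr_ge0 andbT subr_ge0 -(real_normK (num_real _)).
by rewrite exprn_ile1// tanh_norm.
Qed.

(** Controls the terms without sign in the derivative of [Q Wsq u q]: since [dWsq] is -4 tanh times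
    [Wsq], the cross term costs at most 2 (p^2 + u^2), and [cubic] pays for n u^2. *)
Lemma uq_lower : 0 <= 2 * Q Wsq p p + 5 / 2 * Q Wsq u u + 1 / 2 * Q Wsq n n - Q dWsq u p
   - Q Wsq n (fun x => u x * u x).
Proof.
have := @Int_lin_ge0 R [:: (2, iq Wsq p p); (5 / 2, iq Wsq u u); (1 / 2, iq Wsq n n); (-1, iq dWsq u p);
  (-1, iq Wsq n uu)].
rewrite !big_cons big_nil /= => H.
have : 0 <= 2 * Q Wsq p p + (5 / 2 * Q Wsq u u + (1 / 2 * Q Wsq n n + (-1 * Q dWsq u p + (-1 * Q Wsq n uu + 0)))).
  apply: H; first by do !split; exact: intgQ.
  apply: ae_imply u2 => x hx; rewrite !big_cons big_nil /= /iq /uu.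
  have -> : 2 * (Wsq x * p x * p x) + (5 / 2 * (Wsq x * u x * u x) + (1 / 2 * (Wsq x * n x * n x) +
    (-1 * (dWsq x * u x * p x) + (-1 * (Wsq x * n x * (u x * u x)) + 0)))) =
    Wsq x * (2 * p x ^+ 2 + 5 / 2 * u x ^+ 2 + 1 / 2 * n x ^+ 2 + 4 * (tanh x * u x * p x) - 2 * (1 / 2 * n x * u x ^+ 2)).
    by rewrite /Wsq /dWsq; field.
  rewrite mulr_ge0 ?sqr_ge0//; have := cubic (n x) hx; rewrite ler_norml => /andP[_ h].
  have h2 : - (u x ^+ 2 + p x ^+ 2) / 2 <= tanh x * u x * p x.
    have := sqr_ge0 (tanh x * u x + p x); have : (tanh x * u x) ^+ 2 <= u x ^+ 2.
      by rewrite exprMn ler_piMl ?sqr_ge0// -(real_normK (num_real _)) exprn_ile1// tanh_norm.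
    nra.
  have := sqr_ge0 (u x); have := sqr_ge0 (n x); lra.
rewrite -/uu; lra.
Qed.

(** The derivative of sech^4 is at most 4 sech^4 in size, so the flux is controlled by the same
    weighted norm; a sign [s] with [s ^+ 2 = 1] treats both halves of the absolute value at once. *)
Lemma flux_bound : `|- Q dWsq q p + 1 / 2 * Q dWsq n v + 1 / 2 * Q dWsq v (fun x => u x * u x)| <=
  4 * energy_norm Wsq u p q n v.
Proof.
suff H s : s ^+ 2 = 1 -> 0 <= 4 * energy_norm Wsq u p q n v +
    s * (- Q dWsq q p + 1 / 2 * Q dWsq n v + 1 / 2 * Q dWsq v (fun x => u x * u x)).
  rewrite ler_norml; have := H 1; have := H (-1); rewrite sqrrN expr1n => /(_ erefl) h1 /(_ erefl) h2.
  by apply/andP; split; lra.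
move=> s1; have := @Int_lin_ge0 R [:: (4, iq Wsq q q); (4, iq Wsq p p); (4, iq Wsq u u); (4, iq Wsq n n);
  (4, iq Wsq v v); (- s, iq dWsq q p); (s / 2, iq dWsq n v); (s / 2, iq dWsq v uu)].
rewrite !big_cons big_nil /= => H.
have : 0 <= 4 * Q Wsq q q + (4 * Q Wsq p p + (4 * Q Wsq u u + (4 * Q Wsq n n + (4 * Q Wsq v v +
   (- s * Q dWsq q p + (s / 2 * Q dWsq n v + (s / 2 * Q dWsq v uu + 0))))))).
  apply: H; first by do !split; exact: intgQ.
  apply: ae_imply u2 => x hx; rewrite !big_cons big_nil /= /iq /uu.
  set T := s * tanh x.
  have T2 : T ^+ 2 <= 1.
    by rewrite /T exprMn s1 mul1r -(real_normK (num_real _)) exprn_ile1// tanh_norm.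
  rewrite (_ : _ + _ = Wsq x * (4 * q x ^+ 2 + 4 * p x ^+ 2 + 4 * u x ^+ 2 + 4 * n x ^+ 2 + 4 * v x ^+ 2 +
    4 * (T * q x * p x) - 2 * (T * n x * v x) - 4 * (1 / 2 * (T * v x) * u x ^+ 2))); last first.
    by rewrite /Wsq /dWsq /T; field.
  rewrite mulr_ge0 ?sqr_ge0//; have := cubic (T * v x) hx; rewrite ler_norml => /andP[_ h].
  have Tv (a : R) : (T * a) ^+ 2 <= a ^+ 2 by rewrite exprMn ler_piMl ?sqr_ge0.
  have h2 : - (q x ^+ 2 + p x ^+ 2) / 2 <= T * q x * p x.
    by have := sqr_ge0 (T * q x + p x); have := Tv (q x); nra.
  have h3 : T * n x * v x <= (n x ^+ 2 + v x ^+ 2) / 2.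
    by have := sqr_ge0 (T * n x - v x); have := Tv (n x); nra.
  have := Tv (v x); have := sqr_ge0 (q x); have := sqr_ge0 (p x); have := sqr_ge0 (u x).
  have := sqr_ge0 (n x); have := sqr_ge0 (v x); lra.
rewrite /energy_norm -/uu; lra.
Qed.

Lemma virial_bound : `|- 500 * (Q (@tanh R) q p - 1 / 2 * Q (@tanh R) n v + 1 / 2 * Q W u q) + Q Wsq u q| <=
  1000 * energy_norm (fun=> 1) u p q n v.
Proof.
suff H s : s ^+ 2 = 1 -> 0 <= 1000 * energy_norm (fun=> 1) u p q n v +
    s * (- 500 * (Q (@tanh R) q p - 1 / 2 * Q (@tanh R) n v + 1 / 2 * Q W u q) + Q Wsq u q).
  rewrite ler_norml; have := H 1; have := H (-1); rewrite sqrrN expr1n => /(_ erefl) h1 /(_ erefl) h2.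
  by apply/andP; split; lra.
move=> s1; pose o := (fun _ : R => 1 : R).
have := @Int_lin_ge0 R [:: (1000, iq o q q); (1000, iq o p p); (1000, iq o u u); (1000, iq o n n);
  (1000, iq o v v); (- (500 * s), iq (@tanh R) q p); (250 * s, iq (@tanh R) n v); (- (250 * s), iq W u q);
  (s, iq Wsq u q)].
rewrite !big_cons big_nil /= => H.
have : 0 <= 1000 * Q o q q + (1000 * Q o p p + (1000 * Q o u u + (1000 * Q o n n + (1000 * Q o v v +
   (- (500 * s) * Q (@tanh R) q p + (250 * s * Q (@tanh R) n v + (- (250 * s) * Q W u q + (s * Q Wsq u q + 0)))))))).
  apply: H; first by do !split; exact: intgQ.
  apply: aeW => x; rewrite !big_cons big_nil /= /iq /o.
  have Tv (k a b : R) : `|k| <= 1 -> `|k * a * b| <= (a ^+ 2 + b ^+ 2) / 2.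
    move=> k1; apply: (@le_trans _ _ (`|a| * `|b|)).
      by rewrite -mulrA normrM -[leRHS]normrM ler_piMl.
    have := sqr_ge0 (`|a| - `|b|); rewrite -(real_normK (num_real a)) -(real_normK (num_real b)).
    nra.
  have sn : `|s| = 1 by apply/eqP; rewrite -(@eqrXn2 _ 2)// ?real_normK ?num_real// s1 expr1n.
  have k1 : `|s * tanh x| <= 1 by rewrite normrM sn mul1r tanh_norm.
  have /andP[w0 w1] := W01 x.
  have k2 : `|s * W x| <= 1 by rewrite normrM sn mul1r ger0_norm.
  have k3 : `|s * Wsq x| <= 1 by rewrite normrM sn mul1r ger0_norm ?sqr_ge0// exprn_ile1.
  rewrite (_ : _ + _ = 1000 * (q x ^+ 2 + p x ^+ 2 + u x ^+ 2 + n x ^+ 2 + v x ^+ 2)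
   - 500 * (s * tanh x * q x * p x) + 250 * (s * tanh x * n x * v x) - 250 * (s * W x * u x * q x)
   + s * Wsq x * u x * q x); last by ring.
  move: (Tv _ (q x) (p x) k1) (Tv _ (n x) (v x) k1) (Tv _ (u x) (q x) k2) (Tv _ (u x) (q x) k3).
  rewrite !ler_norml => /andP[_ h1] /andP[h2 _] /andP[_ h3] /andP[h4 _].
  have := sqr_ge0 (q x); have := sqr_ge0 (p x); have := sqr_ge0 (u x).
  have := sqr_ge0 (n x); have := sqr_ge0 (v x); lra.
rewrite /energy_norm -/o; lra.
Qed.

End pointwise_in_time.

End Decay.

(** * Conclusion *)

Section KGZ_decay.
Context {R : realType}.
Local Notation mu := (@lebesgue_measure R).
Local Notation T := (@tanh R).
Local Notation W := (@W R).
Local Notation dW := (@dW R).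
Local Notation Wsq := (@Wsq R).
Implicit Types (t r e x : R).
Variables (eps : R) (u q n v : R -> R -> R).
Hypotheses (eps0 : 0 < eps) (eps1 : eps <= 1 / 20).
Hypothesis sol : KGZ_solution u q n v.
Hypothesis u_eps : forall t, 0 <= t -> (H1norm setT (u t) <= eps%:E)%E.
Hypothesis u_odd : forall t, 0 <= t -> {ae mu, forall x, u t (- x) = - u t x}.

Let p t := wderiv (u t).
Let s t x := - u t x - n t x * u t x.
Let nu t x := n t x * u t x.
Let up t x := u t x * p t x.
Let uu t x := u t x * u t x.
Let dWsq x := - 4 * tanh x * (1 - tanh x ^+ 2) ^+ 2.

Let cu := contL2_u sol.
Let cp := contL2_p sol.
Let cq := contL2_q sol.
Let cn := contL2_n sol.
Let cv := contL2_v sol.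
Let cmul := @contL2_umul R eps u q n v eps0 sol u_eps.
Let Tu := transport_u sol.
Let Tqp := @transport_qp R eps u q n v eps0 sol u_eps.
Let Tnv := @transport_nv R eps u q n v eps0 sol u_eps.
Let Tuu := transport_uu eps0 sol u_eps.

Let u2 t : 0 < t -> {ae mu, forall x, u t x ^+ 2 <= 1 / 200}.
Proof.
move=> t0; apply: ae_imply (KGZ_u_sup eps0 sol u_eps t0) => x h; apply: le_trans h _.
have : eps ^+ 2 <= (1 / 20) ^+ 2 by rewrite ler_sqr ?nnegrE// ltW.
lra.
Qed.

Let wu t : 0 < t -> wd (u t) (p t). Proof. exact: (KGZ_wd sol). Qed.
Let lu t : 0 < t -> L2 (u t). Proof. exact: cu.1. Qed.
Let lp t : 0 < t -> L2 (p t). Proof. exact: cp.1. Qed.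
Let lq t : 0 < t -> L2 (q t). Proof. exact: cq.1. Qed.
Let ln t : 0 < t -> L2 (n t). Proof. exact: cn.1. Qed.
Let lv t : 0 < t -> L2 (v t). Proof. exact: cv.1. Qed.
Let lnu t : 0 < t -> L2 (nu t).
Proof. by move=> t0; have := (cmul cn).1 t t0; congr L2; apply/funext => x; rewrite mulrC. Qed.

Let D (w : R -> R) t := energy_norm w (u t) (p t) (q t) (n t) (v t).
Let E (w : R -> R) t := local_energy w (u t) (p t) (q t) (n t) (v t).
(* [Q Wsq u q] supplies the [q^2] that the virial derivative lacks; the factor 500 absorbs its
   other terms. *)
Let M t := - 500 * (Q T (q t) (p t) - 1 / 2 * Q T (n t) (v t) + 1 / 2 * Q W (u t) (q t)) +
  Q Wsq (u t) (q t).
Let M1 t := 500 * (Q W (p t) (p t) + 1 / 2 * Q dW (u t) (p t) + 1 / 2 * Q W (n t) (uu t) +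
    1 / 4 * (Q W (n t) (n t) + Q W (v t) (v t))) +
  (- Q dWsq (u t) (p t) + (Q Wsq (q t) (q t) - Q Wsq (p t) (p t)) - Q Wsq (u t) (u t) - Q Wsq (n t) (uu t)).

Let bT : bounded_weight T. Proof. by case: (weight_bw (weight_tanh (R := R))). Qed.
Let bW : bounded_weight W. Proof. by case: (weight_bw (weight_sech2 (R := R))). Qed.
Let bWsq : bounded_weight Wsq. Proof. by case: (weight_bw (weight_sech4 (R := R))). Qed.
Let b1 : bounded_weight (fun _ : R => 1 : R). Proof. by case: (weight_bw (weight_1 (R := R))). Qed.

Let Qs (w a : R -> R) t : bounded_weight w -> 0 < t -> L2 a ->
  Q w (s t) a = - Q w (u t) a - Q w (nu t) a.
Proof.
move=> bw t0 la; rewrite QB ?QN//; [exact: lu|exact: L2N (lu t0)|exact: lnu].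
Qed.

Let der_M t : 0 < t -> der M t (M1 t).
Proof.
move=> t0.
have h1 : der (fun r => Q T (q r) (p r)) t
  (- (1 / 2) * (Q W (q t) (q t) + Q W (p t) (p t)) + Q T (s t) (p t)).
  exact: (der_qp cu cp cq cn cmul Tqp (weight_tanh (R := R)) t0).
have h2 : der (fun r => Q T (n r) (v r)) t
  (1 / 2 * (Q W (n t) (n t) + Q W (v t) (v t)) - 2 * Q T (up t) (n t)).
  exact: (der_nv cp cn cv cmul Tnv (weight_tanh (R := R)) t0).
have h3 : der (fun r => Q W (u r) (q r)) t
  (- Q dW (u t) (p t) + (Q W (q t) (q t) - Q W (p t) (p t)) + Q W (s t) (u t)).
  exact: (der_uq cu cp cq Tu Tqp (weight_sech2 (R := R)) t0).
have h4 : der (fun r => Q Wsq (u r) (q r)) t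
  (- Q dWsq (u t) (p t) + (Q Wsq (q t) (q t) - Q Wsq (p t) (p t)) + Q Wsq (s t) (u t)).
  exact: (der_uq cu cp cq Tu Tqp (weight_sech4 (R := R)) t0).
(* Turns int tanh u p into - 1/2 int sech^2 u^2, which cancels against the u^2 term produced by 1/2
   int sech^2 u q. *)
have I1 : Q W (u t) (u t) = - (Q T (p t) (u t) + Q T (u t) (p t)).
  exact: (wd_product (wu t0) (wu t0) (weight_tanh (R := R))).
(* The coupling of n with u u_x appears in both momenta; the factor 1/2 on [n v] makes the two
   occurrences cancel. *)
have e1 : Q T (nu t) (p t) = Q T (up t) (n t) by apply: eq_Int => x; rewrite /nu /up; ring.
have e2 : Q W (nu t) (u t) = Q W (n t) (uu t) by apply: eq_Int => x; rewrite /nu /uu; ring.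
have e3 : Q Wsq (nu t) (u t) = Q Wsq (n t) (uu t) by apply: eq_Int => x; rewrite /nu /uu; ring.
have h := derD (derZ (k := - 500) (derD (derB h1 (derZ (k := 1 / 2) h2 (erefl _)) (erefl _))
  (derZ (k := 1 / 2) h3 (erefl _)) (erefl _)) (erefl _)) h4 (erefl _).
apply: (der_congr ltr01 _ _ h) => //.
rewrite (Qs bT t0 (lp t0)) (Qs bW t0 (lu t0)) (Qs bWsq t0 (lu t0)) e1 e2 e3.
rewrite (QC T (p t) (u t)) in I1; rewrite /M1; lra.
Qed.

Let der_E w w1 t : weight w w1 -> 0 < t -> der (E w) t
  (- Q w1 (q t) (p t) + 1 / 2 * Q w1 (n t) (v t) + 1 / 2 * Q w1 (v t) (uu t)).
Proof. by move=> ww t0; exact: (der_energy cu cp cq cn cv cmul Tu Tqp Tnv Tuu ww t0). Qed.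

(** Coercivity times 500 gives 5 (p^2 + u^2 + n^2 + v^2); the remaining terms consume at most 3 p^2,
    7/2 u^2 and 1/2 n^2, and q^2 is present with coefficient 1. *)
Let M1_ge t : 0 < t -> D Wsq t <= M1 t.
Proof.
move=> t0.
have h1 := virial_coercive (wu t0) (u_odd (ltW t0)) (u2 t0) (ln t0) (lv t0).
have h2 := uq_lower (wu t0) (ln t0) (u2 t0).
have Q0 (a : R -> R) : 0 <= Q Wsq a a.
  by apply: Int_ge0 => x; rewrite -mulrA -expr2 mulr_ge0 ?sqr_ge0.
have := Q0 (p t); have := Q0 (u t); have := Q0 (n t); have := Q0 (v t).
move: h1 h2; rewrite -/(uu t) -/dWsq /D /energy_norm /M1; lra.
Qed.

(** The reference time is 1 rather than 0 because the equations are available at positive times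
    only. *)
Let energy_const t : 0 < t -> E (fun=> 1) t = E (fun=> 1) 1.
Proof.
have d r : 0 < r -> der (E (fun=> 1)) r 0.
  move=> r0; have Q0 (a b : R -> R) : Q (fun=> 0) a b = 0.
    by rewrite -[RHS](@Int0 R); apply: eq_Int => x; rewrite !mul0r.
  have := der_E (weight_1 (R := R)) r0; rewrite !Q0.
  by congr (is_derive _ _ _ _); lra.
have le a b : 0 < a -> a <= b -> E (fun=> 1) a = E (fun=> 1) b.
  move=> a0 ab; apply/eqP; rewrite eq_le; apply/andP; split.
    by apply: (nondecreasing_der a0 ab d).
  rewrite -lerN2; apply: (nondecreasing_der (f := fun y => - E (fun=> 1) y) (f1 := fun=> - 0) a0 ab).
    by move=> x x0; exact: (derN (d x x0)).
  by move=> x _; rewrite oppr0.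
move=> t0; have [t1|t1] := lerP t 1; first exact: le.
by apply/esym/le => //; exact: ltW.
Qed.

Lemma local_energy_decay e : 0 < e -> exists2 t0, 0 < t0 & forall t, t0 <= t ->
  energy_norm Wsq (u t) (wderiv (u t)) (q t) (n t) (v t) <= e.
Proof.
move=> e0; have e8 : 0 < e / 8 by rewrite divr_gt0.
have Wsq_ge0 x : 0 <= Wsq x by rewrite /Wsq sqr_ge0.
have FM t : 0 < t -> 0 <= E Wsq t <= M1 t.
  move=> t0; have /andP[h0 h1] := energy_upper (wu t0) (lq t0) (ln t0) (lv t0) (u2 t0) bWsq Wsq_ge0.
  by rewrite h0 (le_trans h1)// M1_ge.
have F1M t : 0 < t -> `|- Q dWsq (q t) (p t) + 1 / 2 * Q dWsq (n t) (v t) + 1 / 2 * Q dWsq (v t) (uu t)| <= 4 * M1 t.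
  move=> t0; apply: le_trans (flux_bound (wu t0) (lq t0) (ln t0) (lv t0) (u2 t0)) _.
  by rewrite ler_wpM2l// M1_ge.
(* 8000 is the factor 1000 of [virial_bound] times the factor 8 of [energy_lower]. *)
have MB t : 0 < t -> `|M t| <= 8000 * E (fun=> 1) 1.
  move=> t0; apply: le_trans (virial_bound (wu t0) (lq t0) (ln t0) (lv t0)) _.
  have := energy_lower (wu t0) (lq t0) (ln t0) (lv t0) (u2 t0) b1 (fun=> ler01).
  by have := energy_const t0; rewrite /E => ->; lra.
have [t0 t00 H] := barbalat (@der_M) (fun r hr => der_E (weight_sech4 (R := R)) hr) FM F1M MB e8.
exists t0 => // t tt; have tp : 0 < t by exact: lt_le_trans tt.
apply: le_trans (energy_lower (wu tp) (lq tp) (ln tp) (lv tp) (u2 tp) bWsq Wsq_ge0) _.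
by have := H t tt; rewrite /E -/(p t); lra.
Qed.

End KGZ_decay.

(** * From the weighted norm to norms on a compact interval *)

Section Conclusion.
Context {R : realType}.
Local Notation mu := (@lebesgue_measure R).
Local Notation Wsq := (@Wsq R).

Lemma L2norm_restrict (a b : R) (f : R -> R) : L2 f ->
  L2norm `[a, b] f = (nrm (f \_ `[a, b]))%:E /\ L2 (f \_ `[a, b]).
Proof.
move=> lf; have -> : f \_ `[a, b] = fun x => \1_(`[a, b]%classic) x * f x.
  apply/funext => x; rewrite patchE indicE; case: ifPn => _; by rewrite ?mul1r ?mul0r.
have mi : measurable_fun setT (\1_(`[a, b]%classic) : R -> R).
  by apply: measurable_indic; exact: measurable_itv.
have bi (x : R) : `|\1_(`[a, b]%classic) x : R| <= 1.
  by rewrite indicE; case: (_ \in _); rewrite ?normr1 ?normr0.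
have l2 := L2M mi bi lf; split=> //.
rewrite -(L2norm_nrm l2) /L2norm patch_setT; congr (Lnorm _ _ _).
apply/funext => x /=; congr EFin.
by rewrite patchE indicE; case: ifPn => _; rewrite ?mul1r ?mul0r.
Qed.

Lemma Wsq_lower (a b : R) : a <= b -> exists2 c : R, 0 < c & forall x, a <= x <= b -> c <= Wsq x.
Proof.
move=> ab; have cT : continuous (fun x : R => tanh x ^+ 2).
  rewrite (_ : (fun x => _) = fun x => tanh x * tanh x); last first.
    by apply/funext => x; rewrite expr2.
  by move=> x; exact: der_continuous (derM (der_tanh x) (der_tanh x) (erefl _)).
have [z _ zM] := EVT_max ab (continuous_subspaceT cT).
have z0 : 0 < 1 - tanh z ^+ 2.
  have h1 := tanh_lt1 z; have h2 := tanh_gtN1 z.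
  rewrite (_ : 1 - _ = (1 - tanh z) * (1 + tanh z)); last by ring.
  by rewrite mulr_gt0//; lra.
exists ((1 - tanh z ^+ 2) ^+ 2); first by rewrite exprn_gt0.
move=> x xab; have := zM x; rewrite in_itv/= xab => /(_ isT) h.
by rewrite /Wsq ler_sqr ?nnegrE//; lra.
Qed.

Lemma nrm_restrict_le (a b c : R) (f : R -> R) : (forall x, a <= x <= b -> c <= Wsq x) ->
  0 < c -> L2 f -> c * nrm (f \_ `[a, b]) ^+ 2 <= Q Wsq f f.
Proof.
move=> cW c0 lf; have [_ l2] := L2norm_restrict a b lf.
have [bWsq _] := weight_bw (weight_sech4 (R := R)).
rewrite nrm_sqr -(IntZ c (L2_sqr l2)); apply: le_Int.
- exact: intgZ (L2_sqr l2).
- exact: intgQ.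
move=> x; rewrite patchE; case: ifPn => [|_].
  rewrite inE/= in_itv/= => xab.
  by rewrite -[leRHS]mulrA -expr2 ler_wpM2r ?sqr_ge0// cW.
by rewrite expr0n mulr0 -mulrA -expr2 mulr_ge0 ?sqr_ge0.
Qed.

End Conclusion.

Theorem theorem1p4 (R : realType) :
  exists2 eps0 : R, 0 < eps0 &
  forall eps : R, 0 < eps -> eps <= eps0 ->
  forall C : R, 0 < C ->
  forall u ut n v : R -> R -> R,
    KGZ_solution u ut n v ->
    (KGZ_energy (u 0%R) (ut 0%R) (n 0%R) (v 0%R) < +oo)%E ->
    (forall t : R, 0 <= t ->
      {ae @lebesgue_measure R, forall x, u t (- x) = - u t x}) ->
    (ereal_sup [set H1norm setT (u t) | t in [set t : R | (0 <= t)%R]]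
      <= eps%:E)%E ->
    (ereal_sup [set L2norm setT (ut t) | t in [set t : R | (0 <= t)%R]]
      <= C%:E)%E ->
  forall a b : R, a <= b ->
    (H1norm `[a, b] (u t) + L2norm `[a, b] (ut t)
      + L2norm `[a, b] (n t) + L2norm `[a, b] (v t))%E
      @[t --> +oo%R] --> 0%E.
Proof.
(* With eps <= 1/20 the sup bound gives u^2 <= 2 eps^2 <= 1/200, the threshold of all pointwise
   inequalities. *)
exists (1 / 20) => // eps eps0 eps1 C _ u ut n v sol _ u_odd u_sup _ a b ab.
have u_eps (t : R) : 0 <= t -> (H1norm setT (u t) <= eps%:E)%E.
  by move=> t0; apply: le_trans u_sup; apply: ereal_sup_ubound; exists t.
have [c c0 cW] := Wsq_lower ab.
pose G t := Num.sqrt (nrm ((u t) \_ `[a, b]) ^+ 2 + nrm ((wderiv (u t)) \_ `[a, b]) ^+ 2) +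
  nrm ((ut t) \_ `[a, b]) + nrm ((n t) \_ `[a, b]) + nrm ((v t) \_ `[a, b]).
have GE (t : R) : 0 < t -> (H1norm `[a, b] (u t) + L2norm `[a, b] (ut t)
      + L2norm `[a, b] (n t) + L2norm `[a, b] (v t))%E = (G t)%:E.
  move=> t0; have [Hu lq ln lv] := KGZ_mem sol (ltW t0).
  have [lu lp _] := wderivP Hu.
  rewrite (L2norm_restrict a b lq).1 (L2norm_restrict a b ln).1 (L2norm_restrict a b lv).1.
  rewrite /H1norm (L2norm_restrict a b lu).1 (L2norm_restrict a b lp).1.
  by rewrite -!EFin_expe -[in X in (X `^ _)%E]EFinD poweR_EFin powR12_sqrt ?addr_ge0 ?sqr_ge0.
apply/fine_cvgP; split.
  by exists 0; split => // t t0; rewrite GE.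
apply/cvgrPdist_le => e e0.
(* [c] bounds sech^4 from below on [a, b], so this level of the weighted norm makes each of the four
   local norms at most e / 4; [u] and its derivative share one of them. *)
have e5 : 0 < c * (e / 4) ^+ 2 by rewrite mulr_gt0// exprn_gt0// divr_gt0.
have [t0 t00 H] := local_energy_decay eps0 eps1 sol u_eps u_odd e5.
exists t0; split; first exact: num_real.
move=> t /ltW tt; have tp : 0 < t by exact: lt_le_trans tt.
rewrite /= GE//= sub0r normrN.
have [Hu lq ln lv] := KGZ_mem sol (ltW tp).
have [lu lp _] := wderivP Hu.
have {}H := H t tt; rewrite /energy_norm in H.
have ru := nrm_restrict_le cW c0 lu; have rp := nrm_restrict_le cW c0 lp.
have rq := nrm_restrict_le cW c0 lq; have rn := nrm_restrict_le cW c0 ln.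
have rv := nrm_restrict_le cW c0 lv.
have Q0 (f : R -> R) : 0 <= Q (@Wsq R) f f.
  by apply: Int_ge0 => x; rewrite -mulrA -expr2 mulr_ge0 ?sqr_ge0.
have := (Q0 (u t), Q0 (wderiv (u t)), Q0 (ut t), Q0 (n t), Q0 (v t)) => -[[[[qu qp] qq] qn] qv].
have e4 : 0 <= e / 4 by rewrite divr_ge0// ltW.
have small (y : R) : 0 <= y -> c * y ^+ 2 <= c * (e / 4) ^+ 2 -> y <= e / 4.
  by move=> y0; rewrite ler_pM2l// ler_sqr ?nnegrE.
have s1 : Num.sqrt (nrm ((u t) \_ `[a, b]) ^+ 2 + nrm ((wderiv (u t)) \_ `[a, b]) ^+ 2) <= e / 4.
  by apply: small; rewrite ?sqrtr_ge0// sqr_sqrtr ?addr_ge0 ?sqr_ge0//; lra.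
have s2 : nrm ((ut t) \_ `[a, b]) <= e / 4 by apply: small; rewrite ?nrm_ge0//; lra.
have s3 : nrm ((n t) \_ `[a, b]) <= e / 4 by apply: small; rewrite ?nrm_ge0//; lra.
have s4 : nrm ((v t) \_ `[a, b]) <= e / 4 by apply: small; rewrite ?nrm_ge0//; lra.
rewrite ger0_norm; first by rewrite /G; lra.
by rewrite /G !addr_ge0 ?sqrtr_ge0 ?nrm_ge0.
Qed.
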